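(* Consider the scalar nonlinear stochastic delay differential equation $$dx(t)+\Big(\sum_{k=0}^n a_k(t)x(t-h_k)+\sum_{k=1}^n\int_{t-h_k}^t b_k(s)x(s)\,ds+g(t,x_t)\Big)dt+\sigma(t)x(t-\tau)\,dw(t)=0,\quad t\ge 0,$$ with initial condition $x(s)=\phi(s)$, $s\in[-h,0]$, $\phi\in H_2$, where $|g(t,\varphi)|\le\int_{-h}^0|\varphi(s)|^\alpha dG(s)$ with $\alpha>1$ and $\int_{-h}^0dG(s)<\infty$. Let $n_1,n_2$ be integers with $0\le n_i\le n$, $i=1,2$, and let $S,R,R_k^0,Q_k^0$ be defined from $n_1,n_2$ and the coefficients as in the context. Suppose that $$\inf_{t\ge0}S(t)>0,\qquad \sup_{t\ge0}S(t)<\infty,\qquad \sup_{t\ge0}R(t)<1,$$ and $$\sup_{t\ge0}\frac1{S(t)}\Big[\sum_{k=1}^n\Big(\int_{t-h_k}^t|R_k^0(t,s)|\,ds+\int_t^{t+h_k}Q_k^0(\theta,t)\,d\theta\Big)+\sum_{k=n_1+1}^n\Big(|a_k(t)|+(1+R(t+h_k))|a_k(t+h_k)|\Big)+\sigma^2(t+\tau)\Big]<2.$$ Then the zero solution of the equation is stable in probability.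
   Context: Setting. $w(t)$ is the standard scalar Wiener process on a probability space $(\Omega,\mathfrak F,\mathbf P)$ with its filtration; $\mathbf E$ is expectation. $h_0=0$, $h_k>0$ for $k=1,\dots,n$, $\tau\ge0$, $h=\max[h_1,\dots,h_n,\tau]$. $a_k(t)$, $b_k(t)$, $\sigma(t)$ are bounded (deterministic, real) functions (with $b_k$ defined on $[-h,\infty)$). $x_t$ denotes the segment $x(t+s)$, $s\in[-h,0]$. $H_2$ is the space of $\mathfrak F_0$-adapted stochastic processes $\phi(s)$, $s\in[-h,0]$, with $\|\phi\|_0=\sup_{s\in[-h,0]}|\phi(s)|$ and $\|\phi\|^2=\sup_{s\in[-h,0]}\mathbf E|\phi(s)|^2$. $G(s)$ is a nondecreasing function of bounded variation and integrals with respect to $dG(s)$ are Stieltjes integrals. Definition. The zero solution is stable in probability if for any $\varepsilon_1>0$ and $\varepsilon_2>0$ there exists $\delta>0$ such that the solution $x(t,\phi)$ satisfies $\mathbf P\{\sup_{t\ge0}|x(t,\phi)|>\varepsilon_1\}<\varepsilon_2$ for any initial function $\phi$ with $\mathbf P\{\|\phi\|_0<\delta\}=1$. Notation. Given integers $0\le n_1,n_2\le n$ put $m_1=\min\{n_1,n_2\}$, $m_2=\max\{n_1,n_2\}$ (empty sums are zero), $$S(t)=\sum_{k=0}^{n_1}a_k(t+h_k)+\sum_{k=1}^{n_2}b_k(t)h_k.$$ For $1\le k\le m_2$: $R_k(t,s)=a_k(s+h_k)+(s-t+h_k)b_k(s)$ if $1\le k\le m_1$; $R_k(t,s)=a_k(s+h_k)$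 if $m_1+1\le k\le m_2$ and $n_1>n_2$; $R_k(t,s)=(s-t+h_k)b_k(s)$ if $m_1+1\le k\le m_2$ and $n_1<n_2$. $$R(t)=\sum_{k=1}^{m_2}\int_{t-h_k}^t|R_k(t,s)|\,ds,\qquad I_k(i,j)=1\text{ if }k\in[i,j],\quad I_k(i,j)=0\text{ if }k\notin[i,j].$$ For $k=1,\dots,n$ (terms containing $R_k$ with $k>m_2$ are zero because of the factor $I_k(1,m_2)$): $$R_k^0(t,s)=S(t)R_k(t,s)I_k(1,m_2)-b_k(s)I_k(n_2+1,n),$$ $$P_0(t)=\sum_{i=n_1+1}^n|a_i(t)|+\sum_{i=n_2+1}^n\int_{t-h_i}^t|b_i(\theta)|\,d\theta,$$ $$Q_k^0(t,s)=|R_k^0(t,s)|+P_0(t)|R_k(t,s)|I_k(1,m_2)+R(t)|b_k(s)|I_k(n_2+1,n).$$ *)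

(* Defs.v *)
From HB Require Import structures.
From mathcomp Require Import all_boot all_order all_algebra.
From mathcomp Require Import all_classical all_reals all_analysis.

Set Implicit Arguments.
Unset Strict Implicit.
Unset Printing Implicit Defensive.

Import Order.TTheory GRing.Theory Num.Theory.
Import numFieldNormedType.Exports.

Local Open Scope classical_set_scope.
Local Open Scope ring_scope.

Section Stieltjes.
Context {R : realType} (a b : R) (G : R -> R).

Definition clamp (r : R) : R := Num.max a (Num.min b r).

(* Extend [G] from [[a, b]] to the line by the constants [G a] and [G b], then
   take right limits (as infima).  The measure of this function has mass
   [G a+ - G a] at [a], [G b - G b-] at [b] and [G s+ - G s-] at [s] in between,
   so that it represents the Stieltjes integral over the closed interval. *)
Definition right_limit (s : R) : R := inf [set G (clamp r) | r in `]s, +oo[].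

Hypothesis ndG : {in `[a, b] &, {homo G : s t / s <= t}}.

Let Gclamp_nd (r s : R) : r <= s -> G (clamp r) <= G (clamp s).
Proof.
move=> rs; have [ab|ba] := leP a b; last first.
  suff c t : clamp t = a by rewrite !c.
  by apply/max_idPl; rewrite ge_min (ltW ba).
have c t : clamp t \in `[a, b].
  by rewrite in_itv/= /clamp le_max lexx/= ge_max ab ge_min lexx.
apply: ndG => //; rewrite /clamp ge_max le_max lexx/= le_max; apply/orP; right.
by rewrite le_min ge_min lexx/= ge_min rs orbT.
Qed.

Let lb (s : R) : lbound [set G (clamp r) | r in `]s, +oo[] (G (clamp s)).
Proof. by move=> _ [r /= + <-]; rewrite in_itv/= andbT => /ltW/Gclamp_nd. Qed.

Let ne (s : R) : [set G (clamp r) | r in `]s, +oo[] !=set0.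
Proof. by exists (G (clamp (s + 1))), (s + 1) => //=; rewrite in_itv/= andbT ltrDl. Qed.

Let hi (s : R) : has_inf [set G (clamp r) | r in `]s, +oo[].
Proof. by split; [exact: ne | exists (G (clamp s)); exact: lb]. Qed.

Let right_limit_le (s r : R) : s < r -> right_limit s <= G (clamp r).
Proof.
by move=> sr; apply: ge_inf; [exact: (hi s).2 | exists r => //=; rewrite in_itv/= andbT].
Qed.

Let right_limit_nd : nondecreasing right_limit.
Proof.
move=> s t st; apply: lb_le_inf; first exact: ne.
by move=> _ [r /= + <-]; rewrite in_itv/= andbT => tr; apply/right_limit_le/(le_lt_trans st).
Qed.

Let right_limit_rc : right_continuous right_limit.
Proof.
move=> s; apply/(@cvgrPdist_le _ R^o) => e e0.
have [_ [r /= + <-] re] := inf_adherent e0 (hi s).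
rewrite in_itv/= andbT => sr; near=> t.
have st : s < t by near: t; exact: nbhs_right_gt.
have tr : t < r by near: t; exact: nbhs_right_lt.
rewrite ler0_norm ?opprB ?subr_le0; last exact/right_limit_nd/ltW.
rewrite lerBlDr addrC; apply: le_trans (ltW re).
exact: right_limit_le.
Unshelve. all: by end_near. Qed.

Definition stieltjes_distribution : cumulative R R :=
  HB.pack right_limit
    (isCumulative.Build R _ R right_limit right_limit_nd right_limit_rc).

Definition stieltjes_measure : {measure set (measurableTypeR R) -> \bar R} :=
  lebesgue_stieltjes_measure stieltjes_distribution.

End Stieltjes.
Arguments stieltjes_measure {R a b G} ndG.

Section Processes.
Context {R : realType} {d : measure_display} {Omega : measurableType d}.
Variables (P : probability Omega R) (F : R -> set_system Omega).
Local Notation mu := (@lebesgue_measure R).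

(* Only the indices t >= 0 of [F] matter. *)
Definition is_filtration : Prop :=
  [/\ forall t, 0 <= t -> sigma_algebra setT (F t),
      forall t, 0 <= t -> F t `<=` measurable &
      forall s t, 0 <= s -> s <= t -> F s `<=` F t].

Definition sub_measurable (A : set_system Omega) (X : Omega -> R) : Prop :=
  preimage_set_system setT X measurable `<=` A.

Definition jointly_measurable (D : set R) (X : R -> Omega -> R) : Prop :=
  measurable_fun (D `*` [set: Omega]) (fun p : R * Omega => X p.1 p.2).

Definition increment (w : R -> Omega -> R) (s t : R) (omega : Omega) : R :=
  w t omega - w s omega.

Definition is_wiener (w : R -> Omega -> R) : Prop :=
  [/\ forall t, 0 <= t -> sub_measurable (F t) (w t),
      {ae P, forall omega, w 0 omega = 0},
      {ae P, forall omega, {within `[0, +oo[, continuous (w ^~ omega)}},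
      forall s t (B : set R), 0 <= s -> s < t -> measurable B ->
        P (increment w s t @^-1` B) = normal_prob 0 (Num.sqrt (t - s)) B &
      forall s t (A : set Omega) (B : set R), 0 <= s -> s < t ->
        F s A -> measurable B ->
        P (A `&` increment w s t @^-1` B) = (P A * P (increment w s t @^-1` B))%E].

(* The step process \sum_(i < N) xi_i 1_]t_i, t_(i+1)] with 0 <= t_0 <= t_1 <= ...
   and bounded F_(t_i)-measurable xi_i *)
Record simple_process := SimpleProcess {
  sp_size : nat ;
  sp_time : nat -> R ;
  sp_coef : nat -> Omega -> R ;
  sp_time_ge0 : 0 <= sp_time 0%N ;
  sp_time_nd : {homo sp_time : i j / (i <= j)%N >-> i <= j} ;
  sp_coef_adapted : forall i, sub_measurable (F (sp_time i)) (sp_coef i) ;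
  sp_coef_bounded : forall i, [bounded sp_coef i omega | omega in [set: Omega]] }.

Definition sp_value (Y : simple_process) (s : R) (omega : Omega) : R :=
  \sum_(i < sp_size Y)
    sp_coef Y i omega * \1_(`]sp_time Y i, sp_time Y i.+1]%classic) s.

Definition sp_integral (w : R -> Omega -> R) (Y : simple_process) (t : R)
    (omega : Omega) : R :=
  \sum_(i < sp_size Y) sp_coef Y i omega *
    (w (Num.min t (sp_time Y i.+1)) omega - w (Num.min t (sp_time Y i)) omega).

Definition cvg0_in_probability (X : nat -> Omega -> \bar R) : Prop :=
  forall e : R, 0 < e ->
    P [set omega | (e%:E <= `|X n omega|)%E] @[n --> \oo] --> 0%E.

(* [Z] is a version of the Ito integral of [Y] with respect to [w] over [[0, t]]:
   the limit in probability of the integrals of simple processes that approximate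
   [Y] in L^2(0, t), in probability. *)
Definition is_ito_integral (w Y : R -> Omega -> R) (t : R) (Z : Omega -> R) : Prop :=
  [/\ jointly_measurable `[0, t] Y, measurable_fun setT Z &
      exists Yn : nat -> simple_process,
        cvg0_in_probability (fun n omega =>
          \int[mu]_(s in `[0%R, t]) ((sp_value (Yn n) s omega - Y s omega) ^+ 2)%:E)%E
        /\ cvg0_in_probability (fun n omega =>
          (sp_integral w (Yn n) t omega - Z omega)%:E)].

End Processes.

Section Equation.
Context {R : realType} {d : measure_display} {Omega : measurableType d}.
Variables (P : probability Omega R) (F : R -> set_system Omega).
Variables (w : R -> Omega -> R).
Variables (n : nat) (hd : nat -> R) (tau : R) (a b : nat -> R -> R).
Variables (sigma : R -> R) (g : R -> (R -> R) -> R).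
Local Notation mu := (@lebesgue_measure R).

Definition max_delay : R := \big[Num.max/tau]_(1 <= k < n.+1) hd k.
Local Notation h := max_delay.

(* x_t as a function of s in [-h, 0], extended by zero to the line *)
Definition segment (x : R -> R) (t : R) : R -> R :=
  (fun s => x (t + s)) \_ `[- h, 0].

Definition in_H2 (phi : R -> Omega -> R) : Prop :=
  [/\ jointly_measurable `[- h, 0] phi,
      forall s, s \in `[- h, 0] -> sub_measurable (F 0) (phi s) &
      (ereal_sup [set 'E_P[fun omega => (`|phi s omega| ^+ 2)%R] | s in `[(- h)%R, 0%R]]
         < +oo)%E].

Definition sup_norm (I : set R) (f : R -> R) : \bar R :=
  ereal_sup [set `|f s|%:E | s in I].

Definition drift (x : R -> R) (t : R) : R :=
  \sum_(0 <= k < n.+1) a k t * x (t - hd k)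
  + \sum_(1 <= k < n.+1) \int[mu]_(s in `[t - hd k, t]) (b k s * x s)
  + g t (segment x t).

(* Of the three parts of the drift only the nonlinear one has to be assumed
   integrable: the other two are so almost surely, because the coefficients are
   bounded, the paths are continuous on [0, oo[ and [phi] is in [H_2].
   [Z] is the stochastic integral of sigma(s) x(s - tau) over [[0, t]], so that the
   last clause is the equation in integrated form. *)
Definition is_solution (phi x : R -> Omega -> R) : Prop :=
  [/\ forall s omega, s \in `[- h, 0] -> x s omega = phi s omega,
      (forall t, 0 <= t -> sub_measurable (F t) (x t)) /\
        (forall omega, {within `[0, +oo[, continuous (x ^~ omega)}),
      jointly_measurable `[0, +oo[ (fun t omega => g t (segment (x ^~ omega) t)),
      {ae P, forall omega, forall t, 0 <= t ->
        mu.-integrable `[0, t] (fun s => (g s (segment (x ^~ omega) s))%:E)} &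
      forall t, 0 <= t -> exists Z : Omega -> R,
        is_ito_integral P F w (fun s omega => sigma s * x (s - tau) omega) t Z /\
        {ae P, forall omega,
          x t omega + \int[mu]_(s in `[0, t]) drift (x ^~ omega) s + Z omega
            = phi 0 omega}].

(* The norm of [phi] is a supremum of uncountably many variables without path
   regularity, so the condition of probability one is read as "almost surely"; the
   last event is measurable since [x] is continuous on [0, oo[. *)
Definition stable_in_probability : Prop :=
  forall e1 e2 : R, 0 < e1 -> 0 < e2 -> exists2 delta : R, 0 < delta &
    forall phi x : R -> Omega -> R, in_H2 phi -> is_solution phi x ->
      {ae P, forall omega, (sup_norm `[(- h)%R, 0%R] (phi ^~ omega) < delta%:E)%E} ->
      (P [set omega | (e1%:E < sup_norm `[0%R, +oo[ (x ^~ omega))%E] < e2%:E)%E.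

End Equation.

Section Coefficients.
Context {R : realType}.
Variables (n n1 n2 : nat) (hd : nat -> R) (a b : nat -> R -> R).
Local Notation mu := (@lebesgue_measure R).
Local Notation m1 := (minn n1 n2).
Local Notation m2 := (maxn n1 n2).

Definition Ssum (t : R) : R :=
  \sum_(0 <= k < n1.+1) a k (t + hd k) + \sum_(1 <= k < n2.+1) b k t * hd k.

(* Meaningful for 1 <= k <= m2 only; for k > m2 it is always multiplied by 0. *)
Definition Rker (k : nat) (t s : R) : R :=
  if (k <= m1)%N then a k (s + hd k) + (s - t + hd k) * b k s
  else if (n2 < n1)%N then a k (s + hd k)
  else (s - t + hd k) * b k s.

Definition Rsum (t : R) : R :=
  \sum_(1 <= k < m2.+1) \int[mu]_(s in `[t - hd k, t]) `|Rker k t s|.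

Definition Iind (k i j : nat) : R := (i <= k <= j)%N%:R.

Definition Rker0 (k : nat) (t s : R) : R :=
  Ssum t * Rker k t s * Iind k 1 m2 - b k s * Iind k n2.+1 n.

Definition Psum0 (t : R) : R :=
  \sum_(n1.+1 <= i < n.+1) `|a i t|
  + \sum_(n2.+1 <= i < n.+1) \int[mu]_(u in `[t - hd i, t]) `|b i u|.

Definition Qker0 (k : nat) (t s : R) : R :=
  `|Rker0 k t s| + Psum0 t * `|Rker k t s| * Iind k 1 m2
  + Rsum t * `|b k s| * Iind k n2.+1 n.

End Coefficients.

(* Main.v *)
Require Import Defs.
From mathcomp Require Import all_boot all_order all_algebra.
From mathcomp Require Import all_classical all_reals all_analysis.
From mathcomp Require Import measurable_realfun ring lra.

(** The kernels [R_k] define a memory of the path, and with it the neutral variable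
    [z(t) = x(t) - sum_k int_(t-h_k)^t R_k(t,s) x(s) ds].  Integrating the equation and
    exchanging the order of integration shows that [z] moves with the velocity
    [- (S(t) x(t) + ...)], in which the only delays left are those that [n1] and [n2]
    exclude, up to the nonlinearity and the stochastic integral ([itg_drift],
    [neutral_increment]).

    Ito's formula for [z^2] would give the velocity
    [- 2 z(t) (S(t) x(t) + ...) + sigma(t)^2 x(t - tau)^2].  Every product of two values
    of the path is split by [2 |u v| <= u^2 + v^2] ([linear_drift_le]).  After
    integration in time each past value is counted at its own time, and the coefficient
    of [x(t)^2] becomes the expression of the criterion minus [2 S(t)], which is at most a
    negative constant ([lyapunov_bound]).  The values before time [0] contribute
    [C delta^2].  As long as [|x| <= 2 K], the nonlinearity is at most [(2 K)^(alpha - 1)]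
    times the mean of [|x|] over the lags, and the negative constant absorbs it for small
    [K] ([path_energy_bound]).  When [x] leaves [[-K, K]], the memory compensates at most
    the fraction [sup R < 1] of it, so that [|z| >= (1 - sup R) K / 2] ([neutral_exit]).
    By Chebyshev's inequality the probability of an exit is at most [C (delta / K)^2],
    whatever the time horizon ([exit_probability]), and this is stability in probability.

    Ito's formula and stopping times are replaced by sums over a grid.  With [D] the
    increment of [z] over a step, [z^2] increases by [2 z D + D^2].  The sum runs over the
    steps that begin before the exit, an event known at the beginning of the step.
    There [D] is minus an integral of the drift minus a stochastic increment; the product of
    the latter with [z] has mean zero ([neutral_martingale]) and its square is estimated
    by the inequality half of the isometry ([sp_increment_sqr]).  Both facts are needed
    for simple processes only: the stochastic integral in the equation is a limit in
    probability of their integrals, and before the exit one sequence of bounded simple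
    processes serves for all grid points ([ito_localize]).  On the whole probability
    space the sum is at least [- sum z^2], which is bounded, so that the events of small
    probability on which an approximation fails do no harm.  [exit_energy] lets the
    parameters tend to their limits. *)

Set Implicit Arguments.
Unset Strict Implicit.
Unset Printing Implicit Defensive.

Import Order.TTheory GRing.Theory Num.Theory.
Import numFieldNormedType.Exports.

Local Open Scope classical_set_scope.
Local Open Scope ring_scope.

(** * Bounded measurable functions *)

Section BoundedMeasurable.
Context {R : realType}.

(** Bounded measurable functions are integrable over sets of finite measure and closed
    under all the operations used below, so that integrability never has to be tracked. *)
Definition bm {d} {T : measurableType d} (f : T -> R) : Prop :=
  measurable_fun setT f /\ exists M : R, forall x, `|f x| <= M.

Section Closure.
Context {d} {T : measurableType d}.
Implicit Types f g : T -> R.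

Lemma bm_bound f : bm f -> exists2 M : R, 0 <= M & forall x, `|f x| <= M.
Proof.
by move=> [_ [M fM]]; exists `|M| => // x; rewrite (le_trans (fM x))// ler_norm.
Qed.

Lemma bm_ext f g : f =1 g -> bm f -> bm g.
Proof. by move=> /funext ->. Qed.

Lemma bm_cst (c : R) : bm (fun _ : T => c).
Proof. by split; [exact: measurable_cst|exists `|c|]. Qed.

Lemma bmD f g : bm f -> bm g -> bm (fun x => f x + g x).
Proof.
move=> [mf [M fM]] [mg [N gN]]; split; first exact: measurable_funD.
by exists (M + N) => x; rewrite (le_trans (ler_normD _ _))// lerD.
Qed.

Lemma bmN f : bm f -> bm (fun x => - f x).
Proof.
move=> [mf [M fM]]; split; first exact: measurableT_comp.
by exists M => x; rewrite normrN.
Qed.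

Lemma bmB f g : bm f -> bm g -> bm (fun x => f x - g x).
Proof. by move=> bf bg; apply: bmD => //; exact: bmN. Qed.

Lemma bmM f g : bm f -> bm g -> bm (fun x => f x * g x).
Proof.
move=> [mf [M fM]] [mg [N gN]]; split; first exact: measurable_funM.
by exists (M * N) => x; rewrite normrM ler_pM.
Qed.

Lemma bmX2 f : bm f -> bm (fun x => f x ^+ 2).
Proof. by move=> bf; under eq_fun do rewrite expr2; exact: bmM. Qed.

Lemma bm_norm f : bm f -> bm (fun x => `|f x|).
Proof.
move=> [mf [M fM]]; split; first exact: measurableT_comp.
by exists M => x; rewrite normr_id.
Qed.

Lemma bm_sum (I : Type) (r : seq I) (p : pred I) (F : I -> T -> R) :
  (forall i, p i -> bm (F i)) -> bm (fun x => \sum_(i <- r | p i) F i x).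
Proof.
move=> bF; elim: r => [|i r IH].
  by under eq_fun do rewrite big_nil; exact: bm_cst.
under eq_fun do rewrite big_cons.
by case pi: (p i) => //; apply: bmD => //; exact: bF.
Qed.

Lemma bm_indic (A : set T) : measurable A -> bm (\1_A : T -> R).
Proof.
move=> mA; split; first exact: measurable_indic.
by exists 1 => x; rewrite indicE normr_nat lern1 leq_b1.
Qed.

Lemma bm_patch (A : set T) f (M : R) : measurable A -> measurable_fun A f ->
  (forall x, A x -> `|f x| <= M) -> bm (f \_ A).
Proof.
move=> mA mf fM; split; first exact/(measurable_restrictT _ mA).
exists `|M| => x; rewrite patchE; case: ifPn => [/set_mem Ax|_].
  by rewrite (le_trans (fM _ Ax))// ler_norm.
by rewrite normr0.
Qed.

Lemma bm_integrable (m : {measure set T -> \bar R}) (D : set T) f :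
  measurable D -> (m D < +oo)%E -> bm f -> m.-integrable D (EFin \o f).
Proof.
move=> mD foo [mf [M fM]]; apply: measurable_bounded_integrable => //.
  exact: measurable_funTS.
exists M; split; first exact: num_real.
by move=> N MN x _ /=; rewrite (le_trans (fM x))// ltW.
Qed.

End Closure.

Lemma bm_comp {d d'} {T : measurableType d} {U : measurableType d'}
    (f : U -> R) (p : T -> U) : measurable_fun setT p -> bm f -> bm (fun x => f (p x)).
Proof.
move=> mp [mf [M fM]]; split; first exact: measurableT_comp.
by exists M => x.
Qed.

Lemma indic_iff (S S' : Type) (A : set S) (B : set S') x y : (A x <-> B y) ->
  \1_A x = \1_B y :> R.
Proof.
by move=> AB; rewrite !indicE (_ : (x \in A) = (y \in B))//; apply/idP/idP;
  rewrite !inE => /AB.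
Qed.

Lemma measurable_ltset d (T : measurableType d) (f g : T -> R) : measurable_fun setT f ->
  measurable_fun setT g -> measurable [set x | f x < g x].
Proof.
move=> mf mg; have mt : measurable [set true] by [].
have := measurable_fun_ltr mf mg measurableT mt.
by rewrite setTI; congr measurable; apply/seteqP; split.
Qed.

Lemma measurable_leset d (T : measurableType d) (f g : T -> R) : measurable_fun setT f ->
  measurable_fun setT g -> measurable [set x | f x <= g x].
Proof.
move=> mf mg; have mt : measurable [set true] by [].
have := measurable_fun_ler mf mg measurableT mt.
by rewrite setTI; congr measurable; apply/seteqP; split.
Qed.

Section Fubini.
Context {d1 d2} {T1 : measurableType d1} {T2 : measurableType d2}.
Variables (m1 : {sigma_finite_measure set T1 -> \bar R})
          (m2 : {sigma_finite_measure set T2 -> \bar R}).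

(** Adding a constant makes [q] nonnegative, and Tonelli's theorem contains the
    measurability. *)
Lemma bm_Rintegral (D : set T2) (q : T1 * T2 -> R) : measurable D ->
  (m2 D < +oo)%E -> bm q -> bm (fun x => \int[m2]_(y in D) q (x, y)).
Proof.
move=> mD foo bq; have [mq [M qM]] := bq.
have bqx x : bm (fun y => q (x, y)) by apply: bm_comp bq; exact: pair1_measurable.
have iqx x : m2.-integrable D (EFin \o (fun y => q (x, y))) by exact: bm_integrable.
split; last first.
  exists (M * fine (m2 D)) => x; rewrite (le_trans (le_normr_Rintegral _ _))//.
  rewrite -Rintegral_cst//; apply: le_Rintegral => //.
  - by apply: bm_integrable => //; exact: bm_norm.
  - by apply: bm_integrable => //; exact: bm_cst.
pose f (p : T1 * T2) : \bar R := ((q p + M) * \1_D p.2)%:E.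
have f0 p : (0 <= f p)%E.
  rewrite lee_fin mulr_ge0 ?indicE ?ler0n// -lerBlDr sub0r.
  by have := qM p; rewrite ler_norml => /andP[].
have mf : measurable_fun setT f.
  apply/measurable_EFinP/measurable_funM; first exact: measurable_funD.
  by apply: measurableT_comp => //; exact: measurable_indic.
have mF := @measurable_fun_fubini_tonelli_F _ _ _ _ _ m2 f mf f0.
rewrite (_ : (fun x => _) = fun x => fine (fubini_F m2 f x) - M * fine (m2 D)); last first.
  apply/funext => x; rewrite /fubini_F /f/=.
  transitivity (\int[m2]_(y in D) (q (x, y) + M) - M * fine (m2 D)).
    rewrite RintegralD ?Rintegral_cst ?addrK//.
    by apply: bm_integrable => //; exact: bm_cst.
  congr (_ - _); rewrite Rintegral_mkcond; congr fine.
  apply: eq_integral => y _; congr EFin; rewrite patchE indicE.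
  by case: ifPn => yD; rewrite ?mulr1 ?mulr0.
by apply: measurable_funB; [exact: measurableT_comp|exact: measurable_cst].
Qed.

Lemma Rintegral_Fubini (D1 : set T1) (D2 : set T2) (q : T1 * T2 -> R) :
  measurable D1 -> measurable D2 -> (m1 D1 < +oo)%E -> (m2 D2 < +oo)%E -> bm q ->
  \int[m1]_(x in D1) \int[m2]_(y in D2) q (x, y) =
  \int[m2]_(y in D2) \int[m1]_(x in D1) q (x, y).
Proof.
move=> mD1 mD2 f1 f2 bq; have [M M0 qM] := bm_bound bq.
pose f (p : T1 * T2) : \bar R := (q p * \1_D1 p.1 * \1_D2 p.2)%:E.
have bqx x : bm (fun y => q (x, y)) by apply: bm_comp bq; exact: pair1_measurable.
have bqy y : bm (fun x => q (x, y)) by apply: bm_comp bq; exact: pair2_measurable.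
have bf : bm (fun p : T1 * T2 => q p * \1_D1 p.1 * \1_D2 p.2).
  apply: bmM; first apply: bmM => //.
    by apply: (bm_comp (f := \1_D1)) => //; exact: bm_indic.
  by apply: (bm_comp (f := \1_D2)) => //; exact: bm_indic.
have intf : (m1 \x m2)%E.-integrable setT f.
  apply/integrableP; split; first by apply/measurable_EFinP; exact: bf.1.
  rewrite fubini_tonelli1; last 2 first.
  - by apply: measurableT_comp => //; apply/measurable_EFinP; exact: bf.1.
  - by move=> p; exact: abse_ge0.
  apply: (@le_lt_trans _ _ (\int[m1]_x ((M * fine (m2 D2)) * \1_D1 x)%:E)%E).
    apply: ge0_le_integral => //.
    - by move=> x _; apply: integral_ge0.
    - apply: (measurable_fun_fubini_tonelli_F (abse \o f)) => //.
        by apply: measurableT_comp => //; apply/measurable_EFinP; exact: bf.1.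
      by move=> p; exact: abse_ge0.
    - by apply/measurable_EFinP/measurable_funM => //; exact: measurable_indic.
    - move=> x _; rewrite /fubini_F/=.
      apply: (@le_trans _ _ (\int[m2]_y ((M * \1_D1 x) * \1_D2 y)%:E)%E).
        apply: ge0_le_integral => //.
        + apply/measurable_EFinP/measurableT_comp => //.
          apply: (@bm_comp _ _ _ _ _ (pair x) _ bf).1.
          exact: pair1_measurable.
        + by apply/measurable_EFinP/measurable_funM => //; exact: measurable_indic.
        + move=> y _; rewrite lee_fin !normrM !indicE !normr_nat.
          by rewrite !ler_wpM2r.
      under eq_integral do rewrite EFinM.
      rewrite integralZl//; last first.
        apply/integrableP; split; first by apply/measurable_EFinP; exact: measurable_indic.
        under eq_integral do rewrite /= indicE normr_nat -indicE.
        by rewrite integral_indic// setIT.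
      rewrite integral_indic// setIT -[X in (_ * X)%E]fineK ?ge0_fin_numE// -EFinM.
      by rewrite mulrAC.
  under eq_integral do rewrite EFinM.
  rewrite integralZl//; last first.
    apply/integrableP; split; first by apply/measurable_EFinP; exact: measurable_indic.
    under eq_integral do rewrite /= indicE normr_nat -indicE.
    by rewrite integral_indic// setIT.
  by rewrite integral_indic// setIT lte_mul_pinfty// lee_fin mulr_ge0 ?fine_ge0.
have inner1 x : (\int[m2]_y f (x, y) = (\int[m2]_(y in D2) q (x, y) * \1_D1 x)%:E)%E.
  rewrite -RintegralZr//; last by apply: bm_integrable.
  rewrite /Rintegral fineK; last first.
    apply: integrable_fin_num => //.
    by apply: (@bm_integrable _ _ _ _ (fun y => q (x, y) * \1_D1 x)) => //; apply: bmM => //; exact: bm_cst.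
  rewrite [RHS]integral_mkcond; apply: eq_integral => y _; rewrite /f/= patchE [\1_D2 y]indicE.
  by case: ifPn => _; rewrite ?mulr1 ?mulr0.
have inner2 y : (\int[m1]_x f (x, y) = (\int[m1]_(x in D1) q (x, y) * \1_D2 y)%:E)%E.
  rewrite -RintegralZr//; last by apply: bm_integrable.
  rewrite /Rintegral fineK; last first.
    apply: integrable_fin_num => //.
    by apply: (@bm_integrable _ _ _ _ (fun x => q (x, y) * \1_D2 y)) => //; apply: bmM => //; exact: bm_cst.
  rewrite [RHS]integral_mkcond; apply: eq_integral => x _; rewrite /f/= patchE [\1_D1 x]indicE.
  by case: ifPn => _; rewrite ?mulr1 ?mulr0 ?mul0r.
have := Fubini intf.
under eq_integral do rewrite inner1.
under [in RHS]eq_integral do rewrite inner2.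
move=> E.
rewrite [LHS]Rintegral_mkcond [RHS]Rintegral_mkcond; congr fine.
transitivity (\int[m1]_x (\int[m2]_(y in D2) q (x, y) * \1_D1 x)%:E)%E; last rewrite E;
  apply: eq_integral => z _; rewrite patchE indicE;
  by case: ifPn => _; rewrite ?mulr1 ?mulr0.
Qed.

End Fubini.
End BoundedMeasurable.

(** * Integrals over intervals and moving windows *)

Section Intervals.
Context {R : realType}.
Local Notation mu := (@lebesgue_measure R).
Implicit Types (f g : R -> R) (a b c h : R).

(** Half-open intervals concatenate without overlap. *)
Definition itg f a b : R := \int[mu]_(x in `]a, b]) f x.

Lemma mu_oc_fin a b : (mu `]a, b] < +oo)%E.
Proof. by rewrite lebesgue_measure_itv/=; case: ifPn => // _; rewrite ltry. Qed.

Lemma mu_cc_fin a b : (mu `[a, b] < +oo)%E.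
Proof. by rewrite lebesgue_measure_itv/=; case: ifPn => // _; rewrite ltry. Qed.

Lemma mu_oc a b : a <= b -> fine (mu `]a, b]) = b - a.
Proof.
rewrite le_eqVlt => /predU1P[->|ab]; rewrite lebesgue_measure_itv/= lte_fin.
  by rewrite ltxx subrr.
by rewrite ab.
Qed.

Lemma bm_integrable_oc f a b : bm f -> mu.-integrable `]a, b] (EFin \o f).
Proof. by move=> bf; apply: bm_integrable => //; exact: mu_oc_fin. Qed.

Lemma bm_integrable_cc f a b : bm f -> mu.-integrable `[a, b] (EFin \o f).
Proof. by move=> bf; apply: bm_integrable => //; exact: mu_cc_fin. Qed.

Hint Resolve bm_integrable_oc bm_integrable_cc : core.

Lemma itg_cc f a b : bm f -> \int[mu]_(x in `[a, b]) f x = itg f a b.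
Proof. by move=> bf; rewrite -Rintegral_itv_obnd_cbnd//; exact: bm_integrable_oc. Qed.

Lemma eq_itg f g a b : (forall x, a < x -> x <= b -> f x = g x) ->
  itg f a b = itg g a b.
Proof.
move=> fg; apply: eq_Rintegral => x; rewrite inE/= in_itv/= => /andP[ax xb].
exact: fg.
Qed.

Lemma le_itg f g a b : bm f -> bm g ->
  (forall x, a < x -> x <= b -> f x <= g x) -> itg f a b <= itg g a b.
Proof.
move=> bf bg fg; apply: le_Rintegral; [exact: measurable_itv|exact: bm_integrable_oc..|].
by move=> x /=; rewrite in_itv/= => /andP[ax xb]; exact: fg.
Qed.

Lemma itg_ge0 f a b : (forall x, a < x -> x <= b -> 0 <= f x) -> 0 <= itg f a b.
Proof.
by move=> f0; apply: Rintegral_ge0 => x /=; rewrite in_itv/= => /andP[]; exact: f0.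
Qed.

Lemma itgD f g a b : bm f -> bm g ->
  itg (fun x => f x + g x) a b = itg f a b + itg g a b.
Proof. by move=> bf bg; rewrite /itg RintegralD//; exact: bm_integrable_oc. Qed.

Lemma itgB f g a b : bm f -> bm g ->
  itg (fun x => f x - g x) a b = itg f a b - itg g a b.
Proof. by move=> bf bg; rewrite /itg RintegralB//; exact: bm_integrable_oc. Qed.

Lemma itgZl r f a b : bm f -> itg (fun x => r * f x) a b = r * itg f a b.
Proof. by move=> bf; rewrite /itg RintegralZl//; exact: bm_integrable_oc. Qed.

Lemma itgZr r f a b : bm f -> itg (fun x => f x * r) a b = itg f a b * r.
Proof. by move=> bf; rewrite /itg RintegralZr//; exact: bm_integrable_oc. Qed.

Lemma itg_cst r a b : a <= b -> itg (fun=> r) a b = r * (b - a).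
Proof. by move=> ab; rewrite /itg Rintegral_cst// mu_oc. Qed.

Lemma itg0 a b : itg (fun=> 0) a b = 0.
Proof. by rewrite /itg Rintegral_cst// mul0r. Qed.

Lemma itg_sum (I : Type) (r : seq I) (p : pred I) (F : I -> R -> R) a b :
  (forall i, p i -> bm (F i)) ->
  itg (fun x => \sum_(i <- r | p i) F i x) a b = \sum_(i <- r | p i) itg (F i) a b.
Proof.
move=> bF; elim: r => [|i r IH].
  by under eq_itg do rewrite big_nil; rewrite big_nil itg0.
under eq_itg do rewrite big_cons.
rewrite big_cons -IH; case pi: (p i) => //.
by rewrite itgD//; [exact: bF|exact: bm_sum].
Qed.

Lemma itg_norm f a b : bm f -> `|itg f a b| <= itg (fun x => `|f x|) a b.
Proof. by move=> bf; rewrite /itg le_normr_Rintegral//; exact: bm_integrable_oc. Qed.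

Lemma itg_le_cst f a b M : bm f -> a <= b ->
  (forall x, a < x -> x <= b -> f x <= M) -> itg f a b <= M * (b - a).
Proof.
by move=> bf ab fM; rewrite -itg_cst//; apply: le_itg => //; exact: bm_cst.
Qed.

Lemma itg_norm_le f a b M : bm f -> a <= b ->
  (forall x, a < x -> x <= b -> `|f x| <= M) -> `|itg f a b| <= M * (b - a).
Proof.
move=> bf ab fM; rewrite (le_trans (itg_norm _ _ bf))// itg_le_cst//.
exact: bm_norm.
Qed.

Lemma itg_split f a b c : bm f -> a <= b -> b <= c ->
  itg f a c = itg f a b + itg f b c.
Proof.
move=> bf ab bc; rewrite /itg -Rintegral_setU//.
- by rewrite -itv_bndbnd_setU// bnd_simp.
- by rewrite -itv_bndbnd_setU ?bnd_simp//; exact: bm_integrable_oc.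
- apply/disj_setPS => x [/=]; rewrite !in_itv/= => /andP[_ xb] /andP[bx _].
  by have := lt_le_trans bx xb; rewrite ltxx.
Qed.

Let shiftr h : measurableTypeR R -> measurableTypeR R := fun x => x + h.

Let measurable_shiftr h : measurable_fun setT (shiftr h).
Proof.
have : measurable_fun [set: R] (fun x : R => x + h).
  by apply: measurable_realfun.measurable_funD; [exact: measurable_id|exact: measurable_cst].
by [].
Qed.

Lemma pushforward_shift h (A : set R) : measurable A ->
  pushforward mu (shiftr h) A = mu A.
Proof.
move=> mA; apply/esym.
have := @lebesgue_measure_unique R
  (measure_function_pushforward__canonical__measure_function_Measure mu (measurable_shiftr h)).
apply; last exact: mA.
move=> _ [[a b] _ <-].
rewrite /=/pushforward/= (_ : _ @^-1` _ = `]a - h, b - h]%classic); last first.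
  by apply/seteqP; split=> x /=; rewrite /shiftr !in_itv/= ltrBlDr lerBrDr.
rewrite !lebesgue_measure_itv/= !lte_fin ltrD2r; case: ifPn => // _.
by rewrite -!EFinD; congr EFin; ring.
Qed.

Lemma itg_shift f a b h : bm f ->
  itg (fun x => f (x + h)) a b = itg f (a + h) (b + h).
Proof.
move=> bf.
have E : shiftr h @^-1` `]a + h, b + h]%classic = `]a, b]%classic.
  by apply/seteqP; split=> x /=; rewrite /shiftr !in_itv/= ltrD2r lerD2r.
have mf : measurable_fun [set: R] (EFin \o f) by apply/measurable_EFinP; exact: bf.1.
have bfs : bm (fun x : R => f (x + h)) by apply: bm_comp bf; exact: measurable_shiftr.
have := @integral_pushforward _ _ _ _ R (shiftr h) (measurable_shiftr h)
  mu `]a + h, b + h]%classic (EFin \o f) mf.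
rewrite E => /(_ (bm_integrable_oc _ _ bfs) (measurable_itv _)) H.
rewrite /itg /Rintegral; congr fine; rewrite [LHS](_ : _ =
  (\int[mu]_(x in `]a, b]) ((EFin \o f) \o shiftr h) x)%E)// -H.
apply: eq_measure_integral => A mA _; exact: pushforward_shift.
Qed.

Lemma measurable_shift h : measurable_fun setT (fun x : R => x + h).
Proof. exact: measurable_shiftr. Qed.

Lemma bm_shift f h : bm f -> bm (fun x : R => f (x + h)).
Proof. by move=> bf; apply: bm_comp bf; exact: measurable_shiftr. Qed.

Lemma itg_fubini (q : R * R -> R) a b c h : bm q ->
  itg (fun x => itg (fun y => q (x, y)) c h) a b =
  itg (fun y => itg (fun x => q (x, y)) a b) c h.
Proof. by move=> bq; apply: Rintegral_Fubini => //; exact: mu_oc_fin. Qed.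

Lemma bm_itg (q : R * R -> R) c h : bm q -> bm (fun x : R => itg (fun y => q (x, y)) c h).
Proof. by move=> bq; apply: bm_Rintegral => //; exact: mu_oc_fin. Qed.

Lemma measurable_addR : measurable_fun setT (fun p : R * R => p.1 + p.2).
Proof. by apply: measurable_realfun.measurable_funD. Qed.

Lemma bm_sec1 (q : R * R -> R) x : bm q -> bm (fun y : R => q (x, y)).
Proof. by move=> bq; apply: bm_comp bq; exact: pair1_measurable. Qed.

Lemma bm_sec2 (q : R * R -> R) y : bm q -> bm (fun x : R => q (x, y)).
Proof. by move=> bq; apply: bm_comp bq; exact: pair2_measurable. Qed.

Lemma bm_window (q : R * R -> R) c h : bm q ->
  bm (fun s : R => itg (fun u => q (s, u)) (s + c) (s + h)).
Proof.
move=> bq; apply: (@bm_ext _ _ _ (fun s : R => itg (fun v => q (s, v + s)) c h)).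
  move=> s; rewrite (@itg_shift (fun u => q (s, u))) ?(addrC _ s)//.
  exact: bm_sec1.
apply: (@bm_itg (fun p => q (p.1, p.2 + p.1))).
apply: (@bm_comp _ _ _ _ _ q (fun p : R * R => (p.1, p.2 + p.1))) => //.
apply: measurable_fun_pair => //=.
by apply: measurable_realfun.measurable_funD.
Qed.

Lemma bm_window' (q : R * R -> R) c h : bm q ->
  bm (fun s : R => itg (fun u => q (u, s)) (s + c) (s + h)).
Proof.
move=> bq; apply: (@bm_window (fun p => q (p.2, p.1))).
by apply: (bm_comp (p := fun p : R * R => (p.2, p.1))) => //; exact: measurable_swap.
Qed.

Lemma itg_setI f (A : set R) a b : itg (fun x => f x * \1_A x) a b =
  \int[mu]_(x in `]a, b] `&` A) f x.
Proof.
rewrite Rintegral_mkcondr; apply: eq_Rintegral => x _; rewrite patchE indicE.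
by case: ifPn => _; rewrite ?mulr1 ?mulr0.
Qed.

Lemma itg_setI_le f (A : set R) a b c h : bm f -> (forall x, 0 <= f x) ->
  measurable A -> A `<=` `[c, h] -> itg (fun x => f x * \1_A x) a b <= itg f c h.
Proof.
move=> bf f0 mA Ach; rewrite itg_setI -itg_cc//.
have mAI : measurable (`]a, b] `&` A : set R) by apply: measurableI.
have Afin : (mu (`]a, b] `&` A) < +oo)%E.
  apply: le_lt_trans (mu_oc_fin a b); apply: le_measure; rewrite ?inE//.
have ifin (D : set R) : measurable D -> (mu D < +oo)%E ->
    (\int[mu]_(x in D) (f x)%:E)%E \is a fin_num.
  by move=> mD Df; apply: integrable_fin_num => //; exact: bm_integrable.
rewrite /Rintegral fine_le ?ifin//; first exact: mu_cc_fin.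
apply: ge0_subset_integral => //.
- by apply/measurable_EFinP/measurable_funTS; exact: bf.1.
- by move=> x _; rewrite lee_fin.
- by move=> x /= [_ /Ach].
Qed.

(** Exchange the order of integration: the point [u] lies in the windows of the
    [s] between [u] and [u + h].  The last term pays for the [u] before time [0]. *)
Lemma itg_window_le (q : R * R -> R) (v : R -> R) T h M V :
  bm q -> bm v -> (forall p, 0 <= q p <= M) -> (forall u, 0 <= v u) ->
  (forall u, u <= 0 -> - h <= u -> v u <= V) -> 0 <= T -> 0 <= h ->
  itg (fun s => itg (fun u => q (s, u) * v u) (s - h) s) 0 T <=
  itg (fun u => v u * itg (fun s => q (s, u)) u (u + h)) 0 T + h * (h * M * V).
Proof.
move=> bq bv qM v0 vV T0 h0.
have q0 p : 0 <= q p by case/andP: (qM p).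
pose A := [set p : R * R | p.1 - h < p.2] `&` [set p : R * R | p.2 <= p.1].
have mA : measurable A.
  apply: measurableI; last exact: measurable_leset.
  by apply: measurable_ltset => //; apply: measurable_realfun.measurable_funB.
pose r (p : R * R) := q p * v p.2 * \1_A p.
have br : bm r.
  apply: bmM; last exact: bm_indic.
  by apply: bmM => //; apply: (bm_comp (p := snd)) => //; exact: measurable_snd.
rewrite (_ : itg _ 0 T = itg (fun s => itg (fun u => r (s, u)) (- h) T) 0 T); last first.
  apply: eq_itg => s s0 sT; rewrite /r /=.
  transitivity (itg (fun u => (q (s, u) * v u) * \1_(`]s - h, s]%classic) u) (- h) T).
    rewrite itg_setI; congr (Rintegral _ _ _); apply/seteqP; split=> u /=; rewrite !in_itv/=.
      by move=> /andP[su us]; rewrite su us/= (le_trans us)// andbT; lra.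
    by case.
  apply: eq_itg => u _ _; congr (_ * _); apply: indic_iff; rewrite /= in_itv/=.
  by split=> [/andP[]//|[-> ->]].
rewrite itg_fubini//.
have bw : bm (fun u => v u * itg (fun s => q (s, u)) u (u + h)).
  apply: bmM => //.
  have := bm_window' 0 h bq; apply: bm_ext => u.
  by rewrite addr0.
apply: (@le_trans _ _ (itg (fun u => v u * itg (fun s => q (s, u)) u (u + h)) (- h) T)).
  apply: le_itg => //; first by apply: (@bm_itg (fun p => r (p.2, p.1)));
    apply: (bm_comp (p := fun p : R * R => (p.2, p.1))) => //; exact: measurable_swap.
  move=> u hu uT.
  rewrite (_ : itg _ 0 T = v u * itg (fun s => q (s, u) * \1_(`[u, u + h[%classic) s) 0 T); last first.
    rewrite -itgZl; last first.
      by apply: bmM; [exact: bm_sec2|apply: bm_indic; exact: measurable_itv].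
    apply: eq_itg => s _ _; rewrite /r/= mulrA (mulrC (v u)); congr (_ * _).
    apply: indic_iff; rewrite /= in_itv/= -ltrBlDr.
    by split=> [[-> ->]//|/andP[]].
  rewrite ler_wpM2l//; apply: itg_setI_le => //.
  - exact: bm_sec2.
  - by move=> s /=; rewrite !in_itv/= => /andP[-> /ltW].
rewrite (@itg_split _ (- h) 0 T)// ?oppr_le0// addrC lerD2l.
rewrite -[leRHS](_ : h * M * V * (0 - - h) = _); last by ring.
apply: itg_le_cst => //; rewrite ?oppr_le0// => u hu u0.
have vu : v u <= V by apply: vV => //; exact: ltW.
rewrite mulrC; apply: ler_pM => //.
  by apply: itg_ge0 => s _ _.
rewrite (_ : h * M = M * (u + h - u)); last by ring.
apply: itg_le_cst => //; first exact: bm_sec2.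
  by rewrite lerDl.
by move=> s _ _; case/andP: (qM (s, u)).
Qed.

(** On the window [t - h < s <= t] this cuts nothing off [s - t + h]; outside it makes the
    kernels of the memory bounded on the whole plane. *)
Definition clamp0 h x : R := Num.max 0 (Num.min h x).

Lemma clamp0_id h x : 0 <= x <= h -> clamp0 h x = x.
Proof. by move=> /andP[x0 xh]; rewrite /clamp0 min_r// max_r. Qed.

Lemma clamp0_ge0 h x : 0 <= clamp0 h x.
Proof. by rewrite /clamp0 le_max lexx. Qed.

Lemma bm_clamp0 d (T : measurableType d) h (f : T -> R) :
  measurable_fun setT f -> bm (fun x => clamp0 h (f x)).
Proof.
move=> mf; split.
  by apply: measurable_maxr => //; apply: measurable_minr.
exists `|h| => x; rewrite ger0_norm ?clamp0_ge0//.
by rewrite /clamp0 ge_max normr_ge0/= ge_min ler_norm.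
Qed.

Let below : set (R * R) := [set x | x.1 <= x.2].

Let itg_below (p : R -> R) h t v : bm p -> - h < v -> v <= 0 ->
  itg p (v + t) t = itg (fun u => p (u + t) * \1_below (v, u)) (- h) 0.
Proof.
move=> bp hv v0.
rewrite -[X in itg p _ X](add0r t) -itg_shift//.
rewrite (_ : itg (fun u => _ * \1_below _) _ _ =
  itg (fun u => p (u + t) * \1_(`[v, +oo[%classic) u) (- h) 0); last first.
  apply: eq_itg => u _ _; congr (_ * _); apply: indic_iff.
  by rewrite /= in_itv/= andbT.
rewrite itg_setI -itg_cc; last exact: bm_shift.
congr (Rintegral _ _ _); apply/seteqP; split=> u /=; rewrite !in_itv/= ?andbT.
  by move=> /andP[vu ->]; rewrite (lt_le_trans hv vu).
by move=> [/andP[_ ->] ->].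
Qed.

Let bm_below : bm (\1_below : R * R -> R).
Proof. by apply: bm_indic; exact: measurable_leset. Qed.

Let bm_belowp (p : R -> R) t : bm p -> bm (fun x : R * R => p (x.2 + t) * \1_below x).
Proof.
move=> bp; apply: bmM => //.
apply: (@bm_comp _ _ _ _ _ p (fun x : R * R => x.2 + t)) => //.
by apply: measurable_realfun.measurable_funD => //; exact: measurable_snd.
Qed.

(** Both sides integrate [p u] over the triangle [v + t < u <= t], [- h < v <= 0]. *)
Lemma itg_triangle (p : R -> R) t h : bm p -> 0 <= h ->
  itg (fun v => itg p (v + t) t) (- h) 0 =
  itg (fun u => clamp0 h (u - t + h) * p u) (t - h) t.
Proof.
move=> bp h0.
transitivity (itg (fun v => itg (fun u => p (u + t) * \1_below (v, u)) (- h) 0) (- h) 0).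
  by apply: eq_itg => v hv v0; exact: itg_below.
rewrite (@itg_fubini (fun x => p (x.2 + t) * \1_below x)); last exact: bm_belowp.
have bc : bm (fun u : R => clamp0 h (u - t + h)).
  apply: bm_clamp0; apply: measurable_realfun.measurable_funD => //.
  by apply: measurable_realfun.measurable_funB.
rewrite [RHS](_ : _ = itg (fun u => clamp0 h (u + t - t + h) * p (u + t)) (- h) 0);
  last by rewrite (@itg_shift (fun u => clamp0 h (u - t + h) * p u)) ?add0r
    ?(addrC (- h))//; exact: bmM.
apply: eq_itg => u hu u0 /=.
have bAu : bm (fun x : R => \1_below (x, u) : R).
  by apply: (bm_comp (p := pair^~ u) (f := \1_below)) => //; exact: pair2_measurable.
rewrite itgZl// mulrC addrK; congr (_ * _).
rewrite (@itg_split _ (- h) u 0)//; last exact: ltW.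
rewrite (@eq_itg _ (fun=> 1)); last first.
  by move=> x _ xu; rewrite indicE mem_set.
rewrite [X in _ + X](@eq_itg _ (fun=> 0)); last first.
  move=> x xu _; rewrite indicE memNset//= /below/= => xu'.
  by have := lt_le_trans xu xu'; rewrite ltxx.
rewrite itg0 addr0 itg_cst; last exact: ltW.
by rewrite clamp0_id//; lra.
Qed.

(** The integral over a moving window is, up to a derivative in [t], the length of the
    window times the current value: this moves a distributed delay into the memory. *)
Lemma itg_window_prim (p : R -> R) t h : bm p -> 0 <= t -> 0 <= h ->
  itg (fun s => itg p (s - h) s) 0 t =
  h * itg p 0 t + itg (fun u => clamp0 h (u + h) * p u) (- h) 0
    - itg (fun u => clamp0 h (u - t + h) * p u) (t - h) t.
Proof.
move=> bp t0 h0; rewrite -itg_triangle//.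
have -> : itg (fun u => clamp0 h (u + h) * p u) (- h) 0 =
    itg (fun v => itg p (v + 0) 0) (- h) 0.
  by rewrite itg_triangle// sub0r; apply: eq_itg => u _ _; rewrite subr0.
transitivity (itg (fun s => itg (fun v => p (s + v)) (- h) 0) 0 t).
  apply: eq_itg => s _ _; under [in RHS]eq_itg do rewrite addrC.
  by rewrite itg_shift// add0r addrC.
rewrite (@itg_fubini (fun x => p (x.1 + x.2)))//=; last first.
  by apply: (bm_comp (p := fun x : R * R => x.1 + x.2)) => //; exact: measurable_addR.
pose W c v := itg (fun u => p (u + c) * \1_below (v, u)) (- h) 0.
have bW c : bm (W c).
  by apply: (@bm_itg (fun x => p (x.2 + c) * \1_below x)); exact: bm_belowp.
have WE c v : - h < v -> v <= 0 -> itg p (v + c) c = W c v by exact: itg_below.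
transitivity (itg (fun v => (itg p 0 t + W 0 v) - W t v) (- h) 0).
  apply: eq_itg => v hv v0; rewrite itg_shift// add0r -!WE// addr0.
  apply/eqP; rewrite -subr_eq opprK (addrC t v) -itg_split//; last 2 first.
  - by rewrite lerDl.
  - by rewrite gerDr.
  by rewrite addrC -itg_split.
rewrite (itgB _ _ (bmD (bm_cst _) (bW 0)) (bW t)) (itgD _ _ (bm_cst _) (bW 0)).
have -> : itg (fun=> itg p 0 t) (- h) 0 = h * itg p 0 t.
  rewrite itg_cst; last by rewrite oppr_le0.
  by rewrite sub0r opprK mulrC.
have -> : itg (fun v => itg p (v + 0) 0) (- h) 0 = itg (W 0) (- h) 0.
  by apply: eq_itg => v ? ?; rewrite WE.
have -> : itg (fun v => itg p (v + t) t) (- h) 0 = itg (W t) (- h) 0.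
  by apply: eq_itg => v ? ?; rewrite WE.
by [].
Qed.

(** Shift the time by [h]; the last term pays for the values before time [0]. *)
Lemma itg_delay_le (p v : R -> R) T h M V :
  bm p -> bm v -> (forall s, 0 <= p s <= M) -> (forall u, 0 <= v u) ->
  (forall u, u <= 0 -> - h <= u -> v u <= V) -> 0 <= T -> 0 <= h ->
  itg (fun s => p s * v (s - h)) 0 T <=
  itg (fun u => v u * p (u + h)) 0 T + h * M * V.
Proof.
move=> bp bv pM v0 vV T0 h0.
have p0 s : 0 <= p s by case/andP: (pM s).
have bvp : bm (fun u : R => v u * p (u + h)) by apply: bmM => //; exact: bm_shift.
rewrite (_ : itg _ 0 T = itg (fun u => v u * p (u + h)) (0 - h) (T - h)); last first.
  by rewrite -itg_shift//; apply: eq_itg => s _ _; rewrite subrK mulrC.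
apply: (@le_trans _ _ (itg (fun u => v u * p (u + h)) (0 - h) T)).
  rewrite [leRHS](@itg_split _ _ (T - h))//; last 2 first.
  - by rewrite lerD2r.
  - by rewrite gerBl.
  by rewrite lerDl itg_ge0// => u _ _; rewrite mulr_ge0.
rewrite (@itg_split _ _ 0)// ?sub0r ?oppr_le0// addrC lerD2l.
rewrite (_ : h * M * V = V * M * (0 - - h)); last by ring.
apply: itg_le_cst => //; rewrite ?oppr_le0// => u hu u0.
apply: ler_pM => //; first by apply: vV => //; exact: ltW.
by case/andP: (pM (u + h)).
Qed.
End Intervals.

(** * Moments of the normal law *)

Section GaussianMoments.
Context {R : realType}.
Variable s : R.
Hypothesis s_gt0 : 0 < s.
Local Notation mu := (@lebesgue_measure R).
Local Notation N := (normal_prob 0 s).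
Local Notation phi := (normal_pdf 0 s).

Let s_neq0 : s != 0. Proof. by rewrite gt_eqF. Qed.

Let phiE : phi = fun x => normal_peak s * expR (- x ^+ 2 / (s ^+ 2 *+ 2)).
Proof.
by apply/funext => x; rewrite normal_pdfE//= /normal_fun subr0.
Qed.

Lemma integral_normal_prob (f : R -> \bar R) U : measurable U -> measurable_fun U f ->
  (\int[N]_(x in U) `|f x| < +oo)%E ->
  (\int[N]_(x in U) f x = \int[mu]_(x in U) (f x * (phi x)%:E))%E.
Proof.
move=> mU mf finf; have Ndom := normal_prob_dominates 0 s.
have mphi : measurable_fun U (fun x => (phi x)%:E).
  by apply/measurable_EFinP/measurable_funTS; exact: measurable_normal_pdf.
rewrite -(Radon_Nikodym_change_of_variables Ndom)//=; last first.
  by apply/integrableP; split.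
apply: ae_eq_integral => //.
- apply: emeasurable_funM => //; apply: (measurable_int mu).
  apply: (integrableS _ _ (@subsetT _ _)) => //=.
  by apply: Radon_Nikodym_integrable; exact: Ndom.
- exact: emeasurable_funM.
- apply: ae_eqe_mul2l => /=.
  rewrite Radon_NikodymE//=; case: cid => /= h [h1 h2 h3].
  by apply: integral_ae_eq => //=; [exact: integrableS h2|move=> E E01 mE; rewrite -h3].
Qed.

(** If [(F)' = f phi] then [F] integrates [f] against the normal law. *)
Lemma integral_normal_itv (f F : R -> R) (a b M : R) : a < b -> continuous f ->
  (forall x, a <= x <= b -> `|f x| <= M) ->
  (forall x : R, is_derive x (1 : R) F (f x * phi x)) ->
  (\int[N]_(x in `[a, b]) (f x)%:E = (F b - F a)%:E)%E.
Proof.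
move=> ab cf fM dF.
have cphi : continuous phi by exact: continuous_normal_pdf.
have cfp : continuous (fun x => f x * phi x) by move=> x; apply: cvgM; [exact: cf|exact: cphi].
have mf : measurable_fun [set: R] f by exact: continuous_measurable_fun.
have cF : continuous F.
  move=> x; apply: differentiable_continuous; apply/derivable1_diffP.
  by have := dF x => dFx; exact: ex_derive.
rewrite integral_normal_prob//; last 2 first.
- by apply/measurable_EFinP; exact: measurable_funTS.
- have : N.-integrable `[a, b] (EFin \o f).
    apply: measurable_bounded_integrable => //.
    + by rewrite (le_lt_trans (probability_le1 _ _))// ltry.
    + exact: measurable_funTS.
    + exists M; split; first exact: num_real.
      by move=> M' MM' x /=; rewrite in_itv/= => /fM/le_trans; apply; exact: ltW.
  by case/integrableP.
transitivity (\int[mu]_(x in `[a, b]) (f x * phi x)%:E)%E.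
  by apply: eq_integral => x _; rewrite EFinM.
rewrite (@continuous_FTC2 _ _ F _ _ ab) ?EFinB//.
- exact: continuous_subspaceT.
- split.
  + by move=> x _; have dFx := dF x; exact: ex_derive.
  + exact: cvg_at_right_filter (cF a).
  + exact: cvg_at_left_filter (cF b).
- by move=> x _; have dFx := dF x; rewrite derive1E derive_val.
Qed.

Let is_derive_phi (x : R) : is_derive x (1 : R) phi (- (x / s ^+ 2) * phi x).
Proof.
rewrite phiE.
have -> : - (x / s ^+ 2) * (normal_peak s * expR (- x ^+ 2 / (s ^+ 2 *+ 2))) =
    normal_peak s *: (- (x / s ^+ 2) * expR (- x ^+ 2 / (s ^+ 2 *+ 2))).
  by rewrite /GRing.scale/=; ring.
apply: is_deriveZ.
have H : is_derive x (1 : R) (fun y : R => (- (s ^+ 2 *+ 2)^-1) *: y ^+ 2)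
    ((- (s ^+ 2 *+ 2)^-1) *: (x + x)).
  apply: is_deriveZ; have := @is_deriveM R R id id x 1 1 1 (is_derive_id _ _) (is_derive_id _ _).
  by rewrite /GRing.scale/= mulr1; congr is_derive; apply/funext.
have -> : (fun x => expR (- x ^+ 2 / (s ^+ 2 *+ 2))) =
    expR \o (fun y : R => (- (s ^+ 2 *+ 2)^-1) *: y ^+ 2).
  by apply/funext => y /=; congr expR; rewrite /GRing.scale/=; ring.
have := @is_derive1_comp R expR _ x _ _ (is_derive_expR _) H.
congr is_derive; rewrite /GRing.scale/= mulrC; congr (_ * expR _); last by ring.
by field.
Qed.

Let phi_even x : phi (- x) = phi x.
Proof. by rewrite phiE sqrrN. Qed.

Let itv n : set R := `[- n.+1%:R, n.+1%:R]%classic.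

Let itvT : \bigcup_n itv n = setT.
Proof.
apply/seteqP; split => // x _; exists (Num.truncn `|x|) => //=.
rewrite /itv/= in_itv/= -ler_norml; apply/ltW; exact: truncnS_gt.
Qed.

Let itv_nd : nondecreasing_seq itv.
Proof.
move=> m n mn; apply/subsetPset => x; rewrite /itv/= !in_itv/= => /andP[mx xm].
have mn' : m.+1%:R <= n.+1%:R :> R by rewrite ler_nat ltnS.
by rewrite (le_trans xm mn') (le_trans _ mx)// lerN2.
Qed.

Let mitv n : measurable (itv n). Proof. exact: measurable_itv. Qed.

Let NN : {measure set (measurableTypeR R) -> \bar R} := N.

Let cvg_itv (f : R -> R) : measurable_fun setT f -> (forall x, 0 <= f x) ->
  ((\int[N]_(x in itv i) (f x)%:E) @[i --> \oo] --> (\int[N]_x (f x)%:E))%E.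
Proof.
move=> mf f0; rewrite -itvT.
have mf' n : measurable_fun (itv n) (fun x : R => (f x)%:E).
  by apply/measurable_EFinP/measurable_funTS.
apply: (@ge0_nondecreasing_set_cvg_integral _ (measurableTypeR R) R itv
  (fun x => (f x)%:E) NN) => //.
by move=> i x _; rewrite lee_fin.
Qed.

(** The derivative of [- s ^ 2 x phi x] is [(x ^ 2 - s ^ 2) phi x], so that over [[-n, n]] the
    second moment differs from [s ^ 2] times a mass by a boundary term, which is
    negative. *)
Lemma normal_second_moment : (\int[N]_x (x ^+ 2)%:E <= (s ^+ 2)%:E)%E.
Proof.
have mf : measurable_fun [set: R] (fun x : R => x ^+ 2) by exact: exprn_measurable.
have H := cvg_itv mf (fun x => sqr_ge0 x).
apply: (cvge_to_le H); apply: nearW => n {H}.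
pose F x := - s ^+ 2 *: (x * phi x).
have dF (x : R) : is_derive x (1 : R) F ((x ^+ 2 - s ^+ 2) * phi x).
  have -> : (x ^+ 2 - s ^+ 2) * phi x =
      - s ^+ 2 *: (x *: (- (x / s ^+ 2) * phi x) + phi x *: 1).
    by rewrite /GRing.scale/=; field.
  by apply: is_deriveZ; apply: is_deriveM; exact: is_derive_phi.
have n1 : 0 < n.+1%:R :> R by rewrite ltr0n.
have n0 : - n.+1%:R < n.+1%:R :> R by lra.
have bx2 (x : R) : - n.+1%:R <= x <= n.+1%:R -> x ^+ 2 <= n.+1%:R ^+ 2.
  by move=> xn; rewrite -(real_normK (num_real x)) lerXn2r ?nnegrE// ler_norml.
have iN (f : R -> R) M : measurable_fun setT f ->
    (forall x, - n.+1%:R <= x <= n.+1%:R -> `|f x| <= M) ->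
    N.-integrable (itv n) (EFin \o f).
  move=> mf' fM; apply: measurable_bounded_integrable => //.
  - exact: mitv.
  - by apply: le_lt_trans; [apply: probability_le1; exact: mitv|exact: ltry].
  - exact: measurable_funTS.
  - exists M; split; first exact: num_real.
    by move=> M' MM' x /=; rewrite /itv/= in_itv/= => /fM/le_trans; apply; exact: ltW.
have cf : continuous (fun x : R => x ^+ 2 - s ^+ 2).
  by move=> x; apply: (@cvgB _ R^o); [exact: exprn_continuous|exact: cvg_cst].
have fM x : - n.+1%:R <= x <= n.+1%:R -> `|x ^+ 2 - s ^+ 2| <= n.+1%:R ^+ 2 + s ^+ 2.
  move=> /bx2 h; rewrite ler_norml; have := sqr_ge0 x; have := sqr_ge0 s.
  by have := sqr_ge0 (n.+1%:R : R); lra.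
have E := integral_normal_itv n0 cf fM dF.
rewrite (_ : \int[N]_(x in itv n) (x ^+ 2)%:E =
   \int[N]_(x in itv n) ((x ^+ 2 - s ^+ 2)%:E + (s ^+ 2)%:E))%E; last first.
  by apply: eq_integral => x _; rewrite -EFinD subrK.
rewrite integralD//=; last 2 first.
- apply: iN fM; exact: continuous_measurable_fun.
- by apply: (@iN (fun=> s ^+ 2) (s ^+ 2)) => // x _; rewrite ger0_norm ?sqr_ge0.
rewrite E integral_cst//=.
apply: (@le_trans _ _ (0 + (s ^+ 2)%:E * 1)%E); last by rewrite add0e mule1.
apply: leeD; last by rewrite lee_wpmul2l ?lee_fin ?sqr_ge0//; by apply: probability_le1; exact: mitv.
rewrite lee_fin /F phi_even /GRing.scale/=.
have : 0 <= s ^+ 2 * (n.+1%:R * phi n.+1%:R).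
  by rewrite mulr_ge0 ?sqr_ge0// mulr_ge0// normal_pdf_ge0.
by lra.
all: exact: mitv.
Qed.

Lemma normal_symmetric_mean :
  (\int[N]_x (Num.max x 0)%:E = \int[N]_x (Num.max (- x) 0)%:E)%E.
Proof.
have m1 : measurable_fun [set: R] (fun x : R => Num.max x 0) by exact: measurable_maxr.
have m2 : measurable_fun [set: R] (fun x : R => Num.max (- x) 0).
  by apply: measurable_maxr => //; exact: measurableT_comp.
have c1 := cvg_itv m1 (fun x => ltac:(by rewrite le_max lexx orbT)).
have c2 := cvg_itv m2 (fun x => ltac:(by rewrite le_max lexx orbT)).
suff E : (fun i => \int[N]_(x in itv i) (Num.max x 0)%:E)%E =
    (fun i => \int[N]_(x in itv i) (Num.max (- x) 0)%:E)%E.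
  by rewrite E in c1; exact: (cvg_unique _ c1 c2).
apply/funext => n.
have n0 : 0 < n.+1%:R :> R by rewrite ltr0n.
have Nn0 : - n.+1%:R < 0 :> R by lra.
have d1 (x : R) : is_derive x (1 : R) (- s ^+ 2 *: phi) (x * phi x).
  rewrite (_ : x * phi x = - s ^+ 2 *: (- (x / s ^+ 2) * phi x)).
    exact: is_deriveZ.
  by rewrite /GRing.scale/=; field.
have d2 (x : R) : is_derive x (1 : R) (s ^+ 2 *: phi) (- x * phi x).
  rewrite (_ : - x * phi x = s ^+ 2 *: (- (x / s ^+ 2) * phi x)).
    exact: is_deriveZ.
  by rewrite /GRing.scale/=; field.
have E1 := @integral_normal_itv (fun x => x) _ 0 n.+1%:R n.+1%:R n0
  (fun x => @cvg_id _ _) ltac:(by move=> x /andP[x0 xn]; rewrite ger0_norm) d1.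
have E2 := @integral_normal_itv (fun x => - x) _ (- n.+1%:R) 0 n.+1%:R Nn0
  (@oppr_continuous _ _) ltac:(by move=> x /andP[xn x0]; rewrite normrN ler0_norm// lerNl) d2.
transitivity (\int[N]_(x in `[0%R, n.+1%:R]) x%:E)%E.
  rewrite (_ : [set` `[0%R, n.+1%:R]] = itv n `&` `[0, +oo[); last first.
    apply/seteqP; split=> x; rewrite /itv/= !in_itv/= andbT.
      by move=> /andP[x0 ->]; rewrite andbT (le_trans (ltW Nn0)).
    by move=> [/andP[_ ->] ->].
  rewrite integral_mkcondr; apply: eq_integral => x _; rewrite patchE.
  case: ifPn; rewrite ?inE/= ?notin_setE/= ?in_itv/= andbT.
    by move=> x0; rewrite max_l.
  by move=> /negP; rewrite -ltNge => /ltW x0; rewrite max_r.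
rewrite E1; apply/esym.
transitivity (\int[N]_(x in `[(- n.+1%:R)%R, 0%R]) (- x)%:E)%E.
  rewrite (_ : [set` `[(- n.+1%:R)%R, 0%R]] = itv n `&` `]-oo, 0]); last first.
    apply/seteqP; split=> x; rewrite /itv/= !in_itv/=.
      by move=> /andP[-> x0]; rewrite x0 (le_trans x0 (ltW n0)).
    by move=> [/andP[-> _] ->].
  rewrite integral_mkcondr; apply: eq_integral => x _; rewrite patchE.
  case: ifPn; rewrite ?inE/= ?notin_setE/= ?in_itv/=.
    by move=> x0; rewrite max_l// oppr_ge0.
  by move=> /negP; rewrite -ltNge => /ltW x0; rewrite max_r// oppr_le0.
rewrite E2; congr EFin.
have ZE (c : R) x : (c *: phi) x = c * phi x by [].
by rewrite !ZE phi_even; ring.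
Qed.

End GaussianMoments.

(** * Variables measurable with respect to a sub-sigma-algebra *)

Section SubSigmaAlgebra.
Context {R : realType} {d : measure_display} {Omega : measurableType d}.
Variables (A : set_system Omega).
Hypothesis sA : sigma_algebra setT A.

(** A sub-sigma-algebra is the sigma-algebra of another measurable structure on the same
    space, so that the closure properties of measurable functions carry over. *)
Lemma sub_measurableP (X : Omega -> R) : sub_measurable A X <->
  measurable_fun setT (X : g_sigma_algebraType A -> R).
Proof.
have E : <<s A >> = A by exact: sigma_algebra_id.
split=> [XA _ B mB|mX _ [B mB <-]].
  by rewrite /measurable/= E; apply: XA; exists B.
by have := mX measurableT B mB; rewrite /measurable/= E.
Qed.

Lemma sub_measurable_set (X : Omega -> R) (B : set R) : sub_measurable A X ->
  measurable B -> A (X @^-1` B).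
Proof. by move=> XA mB; apply: XA; exists B; rewrite ?setTI. Qed.

Lemma sub_measurableM (X Y : Omega -> R) : sub_measurable A X -> sub_measurable A Y ->
  sub_measurable A (fun omega => X omega * Y omega).
Proof.
by move=> /sub_measurableP mX /sub_measurableP mY; apply/sub_measurableP; exact: measurable_funM.
Qed.

Lemma sub_measurableD (X Y : Omega -> R) : sub_measurable A X -> sub_measurable A Y ->
  sub_measurable A (fun omega => X omega + Y omega).
Proof.
by move=> /sub_measurableP mX /sub_measurableP mY; apply/sub_measurableP; exact: measurable_funD.
Qed.

Lemma sub_measurable_comp (f : R -> R) (X : Omega -> R) : measurable_fun setT f ->
  sub_measurable A X -> sub_measurable A (f \o X).
Proof.
by move=> mf /sub_measurableP mX; apply/sub_measurableP; exact: measurableT_comp.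
Qed.

Lemma sub_measurable_cst (c : R) : sub_measurable A (fun=> c).
Proof. by apply/sub_measurableP; exact: measurable_cst. Qed.

Lemma sub_measurable_sum I (r : seq I) (p : pred I) (X : I -> Omega -> R) :
  (forall i, p i -> sub_measurable A (X i)) ->
  sub_measurable A (fun omega => \sum_(i <- r | p i) X i omega).
Proof.
move=> XA; elim: r => [|i r IH].
  by under eq_fun do rewrite big_nil; exact: sub_measurable_cst.
under eq_fun do rewrite big_cons.
by case pi: (p i) => //; apply: sub_measurableD => //; exact: XA.
Qed.

Lemma sub_measurable_indic (B : set Omega) : A B -> sub_measurable A (\1_B : Omega -> R).
Proof.
move=> AB; apply/sub_measurableP; apply: (@measurable_indic _ (g_sigma_algebraType A)).
exact: sub_sigma_algebra.
Qed.

Lemma sub_measurableW (B : set_system Omega) (X : Omega -> R) : A `<=` B ->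
  sub_measurable A X -> sub_measurable B X.
Proof. by move=> AB XA C /XA/AB. Qed.

Lemma sub_measurable_measurable (X : Omega -> R) : A `<=` measurable ->
  sub_measurable A X -> measurable_fun setT X.
Proof. by move=> Am XA _ B mB; apply: Am; apply: XA; exists B. Qed.

End SubSigmaAlgebra.

(** * Increments of the Wiener process *)

Section Independence.
Context {R : realType} {d : measure_display} {Omega : measurableType d}.
Variable P : probability Omega R.

(** The joint law of independent variables is the product of their laws, so that
    the expectation of a product factors. *)
Lemma integral_indep (U V : Omega -> R) : measurable_fun setT U -> measurable_fun setT V ->
  (forall x, 0 <= U x) -> (forall x, 0 <= V x) ->
  (forall A B : set R, measurable A -> measurable B ->
    P (U @^-1` A `&` V @^-1` B) = (P (U @^-1` A) * P (V @^-1` B))%E) ->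
  (\int[P]_x (U x * V x)%:E = \int[P]_x (U x)%:E * \int[P]_x (V x)%:E)%E.
Proof.
move=> mU mV U0 V0 UV.
pose X : {mfun Omega >-> R} := @mfun_Sub _ _ _ _ U (mem_set mU).
pose Y : {mfun Omega >-> R} := @mfun_Sub _ _ _ _ V (mem_set mV).
have XE : X = U :> (_ -> _) by [].
pose m1 := distribution P X; pose m2 := distribution P Y.
pose XY x := (U x, V x).
have mXY : measurable_fun setT XY by exact: measurable_fun_pair.
pose f (z : R * R) : \bar R := (`|z.1| * `|z.2|)%:E.
have mf : measurable_fun setT f.
  by apply/measurable_EFinP/measurable_funM; apply: measurableT_comp.
have f0 z : (0 <= f z)%E by rewrite lee_fin mulr_ge0.
transitivity (\int[pushforward P XY]_z f z)%E.
  rewrite (ge0_integral_pushforward mXY)//.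
  by apply: eq_integral => x _ /=; rewrite /f/= !ger0_norm.
transitivity (\int[m1 \x m2]_z f z)%E.
  apply: eq_measure_integral => A mA _; apply/esym.
  apply: (@product_measure_unique _ _ _ _ _ m1 m2
    (measure_function_pushforward__canonical__measure_function_Measure P mXY)) => //.
rewrite fubini_tonelli1// /fubini_F/=.
have mn : measurable_fun [set: R] (fun y : R => `|y|%:E).
  by apply/measurable_EFinP; exact: normr_measurable.
have nV : (\int[P]_x (V x)%:E = \int[m2]_y `|y|%:E)%E.
  rewrite [RHS](ge0_integral_pushforward mV _ measurableT mn)//.
  by apply: eq_integral => x _ /=; rewrite ger0_norm.
have nU : (\int[P]_x (U x)%:E = \int[m1]_y `|y|%:E)%E.
  rewrite [RHS](ge0_integral_pushforward mU _ measurableT mn)//.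
  by apply: eq_integral => x _ /=; rewrite ger0_norm.
rewrite nU nV -ge0_integralZr//; last by apply: integral_ge0 => y _; rewrite lee_fin.
apply: eq_integral => x _; rewrite /f/=.
under eq_integral do rewrite EFinM.
by rewrite ge0_integralZl.
Qed.

End Independence.

Section WienerIncrement.
Context {R : realType} {d : measure_display} {Omega : measurableType d}.
Variables (P : probability Omega R) (F : R -> set_system Omega).
Hypothesis F_filtration : is_filtration F.
Variable w : R -> Omega -> R.
Hypothesis w_wiener : is_wiener P F w.

Let sF t : 0 <= t -> sigma_algebra setT (F t).
Proof. by case: F_filtration => + _ _; exact. Qed.

Let Fm t : 0 <= t -> F t `<=` measurable.
Proof. by case: F_filtration => _ + _; exact. Qed.

Lemma measurable_wiener t : 0 <= t -> measurable_fun setT (w t).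
Proof.
by move=> t0; apply: (sub_measurable_measurable (Fm t0)); case: w_wiener => + _ _ _ _; exact.
Qed.

Section OneIncrement.
Variables s t : R.
Hypothesis s_ge0 : 0 <= s.
Hypothesis st : s < t.
Local Notation Delta := (increment w s t).

Let t_ge0 : 0 <= t. Proof. exact: le_trans s_ge0 (ltW st). Qed.

Lemma measurable_increment : measurable_fun setT Delta.
Proof.
by apply: measurable_realfun.measurable_funB; exact: measurable_wiener.
Qed.

Let ts_gt0 : 0 < Num.sqrt (t - s). Proof. by rewrite sqrtr_gt0 subr_gt0. Qed.

Let integral_increment (f : R -> R) : measurable_fun setT f -> (forall x, 0 <= f x) ->
  (\int[P]_x (f (Delta x))%:E = \int[normal_prob 0 (Num.sqrt (t - s))]_x (f x)%:E)%E.
Proof.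
move=> mf f0; have mD := measurable_increment.
pose D' : Omega -> measurableTypeR R := Delta.
have mD' : measurable_fun setT D' by exact: mD.
pose f' : measurableTypeR R -> \bar R := fun x => (f x)%:E.
transitivity (\int[pushforward P D']_x f' x)%E.
  rewrite (ge0_integral_pushforward mD' _ measurableT)//.
  - by apply/measurable_EFinP; exact: mf.
  - by move=> y _; rewrite lee_fin.
pose N : {measure set (measurableTypeR R) -> \bar R} := normal_prob 0 (Num.sqrt (t - s)).
pose PD : {measure set (measurableTypeR R) -> \bar R} :=
  measure_function_pushforward__canonical__measure_function_Measure P mD'.
apply: (@eq_measure_integral _ (measurableTypeR R) R setT N PD f') => A mA _.
by case: w_wiener => _ _ _ + _ => /(_ s t A s_ge0 st mA).
Qed.

Let indep_increment (U : Omega -> R) (f : R -> R) : sub_measurable (F s) U ->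
  (forall x, 0 <= U x) -> measurable_fun setT f -> (forall x, 0 <= f x) ->
  (\int[P]_x (U x * f (Delta x))%:E = \int[P]_x (U x)%:E * \int[P]_x (f (Delta x))%:E)%E.
Proof.
move=> FU U0 mf f0; have mD := measurable_increment.
apply: integral_indep => //.
- exact: sub_measurable_measurable (Fm s_ge0) FU.
- exact: measurableT_comp.
move=> A B mA mB; case: w_wiener => _ _ _ _ /(_ s t (U @^-1` A) (f @^-1` B)).
rewrite comp_preimage; apply => //; first exact: (sub_measurable_set FU mA).
by rewrite -[X in measurable X]setTI; exact: mf.
Qed.

Lemma integral_increment_sqr (U : Omega -> R) : sub_measurable (F s) U ->
  (forall x, 0 <= U x) ->
  (\int[P]_x (U x * Delta x ^+ 2)%:E <= \int[P]_x (U x)%:E * (t - s)%:E)%E.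
Proof.
move=> FU U0; rewrite (@indep_increment U (fun x => x ^+ 2))//;
  last by move=> x; exact: sqr_ge0.
apply: lee_wpmul2l; first by apply: integral_ge0 => x _; rewrite lee_fin.
rewrite (@integral_increment (fun x => x ^+ 2))//;
  last by move=> x; exact: sqr_ge0.
rewrite (le_trans (normal_second_moment ts_gt0))//.
by rewrite sqr_sqrtr// subr_ge0 ltW.
Qed.

Let integrable_Delta_abs : P.-integrable setT (EFin \o Delta).
Proof.
have mD := measurable_increment.
apply/integrableP; split; first exact/measurable_EFinP.
apply: (@le_lt_trans _ _ (\int[P]_x (1 + 1 * Delta x ^+ 2)%:E)%E).
  apply: ge0_le_integral => //.
  - by apply/measurable_EFinP; exact: measurableT_comp.
  - apply/measurable_EFinP; apply: measurable_realfun.measurable_funD => //.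
    by apply: measurable_realfun.measurable_funM => //; exact: measurable_funX.
  - move=> x _; rewrite lee_fin mul1r -(real_normK (num_real (Delta x))).
    by have := sqr_ge0 (`|Delta x| - 1); have := sqr_ge0 `|Delta x|; lra.
under eq_integral do rewrite EFinD.
rewrite ge0_integralD//; last 2 first.
- by move=> x _; rewrite lee_fin mul1r sqr_ge0.
- apply/measurable_EFinP.
  by apply: measurable_realfun.measurable_funM => //; exact: measurable_funX.
rewrite integral_cst//= probability_setT mul1e lte_add_pinfty ?ltry//.
apply: le_lt_trans (@integral_increment_sqr (fun=> 1) _ _) _.
- exact: sub_measurable_cst (sF s_ge0) _.
- by move=> x.
- by rewrite integral_cst//= probability_setT mule1 mul1e ltry.
Qed.

(** A variable known at time [s] is orthogonal to the increment after [s]: the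
    expectations of [U^+ Delta^+], [U^+ Delta^-], [U^- Delta^+] and [U^- Delta^-]
    factor, and [Delta^+] and [Delta^-] have the same mean. *)
Lemma integral_increment0 (U : Omega -> R) : sub_measurable (F s) U ->
  P.-integrable setT (EFin \o U) ->
  P.-integrable setT (EFin \o (fun x => U x * Delta x)) /\
  \int[P]_x (U x * Delta x) = 0.
Proof.
move=> FU iU; have mD := measurable_increment.
have mU : measurable_fun setT U by exact: sub_measurable_measurable (Fm s_ge0) FU.
have mpos : measurable_fun [set: R] (fun x : R => Num.max x 0) by exact: measurable_maxr.
have mneg : measurable_fun [set: R] (fun x : R => Num.max (- x) 0).
  by apply: measurable_maxr => //; exact: measurableT_comp.
have pos0 (x : R) : 0 <= Num.max x 0 by rewrite le_max lexx orbT.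
have posabs (x : R) : Num.max x 0 <= `|x| by rewrite ge_max ler_norm normr_ge0.
have negabs (x : R) : Num.max (- x) 0 <= `|x| by rewrite -normrN.
have comp_int (f : R -> R) (X : Omega -> R) : measurable_fun setT f ->
    (forall x, 0 <= f x) -> (forall x, f x <= `|x|) -> measurable_fun setT X ->
    P.-integrable setT (EFin \o X) -> P.-integrable setT (EFin \o (fun x => f (X x))).
  move=> mf f0 fa mX iX; apply: le_integrable iX => //.
    by apply/measurable_EFinP; exact: measurableT_comp.
  by move=> x _; rewrite lee_fin ger0_norm.
have prod (f h : R -> R) : measurable_fun setT f -> (forall x, 0 <= f x) ->
    (forall x, f x <= `|x|) ->
    measurable_fun setT h -> (forall x, 0 <= h x) -> (forall x, h x <= `|x|) ->
    P.-integrable setT (EFin \o (fun x => f (U x) * h (Delta x))) /\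
    \int[P]_x (f (U x) * h (Delta x)) =
      \int[P]_x f (U x) * \int[P]_x h (Delta x).
  move=> mf f0 fa mh h0 ha.
  have ifU := comp_int _ _ mf f0 fa mU iU.
  have ihD := comp_int _ _ mh h0 ha mD integrable_Delta_abs.
  have E := @indep_increment (f \o U) h (sub_measurable_comp (sF s_ge0) mf FU)
    (fun x => f0 _) mh h0.
  have fU : (\int[P]_x (f (U x))%:E \is a fin_num)%E by exact: integrable_fin_num.
  have fD : (\int[P]_x (h (Delta x))%:E \is a fin_num)%E by exact: integrable_fin_num.
  split; last by rewrite /Rintegral E fineM.
  apply/integrableP; split.
    by apply/measurable_EFinP/measurable_realfun.measurable_funM; exact: measurableT_comp.
  rewrite (_ : (\int[P]_x _)%E = (\int[P]_x (f (U x) * h (Delta x))%:E)%E).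
    by rewrite E ltey_eq fin_numM.
  by apply: eq_integral => x _ /=; rewrite ger0_norm// mulr_ge0.
have [iA _] := prod _ _ (@normr_measurable R setT) (fun x => normr_ge0 x) (fun x => lexx _)
  (@normr_measurable R setT) (fun x => normr_ge0 x) (fun x => lexx _).
have [ipp pp] := prod _ _ mpos pos0 posabs mpos pos0 posabs.
have [ipn pn] := prod _ _ mpos pos0 posabs mneg (fun x => pos0 _) negabs.
have [inp np] := prod _ _ mneg (fun x => pos0 _) negabs mpos pos0 posabs.
have [inn nn] := prod _ _ mneg (fun x => pos0 _) negabs mneg (fun x => pos0 _) negabs.
have sym : \int[P]_x Num.max (Delta x) 0 = \int[P]_x Num.max (- Delta x) 0.
  rewrite /Rintegral (@integral_increment (fun x => Num.max x 0))//.
  rewrite (@integral_increment (fun x => Num.max (- x) 0))//.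
  by rewrite normal_symmetric_mean.
have decomp x : U x * Delta x =
    (Num.max (U x) 0 * Num.max (Delta x) 0 - Num.max (U x) 0 * Num.max (- Delta x) 0)
    - (Num.max (- U x) 0 * Num.max (Delta x) 0 - Num.max (- U x) 0 * Num.max (- Delta x) 0).
  have e (z : R) : z = Num.max z 0 - Num.max (- z) 0.
    have [z0|z0] := leP 0 z.
      by rewrite max_r ?subr0// oppr_le0.
    by rewrite max_l ?sub0r ?opprK// oppr_ge0 ltW.
  by rewrite {1}(e (U x)) {1}(e (Delta x)); ring.
split.
  apply: le_integrable iA => //.
    by apply/measurable_EFinP; exact: measurable_realfun.measurable_funM.
  by move=> x _; rewrite lee_fin normrM [leRHS]ger0_norm// mulr_ge0.
rewrite (@eq_Rintegral _ _ _ _ _ (fun x =>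
    (Num.max (U x) 0 * Num.max (Delta x) 0 - Num.max (U x) 0 * Num.max (- Delta x) 0)
    - (Num.max (- U x) 0 * Num.max (Delta x) 0 - Num.max (- U x) 0 * Num.max (- Delta x) 0)));
  last by move=> x _; exact: decomp.
rewrite RintegralB//; last 2 first.
- by have := integrableB measurableT ipp ipn; apply: eq_integrable.
- by have := integrableB measurableT inp inn; apply: eq_integrable.
by rewrite !RintegralB// pp pn np nn sym !subrr.
Qed.

End OneIncrement.
End WienerIncrement.

(** * Stochastic integrals of step processes *)

Section DiscreteIntegral.
Context {R : realType} {d : measure_display} {Omega : measurableType d}.
Variables (P : probability Omega R) (F : R -> set_system Omega).
Hypothesis F_filtration : is_filtration F.
Variable w : R -> Omega -> R.
Hypothesis w_wiener : is_wiener P F w.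
Implicit Types (s u : R) (l : seq (R * (Omega -> R))) (U V : Omega -> R).

Let sF t : 0 <= t -> sigma_algebra setT (F t).
Proof. by case: F_filtration => + _ _; exact. Qed.

Let Fm t : 0 <= t -> F t `<=` measurable.
Proof. by case: F_filtration => _ + _; exact. Qed.

Let Fle s t : 0 <= s -> s <= t -> F s `<=` F t.
Proof. by case: F_filtration => _ _; exact. Qed.

(** A list [(u1, X1); (u2, X2); ...] stands for the step process that is [X1] on
    [(s, u1]], [X2] on [(u1, u2]] and so on: [dint] is its stochastic integral and [dqv]
    the integral of its square. *)
Fixpoint dint s l (omega : Omega) : R :=
  if l is (u, X) :: l' then X omega * increment w s u omega + dint u l' omega else 0.

Fixpoint dqv s l (omega : Omega) : R :=
  if l is (u, X) :: l' then X omega ^+ 2 * (u - s) + dqv u l' omega else 0.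

Fixpoint adapted s l : Prop :=
  if l is (u, X) :: l' then
    [/\ s < u, sub_measurable (F s) X, bm X & adapted u l'] else True.

Let P1 : (P setT < +oo)%E.
Proof. by rewrite probability_setT ltry. Qed.

Let bmP U : bm U -> P.-integrable setT (EFin \o U).
Proof. by move=> bU; exact: bm_integrable. Qed.

Lemma bm_integrableM U V : bm U -> P.-integrable setT (EFin \o V) ->
  P.-integrable setT (EFin \o (fun x => U x * V x)).
Proof.
move=> bU iV; have [M M0 UM] := bm_bound bU.
have mV : measurable_fun setT V by apply/measurable_EFinP; exact: measurable_int iV.
have iMV : P.-integrable setT (EFin \o (fun x => M * V x)).
  by have := integrableZl measurableT M iV; apply: eq_integrable.
apply: le_integrable iMV => //.
  apply/measurable_EFinP; apply: measurable_realfun.measurable_funM => //.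
  exact: bU.1.
by move=> x _; rewrite lee_fin !normrM ler_wpM2r// (le_trans (UM x))// ler_norm.
Qed.

Let sqr_integrable U : measurable_fun setT U ->
  P.-integrable setT (EFin \o (fun x => U x ^+ 2)) -> P.-integrable setT (EFin \o U).
Proof.
move=> mU iU2.
have i1 : P.-integrable setT (EFin \o (fun x => 1 + U x ^+ 2)).
  have := integrableD measurableT (bmP (bm_cst 1)) iU2.
  by apply: eq_integrable => // x _ /=; rewrite EFinD.
apply: le_integrable i1 => //; first exact/measurable_EFinP.
move=> x _; rewrite lee_fin [leRHS]ger0_norm ?addr_ge0 ?sqr_ge0//.
rewrite -(real_normK (num_real (U x))).
by have := sqr_ge0 (`|U x| - 1); have := sqr_ge0 `|U x|; lra.
Qed.

Let increment_measurable s u : 0 <= s -> s <= u -> sub_measurable (F u) (increment w s u).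
Proof.
move=> s0 su; have u0 := le_trans s0 su.
have H t : 0 <= t -> t <= u -> sub_measurable (F u) (w t).
  move=> t0 tu; apply: sub_measurableW (Fle t0 tu) _.
  by case: w_wiener => + _ _ _ _; exact.
apply: sub_measurableD; [exact: sF|exact: H|].
by apply: (@sub_measurable_comp _ _ _ _ (sF u0) -%R _ _ (H _ s0 su)); exact: oppr_measurable.
Qed.

Let integrable_increment_sqr V s u : 0 <= s -> s < u -> sub_measurable (F s) V ->
  P.-integrable setT (EFin \o (fun x => V x ^+ 2)) ->
  P.-integrable setT (EFin \o (fun x => (V x * increment w s u x) ^+ 2)) /\
  \int[P]_x (V x * increment w s u x) ^+ 2 <= (\int[P]_x V x ^+ 2) * (u - s).
Proof.
move=> s0 su FV iV; have mV := sub_measurable_measurable (Fm s0) FV.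
have mD := measurable_increment F_filtration w_wiener s0 su.
have FV2 : sub_measurable (F s) (fun x => V x ^+ 2).
  by apply: (sub_measurable_comp (sF s0) (f := fun x => x ^+ 2)) => //; exact: exprn_measurable.
have le := integral_increment_sqr F_filtration w_wiener s0 su FV2 (fun x => sqr_ge0 _).
have E : (\int[P]_x ((V x * increment w s u x) ^+ 2)%:E =
    \int[P]_x (V x ^+ 2 * increment w s u x ^+ 2)%:E)%E.
  by apply: eq_integral => x _; rewrite exprMn.
have f2 : (\int[P]_x (V x ^+ 2)%:E \is a fin_num)%E by exact: integrable_fin_num.
have i : P.-integrable setT (EFin \o (fun x => (V x * increment w s u x) ^+ 2)).
  apply/integrableP; split.
    apply/measurable_EFinP/measurable_funX; exact: measurable_realfun.measurable_funM.
  rewrite (_ : (\int[P]_x _)%E = (\int[P]_x ((V x * increment w s u x) ^+ 2)%:E)%E).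
    by rewrite E (le_lt_trans le)// ltey_eq fin_numM.
  by apply: eq_integral => x _ /=; rewrite ger0_norm ?sqr_ge0.
split=> //; rewrite /Rintegral -lee_fin EFinM !fineK//; last exact: integrable_fin_num.
by rewrite E.
Qed.

Lemma integrable_dint_sqr s l : 0 <= s -> adapted s l ->
  measurable_fun setT (dint s l) /\
  P.-integrable setT (EFin \o (fun x => dint s l x ^+ 2)).
Proof.
elim: l s => [|[u X] l IH] s s0 /=.
  by move=> _; split; [exact: measurable_cst|apply: bmP; apply: bmX2; exact: bm_cst].
move=> [su FX bX al]; have u0 : 0 <= u by exact: le_trans s0 (ltW su).
have [mI iI] := IH u u0 al.
have mD := measurable_increment F_filtration w_wiener s0 su.
have mXD : measurable_fun setT (fun x => X x * increment w s u x).
  by apply: measurable_realfun.measurable_funM => //; exact: bX.1.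
have m1 := measurable_realfun.measurable_funD mXD mI; split=> //.
have [iXD _] := integrable_increment_sqr s0 su FX (bmP (bmX2 bX)).
have iS : P.-integrable setT (EFin \o (fun x =>
    2 * ((X x * increment w s u x) ^+ 2 + dint u l x ^+ 2))).
  have := integrableZl measurableT 2 (integrableD measurableT iXD iI).
  by apply: eq_integrable => // x _ /=; rewrite EFinM EFinD.
apply: le_integrable iS => //; first by apply/measurable_EFinP/measurable_funX.
move=> x _; rewrite lee_fin; set p := X x * _; set q := dint u l x.
have h : 0 <= 2 * (p ^+ 2 + q ^+ 2) by have := sqr_ge0 p; have := sqr_ge0 q; lra.
rewrite (ger0_norm (sqr_ge0 _)) (ger0_norm h).
by have := sqr_ge0 (p - q); lra.
Qed.

(** Condition on the first increment, which is orthogonal to all that is known at [s];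
    the rest of the sum is the same statement from the next point on. *)
Lemma integral_dint0 s l V : 0 <= s -> adapted s l -> sub_measurable (F s) V ->
  P.-integrable setT (EFin \o (fun x => V x ^+ 2)) ->
  P.-integrable setT (EFin \o (fun x => V x * dint s l x)) /\
  \int[P]_x (V x * dint s l x) = 0.
Proof.
elim: l s => [|[u X] l IH] s s0 /=.
  move=> _ _ _; split.
    by under eq_fun do rewrite mulr0; apply: bmP; exact: bm_cst.
  by under eq_Rintegral do rewrite mulr0; rewrite Rintegral_cst// mul0r.
move=> [su FX bX al] FV iV; have u0 : 0 <= u by exact: le_trans s0 (ltW su).
have mV := sub_measurable_measurable (Fm s0) FV.
have FuV : sub_measurable (F u) V by apply: sub_measurableW FV; apply: Fle => //; exact: ltW.
have [i1 e1] := IH u u0 al FuV iV.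
have FVX : sub_measurable (F s) (fun x => X x * V x) by apply: sub_measurableM => //; exact: sF.
have iVX := bm_integrableM bX (sqr_integrable mV iV).
have [i2 e2] := integral_increment0 F_filtration w_wiener s0 su FVX iVX.
have E x : V x * (X x * increment w s u x + dint u l x) =
    X x * V x * increment w s u x + V x * dint u l x by ring.
split.
  by have := integrableD measurableT i2 i1; apply: eq_integrable => // x _ /=; rewrite E EFinD.
by under eq_Rintegral do rewrite E; rewrite RintegralD// e1 e2 addr0.
Qed.

Lemma bm_dqv s l : adapted s l -> bm (dqv s l).
Proof.
elim: l s => [|[u X] l IH] s /=; first by move=> _; exact: bm_cst.
move=> [_ _ bX al]; apply: bmD; last exact: IH.
by apply: bmM; [exact: bmX2|exact: bm_cst].
Qed.

(** The inequality half of the isometry: the cross terms vanish because each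
    integrand is known before the increments that follow it. *)
Lemma integral_dint_sqr s l U : 0 <= s -> adapted s l -> sub_measurable (F s) U ->
  bm U -> (forall x, 0 <= U x) ->
  \int[P]_x (U x * dint s l x ^+ 2) <= \int[P]_x (U x * dqv s l x).
Proof.
elim: l s U => [|[u X] l IH] s U s0 /=.
  by move=> _ _ _ _; under eq_Rintegral do rewrite expr0n.
move=> [su FX bX al] FU bU U0; have u0 : 0 <= u by exact: le_trans s0 (ltW su).
have FuU : sub_measurable (F u) U by apply: sub_measurableW FU; apply: Fle => //; exact: ltW.
have := IH u U u0 al FuU bU U0.
have [mI iI] := integrable_dint_sqr u0 al.
pose r x := Num.sqrt (U x).
have mr : measurable_fun [set: R] (@Num.sqrt R).
  by apply: continuous_measurable_fun; exact: sqrt_continuous.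
have Fr : sub_measurable (F s) r by apply: sub_measurable_comp => //; exact: sF.
have rE x : r x ^+ 2 = U x by rewrite sqr_sqrtr.
have FrX : sub_measurable (F s) (fun x => r x * X x) by apply: sub_measurableM => //; exact: sF.
have irX : P.-integrable setT (EFin \o (fun x => (r x * X x) ^+ 2)).
  have : bm (fun x => U x * X x ^+ 2) by apply: bmM => //; exact: bmX2.
  by move/bmP; apply: eq_integrable => // x _ /=; rewrite exprMn rE.
have [i1 e1] := integrable_increment_sqr s0 su FrX irX.
pose V x := U x * X x * increment w s u x.
have FV : sub_measurable (F u) V.
  apply: sub_measurableM; [exact: sF| |by apply: increment_measurable => //; exact: ltW].
  apply: sub_measurableW (Fle s0 (ltW su)) _.
  by apply: sub_measurableM => //; exact: sF.
have iV : P.-integrable setT (EFin \o (fun x => V x ^+ 2)).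
  have := bm_integrableM bU i1; apply: eq_integrable => // x _ /=.
  by congr EFin; rewrite /V !exprMn rE; ring.
have [i2 e2] := integral_dint0 u0 al FV iV.
have i3 := bm_integrableM bU iI.
have E x : U x * (X x * increment w s u x + dint u l x) ^+ 2 =
    ((r x * X x * increment w s u x) ^+ 2 + 2 * (V x * dint u l x)) + U x * dint u l x ^+ 2.
  by rewrite !exprMn rE /V; ring.
under [leLHS in _ -> leLHS <= _]eq_Rintegral do rewrite E.
have i2' : P.-integrable setT (EFin \o (fun x => 2 * (V x * dint u l x))).
  by have := integrableZl measurableT 2 i2; apply: eq_integrable.
have i12 : P.-integrable setT (EFin \o (fun x =>
    (r x * X x * increment w s u x) ^+ 2 + 2 * (V x * dint u l x))).
  by have := integrableD measurableT i1 i2'; apply: eq_integrable.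
rewrite RintegralD// RintegralD// RintegralZl// e2 mulr0 addr0 => le.
have bq := bm_dqv al.
have -> : \int[P]_x (U x * (X x ^+ 2 * (u - s) + dqv u l x)) =
    \int[P]_x (r x * X x) ^+ 2 * (u - s) + \int[P]_x (U x * dqv u l x).
  under eq_Rintegral do rewrite mulrDr.
  rewrite RintegralD//; last 2 first.
  - by apply: bmP; apply: bmM => //; apply: bmM; [exact: bmX2|exact: bm_cst].
  - by apply: bmP; exact: bmM.
  rewrite -RintegralZr//; congr (_ + _); apply: eq_Rintegral => x _.
  by rewrite exprMn rE mulrA.
exact: lerD.
Qed.

(** [gamma] is what remains of the budget for the quadratic variation.  A coefficient
    that would overdraw it is replaced by [0], which can be decided before the increment
    that it multiplies. *)
Fixpoint stopped (gamma : Omega -> R) s l : seq (R * (Omega -> R)) :=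
  if l is (u, X) :: l' then
    (u, fun x => X x * \1_[set x | X x ^+ 2 * (u - s) <= gamma x] x)
      :: stopped (fun x => gamma x - X x ^+ 2 * (u - s)) u l'
  else [::].

Lemma stopped_adapted gamma s l : 0 <= s -> sub_measurable (F s) gamma ->
  adapted s l -> adapted s (stopped gamma s l).
Proof.
elim: l s gamma => [//|[u X] l IH] s gamma s0 Fg /= [su FX bX al].
have u0 : 0 <= u by exact: le_trans s0 (ltW su).
have FX2 : sub_measurable (F s) (fun x => X x ^+ 2 * (u - s)).
  apply: sub_measurableM; [exact: sF| |exact: sub_measurable_cst (sF s0) _].
  by apply: (sub_measurable_comp (sF s0) (f := fun x => x ^+ 2)) => //; exact: exprn_measurable.
have FA : F s [set x | X x ^+ 2 * (u - s) <= gamma x].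
  rewrite -[F s](sigma_algebra_id (sF s0)).
  by apply: (@measurable_leset R _ (g_sigma_algebraType (F s))); apply/(sub_measurableP (sF s0)).
split => //.
- by apply: sub_measurableM => //; [exact: sF|apply: sub_measurable_indic => //; exact: sF].
- by apply: bmM => //; apply: bm_indic; exact: Fm FA.
- apply: IH => //; apply: sub_measurableD; [exact: sF| |].
    by apply: sub_measurableW Fg; apply: Fle => //; exact: ltW.
  apply: (sub_measurable_comp (sF u0) (f := fun x => - x)); first exact: oppr_measurable.
  by apply: sub_measurableW FX2; apply: Fle => //; exact: ltW.
Qed.

Lemma dqv_ge0 s l x : adapted s l -> 0 <= dqv s l x.
Proof.
elim: l s => [//|[u X] l IH] s /= [su _ _ al].
by rewrite addr_ge0 ?IH// mulr_ge0 ?sqr_ge0// subr_ge0 ltW.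
Qed.

Lemma dqv_stopped gamma s l x : adapted s l ->
  dqv s (stopped gamma s l) x <= Num.max (gamma x) 0.
Proof.
elim: l s gamma => [|[u X] l IH] s gamma /=; first by rewrite le_max lexx orbT.
move=> [su _ _ al].
have q0 : 0 <= X x ^+ 2 * (u - s) by rewrite mulr_ge0 ?sqr_ge0// subr_ge0 ltW.
have := IH u (fun x => gamma x - X x ^+ 2 * (u - s)) al.
have [le|lt] := leP (X x ^+ 2 * (u - s)) (gamma x).
  rewrite indicE mem_set//= mulr1.
  rewrite [Num.max (gamma x) 0]max_l; last exact: le_trans le.
  by rewrite max_l ?subr_ge0// => h; rewrite -lerBrDl.
rewrite indicE memNset/=; last by apply/negP; rewrite -ltNge.
rewrite mulr0 expr0n/= mul0r add0r max_r; last by rewrite subr_le0 ltW.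
by move/le_trans; apply; rewrite le_max lexx orbT.
Qed.

Lemma dint_stopped gamma s l x : adapted s l -> dqv s l x <= gamma x ->
  dint s (stopped gamma s l) x = dint s l x.
Proof.
elim: l s gamma => [//|[u X] l IH] s gamma /= [su _ _ al] le.
have q0 := dqv_ge0 x al.
have le1 : X x ^+ 2 * (u - s) <= gamma x by apply: le_trans le; rewrite lerDl.
by rewrite indicE mem_set// mulr1 IH// lerBrDl.
Qed.

(** Stop the integrand before its quadratic variation exceeds [gamma]: nothing
    changes on the event, and the stopped sum has second moment at most [gamma]. *)
Lemma dint_prob_le s l (gamma eta : R) : 0 <= s -> adapted s l -> 0 <= gamma -> 0 < eta ->
  (P [set x | (dqv s l x <= gamma)%R /\ (eta <= `|dint s l x|)%R]
     <= (gamma / eta ^+ 2)%:E)%E.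
Proof.
move=> s0 al g0 eta0.
pose k := stopped (fun=> gamma) s l.
have ak : adapted s k by apply: stopped_adapted => //; exact: sub_measurable_cst (sF s0) _.
have [mI iI] := integrable_dint_sqr s0 ak.
have [mJ _] := integrable_dint_sqr s0 al.
have := integral_dint_sqr s0 ak (@sub_measurable_cst R _ _ _ (sF s0) 1) (bm_cst 1) (fun=> ler01).
under eq_Rintegral do rewrite mul1r.
under [leRHS in _ <= leRHS -> _]eq_Rintegral do rewrite mul1r.
move=> le.
have le2 : \int[P]_x dqv s k x <= gamma.
  apply: le_trans (_ : \int[P]_x gamma <= _).
    apply: le_Rintegral => //; [by apply: bmP; exact: bm_dqv|by apply: bmP; exact: bm_cst|].
    by move=> x _; rewrite (le_trans (dqv_stopped _ x al))// max_l.
  by rewrite Rintegral_cst//= probability_setT mulr1.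
set A := [set x | _].
have mA : measurable A.
  apply: measurableI.
    by apply: measurable_leset; [exact: (bm_dqv al).1|exact: measurable_cst].
  by apply: measurable_leset; [exact: measurable_cst|exact: measurableT_comp].
have e2 : 0 < eta ^+ 2 by rewrite exprn_gt0.
have fA : P A \is a fin_num by exact: fin_num_measure.
rewrite -[P A]fineK// lee_fin ler_pdivlMr// mulrC; apply: le_trans le2.
apply: le_trans le; rewrite -Rintegral_cst//.
rewrite Rintegral_mkcond; apply: le_Rintegral => //.
  by apply: bmP; apply: bm_patch.
move=> x _; rewrite patchE; case: ifPn => [/set_mem[qle dle]|_]; last exact: sqr_ge0.
rewrite /k dint_stopped// -(real_normK (num_real (dint _ _ _))).
by rewrite lerXn2r ?nnegrE// ltW.
Qed.

Definition gridfun (X : R -> Omega -> R) us := [seq (u, X u) | u <- us].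

Lemma grid_gt s us v : path <%R s us -> v \in us -> s < v.
Proof. by move=> /(order_path_min lt_trans)/allP; apply. Qed.

Lemma grid_last s us : path <%R s us -> s <= last s us.
Proof.
case: us => [//|u us] /= p.
by rewrite ltW// (@grid_gt s (u :: us))// mem_last.
Qed.

(** The increments up to [b] add up to [w b - w s]: evaluated on the indicator of [u <= b],
    the recursion [dint] recovers one term of the integral of a simple process. *)
Lemma dint_telescope b s us x : path <%R s us ->
  (s < b -> b <= last s us -> b \in us) ->
  dint s (gridfun (fun u _ => (u <= b)%R%:R) us) x =
  w (Num.min (last s us) b) x - w (Num.min s b) x.
Proof.
elim: us s => [|u us IH] s; first by rewrite /= subrr.
move=> p bus; have := p; rewrite [path _ _ _]/= => /andP[su pus].
have lu := grid_last pus; rewrite /= in lu bus *.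
rewrite IH//; last first.
  by move=> ub bl; have := bus (lt_trans su ub) bl; rewrite in_cons gt_eqF.
have [ub|bu] := leP u b.
  rewrite mulr1n mul1r (min_l (le_trans (ltW su) ub)) /increment; ring.
have bs : b <= s.
  rewrite leNgt; apply/negP => sb; have := bus sb (ltW (lt_le_trans bu lu)).
  rewrite in_cons lt_eqF//= => /(grid_gt pus).
  by rewrite ltNge (ltW bu).
by rewrite mulr0n mul0r add0r (min_r bs).
Qed.

Lemma dint_gridfunB (X Y : R -> Omega -> R) s us x :
  dint s (gridfun (fun u x => X u x - Y u x) us) x =
  dint s (gridfun X us) x - dint s (gridfun Y us) x.
Proof. by elim: us s => [|u us IH] s /=; [rewrite subrr|rewrite IH; ring]. Qed.

Lemma dint_gridfun_sum (N : nat) (c : nat -> Omega -> R) (X : nat -> R -> Omega -> R) s us x :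
  dint s (gridfun (fun u x => \sum_(i < N) c i x * X i u x) us) x =
  \sum_(i < N) c i x * dint s (gridfun (X i) us) x.
Proof.
elim: us s => [|u us IH] s /=; first by rewrite big1// => i _; rewrite mulr0.
rewrite IH mulr_suml -big_split/=; apply: eq_bigr => i _; ring.
Qed.

Lemma eq_dint (X Y : R -> Omega -> R) s us x : (forall u, u \in us -> X u x = Y u x) ->
  dint s (gridfun X us) x = dint s (gridfun Y us) x.
Proof.
elim: us s => [//|u us IH] s /= XY; rewrite XY ?mem_head// IH// => v vus.
by apply: XY; rewrite in_cons vus orbT.
Qed.

(** Between consecutive points of such a grid the simple process is constant, and the
    recursion over the grid applies to it. *)
Definition resolves (Y : simple_process F) s us : Prop :=
  forall i, (i <= sp_size Y)%N -> s < sp_time Y i -> sp_time Y i <= last s us ->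
    sp_time Y i \in us.

Lemma resolves_behead Y s u us : path <%R s (u :: us) -> resolves Y s (u :: us) ->
  resolves Y u us.
Proof.
move=> /= /andP[su pus] r i iN ui il.
by have := r i iN (lt_trans su ui) il; rewrite in_cons gt_eqF.
Qed.

Lemma resolves_head Y s u us i : path <%R s (u :: us) -> resolves Y s (u :: us) ->
  (i <= sp_size Y)%N -> sp_time Y i < u -> sp_time Y i <= s.
Proof.
move=> /= /andP[su pus] r iN iu; rewrite leNgt; apply/negP => si.
have := r i iN si; rewrite /= (le_trans (ltW iu) (grid_last pus)) => /(_ isT).
rewrite in_cons lt_eqF//= => /(grid_gt pus).
by rewrite ltNge (ltW iu).
Qed.

Lemma sp_integral_grid Y s us x : path <%R s us -> resolves Y s us ->
  sp_integral w Y (last s us) x - sp_integral w Y s x =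
  dint s (gridfun (fun u x => sp_value Y u x) us) x.
Proof.
move=> p r; rewrite /sp_integral -sumrB.
rewrite (_ : dint _ _ _ = dint s (gridfun (fun u x => \sum_(i < sp_size Y)
    sp_coef Y i x * ((u <= sp_time Y i.+1)%R%:R - (u <= sp_time Y i)%R%:R)) us) x); last first.
  apply: eq_dint => u _; rewrite /sp_value; apply: eq_bigr => i _; congr (_ * _).
  rewrite indicE; have tt : sp_time Y i <= sp_time Y i.+1 by exact: sp_time_nd.
  rewrite mem_setE in_itv/=; case: (leP u (sp_time Y i)) => [ui|_].
    by rewrite (le_trans ui tt) subrr.
  by rewrite subr0.
rewrite (dint_gridfun_sum (sp_size Y) (sp_coef Y) (fun i u _ =>
  (u <= sp_time Y i.+1)%R%:R - (u <= sp_time Y i)%R%:R)).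
apply: eq_bigr => i _.
rewrite (dint_gridfunB (fun u _ => (u <= sp_time Y i.+1)%R%:R) (fun u _ => (u <= sp_time Y i)%R%:R)).
rewrite !dint_telescope//; last 2 first.
- by apply: r; apply: ltnW; exact: ltn_ord.
- by apply: r; exact: ltn_ord.
by ring.
Qed.

Lemma sp_value_adapted Y s u us : 0 <= s -> path <%R s (u :: us) ->
  resolves Y s (u :: us) -> sub_measurable (F s) (sp_value Y u).
Proof.
move=> s0 p r; apply: sub_measurable_sum; first exact: sF.
move=> i _; have [iu|ui] := ltP (sp_time Y i) u; last first.
  rewrite (_ : (fun _ => _) = fun=> 0); first exact: sub_measurable_cst (sF s0) _.
  by apply/funext => x; rewrite indicE mem_setE in_itv/= ltNge ui mulr0.
apply: sub_measurableM; [exact: sF| |exact: sub_measurable_cst (sF s0) _].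
have ti0 : 0 <= sp_time Y i.
  by apply: le_trans (sp_time_ge0 Y) _; exact: sp_time_nd.
apply: (@sub_measurableW R _ _ (F (sp_time Y i))); last exact: sp_coef_adapted.
apply: Fle => //; apply: (resolves_head p r) => //.
by apply: ltnW; exact: ltn_ord.
Qed.

Lemma sp_value_step Y s u us v x : path <%R s (u :: us) -> resolves Y s (u :: us) ->
  s < v -> v <= u -> sp_value Y v x = sp_value Y u x.
Proof.
move=> p r sv vu; apply: eq_bigr => i _; congr (_ * _); rewrite !indicE !mem_setE !in_itv/=.
have side j : (j <= sp_size Y)%N -> (sp_time Y j < v) = (sp_time Y j < u).
  move=> jN; apply/idP/idP => [/lt_le_trans/(_ vu)//|/(resolves_head p r jN)].
  by move=> /le_lt_trans; apply.
by rewrite !(leNgt _ (sp_time _ _)) side ?side//; apply: ltnW; exact: ltn_ord.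
Qed.

Lemma bm_sp_value (Y : simple_process F) u : bm (sp_value Y u).
Proof.
have t0 i : 0 <= sp_time Y i by apply: le_trans (sp_time_ge0 Y) _; exact: sp_time_nd.
apply: bm_sum => i _; apply: bmM; last exact: bm_cst.
split.
  by apply: (@sub_measurable_measurable R d Omega (F (sp_time Y i)));
    [exact: Fm|exact: sp_coef_adapted].
have [M [_ HM]] := sp_coef_bounded Y i.
by exists (M + 1) => x; apply: HM => //; rewrite ltrDl.
Qed.

(** Sort the jump times of both processes: comparing two simple processes requires a
    common grid. *)
Lemma grid_exists (Y1 Y2 : simple_process F) s t : s < t -> exists us,
  [/\ path <%R s us, last s us = t, resolves Y1 s us & resolves Y2 s us].
Proof.
move=> st.
pose times (Y : simple_process F) := [seq sp_time Y i | i <- iota 0 (sp_size Y).+1].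
pose L := [seq c <- times Y1 ++ times Y2 | s < c < t].
pose us := rcons (sort <=%R (undup L)) t.
have lus : last s us = t by rewrite last_rcons.
have inus c : (c \in times Y1) || (c \in times Y2) -> s < c -> c <= t -> c \in us.
  move=> cY sc; rewrite le_eqVlt mem_rcons in_cons => /predU1P[->|ct]; first by rewrite eqxx.
  by rewrite mem_sort mem_undup mem_filter sc ct mem_cat cY orbT.
have timesP (Y : simple_process F) i : (i <= sp_size Y)%N -> sp_time Y i \in times Y.
  by move=> iN; apply/mapP; exists i => //; rewrite mem_iota.
exists us; split => //.
- have p : path <%R s (sort <=%R (undup L)).
    rewrite path_min_sorted; last first.
      by apply/allP => c; rewrite mem_sort mem_undup mem_filter => /andP[/andP[]].
    by rewrite sort_lt_sorted undup_uniq.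
  rewrite /us rcons_path p/=.
  case: (lastP (sort <=%R (undup L))) (mem_sort <=%R (undup L)) => [_|l c memE]; first by [].
  rewrite last_rcons; have := memE c; rewrite mem_rcons mem_head => /esym.
  by rewrite mem_undup mem_filter => /andP[/andP[]].
- by move=> i iN si; rewrite lus; apply: inus => //; rewrite timesP.
- by move=> i iN si; rewrite lus; apply: inus => //; rewrite timesP ?orbT.
Qed.

Fixpoint steps_on (X : R -> Omega -> R) s us : Prop :=
  if us is u :: us' then
    (forall v, s < v -> v <= u -> X v = X u) /\ steps_on X u us' else True.

Lemma dqv_itg (X : R -> Omega -> R) s us x : path <%R s us -> steps_on X s us ->
  bm (fun v => X v x) ->
  dqv s (gridfun X us) x = itg (fun v => X v x ^+ 2) s (last s us).
Proof.
elim: us s => [|u us IH] s /=.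
  by move=> _ _ _; rewrite /itg set_itvoc0 Rintegral_set0.
move=> /andP[su pus] [Xu st] bX; have bX2 := bmX2 bX.
rewrite (itg_split bX2 (ltW su)); last exact: grid_last.
rewrite IH//; congr (_ + _).
by rewrite (@eq_itg _ _ (fun=> X u x ^+ 2)) ?itg_cst ?ltW// => v sv vu; rewrite Xu.
Qed.

Lemma sp_value_steps (Y : simple_process F) s us : path <%R s us -> resolves Y s us ->
  steps_on (sp_value Y) s us.
Proof.
elim: us s => [//|u us IH] s p r; split.
  by move=> v sv vu; apply/funext => x; exact: sp_value_step p r sv vu.
apply: IH; last exact: resolves_behead r.
by have /andP[] := p.
Qed.

Lemma steps_onB (X Y : R -> Omega -> R) s us : steps_on X s us -> steps_on Y s us ->
  steps_on (fun v x => X v x - Y v x) s us.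
Proof.
elim: us s => [//|u us IH] s /= [Xu sX] [Yu sY]; split; last exact: IH.
by move=> v sv vu; rewrite Xu// Yu.
Qed.

Lemma bm_sp_path (Y : simple_process F) x : bm (fun v => sp_value Y v x).
Proof.
apply: bm_sum => i _; apply: bmM; first exact: bm_cst.
by apply: bm_indic; exact: measurable_itv.
Qed.

Lemma sp_value_adapted_grid (Y : simple_process F) s us : 0 <= s -> path <%R s us ->
  resolves Y s us -> adapted s (gridfun (sp_value Y) us).
Proof.
elim: us s => [//|u us IH] s s0 p r /=; have /= /andP[su pus] := p; split => //.
- exact: sp_value_adapted p r.
- exact: bm_sp_value.
- by apply: IH => //; [exact: le_trans s0 (ltW su)|exact: resolves_behead r].
Qed.

Lemma adaptedB (X Y : R -> Omega -> R) s us : 0 <= s -> adapted s (gridfun X us) ->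
  adapted s (gridfun Y us) -> adapted s (gridfun (fun v x => X v x - Y v x) us).
Proof.
elim: us s => [//|u us IH] s s0 /= [su FX bX aX] [_ FY bY aY]; split => //.
- apply: sub_measurableD; [exact: sF|exact: FX|].
  by apply: (sub_measurable_comp (sF s0) (f := fun x => - x)) => //; exact: oppr_measurable.
- exact: bmB.
- by apply: IH => //; exact: le_trans s0 (ltW su).
Qed.

Section SimpleIntegrals.
Implicit Types Y : simple_process F.

Lemma sp_increment0 Y s t V : 0 <= s -> s < t -> sub_measurable (F s) V -> bm V ->
  P.-integrable setT (EFin \o (fun x => V x * (sp_integral w Y t x - sp_integral w Y s x))) /\
  \int[P]_x (V x * (sp_integral w Y t x - sp_integral w Y s x)) = 0.
Proof.
move=> s0 st FV bV; have [us [p <- r _]] := grid_exists Y Y st.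
under eq_fun do rewrite (sp_integral_grid _ p r).
by apply: integral_dint0 => //; [exact: sp_value_adapted_grid|apply: bmP; exact: bmX2].
Qed.

(** The weight [U] will be the indicator that the path has not left an interval before [s]. *)
Lemma sp_increment_sqr Y s t U : 0 <= s -> s < t -> sub_measurable (F s) U -> bm U ->
  (forall x, 0 <= U x) ->
  P.-integrable setT (EFin \o (fun x => (sp_integral w Y t x - sp_integral w Y s x) ^+ 2)) /\
  \int[P]_x (U x * (sp_integral w Y t x - sp_integral w Y s x) ^+ 2) <=
  \int[P]_x (U x * itg (fun v => sp_value Y v x ^+ 2) s t).
Proof.
move=> s0 st FU bU U0; have [us [p <- r _]] := grid_exists Y Y st.
under eq_fun do rewrite (sp_integral_grid _ p r).
have a := sp_value_adapted_grid s0 p r.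
split; first by have [] := integrable_dint_sqr s0 a.
under eq_Rintegral do rewrite (sp_integral_grid _ p r).
under [leRHS]eq_Rintegral do rewrite -(dqv_itg p (sp_value_steps p r) (bm_sp_path _ _)).
exact: integral_dint_sqr.
Qed.

Lemma sp_integral0 Y x : sp_integral w Y 0 x = 0.
Proof.
have t0 i : 0 <= sp_time Y i by apply: le_trans (sp_time_ge0 Y) _; exact: sp_time_nd.
by apply: big1 => i _; rewrite !min_l// subrr mulr0.
Qed.

(** Lenglart's inequality for the difference of two simple integrals. *)
Lemma sp_integral_prob_le Y1 Y2 t (gamma eta : R) : 0 < t -> 0 <= gamma -> 0 < eta ->
  (P [set x | (itg (fun v => (sp_value Y1 v x - sp_value Y2 v x) ^+ 2) 0 t <= gamma)%R /\
              (eta <= `|sp_integral w Y1 t x - sp_integral w Y2 t x|)%R]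
     <= (gamma / eta ^+ 2)%:E)%E.
Proof.
move=> t0 g0 eta0; have [us [p <- r1 r2]] := grid_exists Y1 Y2 t0.
have a := adaptedB (lexx 0) (sp_value_adapted_grid (lexx 0) p r1)
  (sp_value_adapted_grid (lexx 0) p r2).
have := dint_prob_le (lexx 0) a g0 eta0; congr (P _ <= _)%E.
apply/seteqP; split=> x /=;
  rewrite (dqv_itg p (steps_onB (sp_value_steps p r1) (sp_value_steps p r2)))
    ?dint_gridfunB -?sp_integral_grid// ?sp_integral0 ?subr0//;
  exact: (bmB (bm_sp_path Y1 x) (bm_sp_path Y2 x)).
Qed.

End SimpleIntegrals.

(** * Truncation and localization of the Ito integral *)

Definition clip (C x : R) : R := Num.max (- C) (Num.min C x).

Lemma clip_id C x : `|x| <= C -> clip C x = x.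
Proof. by rewrite ler_norml => /andP[Cx xC]; rewrite /clip min_r// max_r. Qed.

Lemma clip_le C x : 0 <= C -> `|clip C x| <= C.
Proof.
move=> C0; have NC : - C <= C by lra.
by rewrite ler_norml /clip le_max lexx/= ge_max NC ge_min lexx.
Qed.

Lemma clip_lipschitz C x z : 0 <= C -> `|clip C x - clip C z| <= `|x - z|.
Proof.
move=> C0; have NC : - C <= C by lra.
wlog xz : x z / x <= z => [H|].
  by have [/H//|/ltW/H] := leP x z; rewrite distrC (distrC z).
have h (a b : R) : a <= b -> `|a - b| = b - a by move=> ab; rewrite distrC ger0_norm ?subr_ge0.
have mono : clip C x <= clip C z.
  by apply: le_max2; rewrite ?lexx//; apply: le_min2; rewrite ?lexx.
rewrite (h _ _ xz) (h _ _ mono) /clip.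
have [Cx|xC] := leP C x.
  rewrite (max_r NC) (min_l (le_trans Cx xz)) (max_r NC) subrr subr_ge0//.
have [Cz|zC] := leP C z; last first.
  have [xN|Nx] := leP (- C) x; have [zN|Nz] := leP (- C) z; rewrite ?lexx//; lra.
rewrite (max_r NC).
by have [xN|Nx] := leP (- C) x; lra.
Qed.

Lemma measurable_clip C : measurable_fun setT (clip C).
Proof. by apply: measurable_maxr => //; exact: measurable_minr. Qed.

Lemma clip0 C : 0 <= C -> clip C 0 = 0.
Proof. by move=> C0; rewrite clip_id// normr0. Qed.

Lemma bm_clip d' (T : measurableType d') C (f : T -> R) : 0 <= C -> measurable_fun setT f ->
  bm (fun x => clip C (f x)).
Proof.
move=> C0 mf; split; first by apply: measurableT_comp => //; exact: measurable_clip.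
by exists C => x; exact: clip_le.
Qed.

Section ClippedProcess.
Variables (C : R) (C0 : 0 <= C) (Y : simple_process F).

Let clip_coef_adapted i :
  sub_measurable (F (sp_time Y i)) (fun x => clip C (sp_coef Y i x)).
Proof.
have ti0 : 0 <= sp_time Y i by apply: le_trans (sp_time_ge0 Y) _; exact: sp_time_nd.
apply: (@sub_measurable_comp _ _ _ _ (sF ti0) (clip C)); first exact: measurable_clip.
exact: sp_coef_adapted.
Qed.

Let clip_coef_bounded i : [bounded clip C (sp_coef Y i omega) | omega in [set: Omega]].
Proof.
exists C; split; first exact: num_real.
by move=> M CM x _ /=; rewrite (le_trans (clip_le _ C0))// ltW.
Qed.

(** Truncating the coefficients truncates the values, since at each time at most one
    coefficient counts. *)
Definition sp_clip : simple_process F := @SimpleProcess R d Omega F (sp_size Y)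
  (sp_time Y) _ (sp_time_ge0 Y) (sp_time_nd Y) clip_coef_adapted clip_coef_bounded.

Lemma sp_value_clip u x : sp_value sp_clip u x = clip C (sp_value Y u x).
Proof.
have [[i ui]|none] := pselect (exists i : 'I_(sp_size Y),
    (`]sp_time Y i, sp_time Y i.+1]%classic : set R) u).
  have other (j : 'I_(sp_size Y)) : j != i ->
      (\1_(`]sp_time Y j, sp_time Y j.+1]%classic) u : R) = 0.
    move=> ji; rewrite indicE memNset//= in_itv/= => /andP[ju uj].
    move: ui; rewrite /= in_itv/= => /andP[iu ui].
    have [lt|gt|/val_inj/eqP] := ltngtP j i; last by rewrite (negbTE ji).
      by have := lt_le_trans iu (le_trans uj (sp_time_nd Y lt)); rewrite ltxx.
    by have := lt_le_trans ju (le_trans ui (sp_time_nd Y gt)); rewrite ltxx.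
  rewrite /sp_value (bigD1 i)//= big1 ?addr0; last by move=> j ji; rewrite other// mulr0.
  rewrite [in RHS](bigD1 i)//= big1 ?addr0; last by move=> j ji; rewrite other// mulr0.
  by rewrite indicE mem_set// !mulr1.
have zero (j : 'I_(sp_size Y)) : (\1_(`]sp_time Y j, sp_time Y j.+1]%classic) u : R) = 0.
  by rewrite indicE memNset// => uj; apply: none; exists j.
rewrite /sp_value !big1 ?clip0// => j _; by rewrite zero mulr0.
Qed.

End ClippedProcess.

Lemma bm_sp_value_joint (Y : simple_process F) :
  bm (fun p : R * Omega => sp_value Y p.1 p.2).
Proof.
apply: bm_sum => i _; apply: bmM.
  have ti0 : 0 <= sp_time Y i by apply: le_trans (sp_time_ge0 Y) _; exact: sp_time_nd.
  apply: (@bm_comp _ _ _ _ _ (sp_coef Y i) snd); first exact: measurable_snd.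
  split.
    by apply: (@sub_measurable_measurable R d Omega (F (sp_time Y i)));
      [exact: Fm|exact: sp_coef_adapted].
  have [M [_ HM]] := sp_coef_bounded Y i.
  by exists (M + 1) => x; apply: HM => //; rewrite ltrDl.
apply: (@bm_comp _ _ _ _ _ (\1_(`]sp_time Y i, sp_time Y i.+1]%classic)) fst).
  exact: measurable_fst.
by apply: bm_indic; exact: measurable_itv.
Qed.

Lemma measurable_sp_integral (Y : simple_process F) t : 0 <= t ->
  measurable_fun setT (sp_integral w Y t).
Proof.
move=> t0; apply: measurable_sum => i.
have ti0 j : 0 <= sp_time Y j by apply: le_trans (sp_time_ge0 Y) _; exact: sp_time_nd.
apply: measurable_realfun.measurable_funM.
  by apply: (@sub_measurable_measurable R d Omega (F (sp_time Y i)));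
    [exact: Fm|exact: sp_coef_adapted].
by apply: measurable_realfun.measurable_funB; apply: (measurable_wiener F_filtration w_wiener);
  rewrite le_min t0/=.
Qed.

Lemma probability_le4 (A A1 A2 A3 A4 : set Omega) (e1 e2 e3 e4 : R) :
  measurable A -> measurable A1 -> measurable A2 -> measurable A3 -> measurable A4 ->
  A `<=` A1 `|` A2 `|` A3 `|` A4 ->
  (P A1 <= e1%:E)%E -> (P A2 <= e2%:E)%E -> (P A3 <= e3%:E)%E -> (P A4 <= e4%:E)%E ->
  (P A <= (e1 + e2 + e3 + e4)%:E)%E.
Proof.
move=> mA m1 m2 m3 m4 sub h1 h2 h3 h4.
have m12 : measurable (A1 `|` A2) by exact: measurableU.
have m123 : measurable (A1 `|` A2 `|` A3) by exact: measurableU.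
have mm : measurable (A1 `|` A2 `|` A3 `|` A4) by exact: measurableU.
apply: (@le_trans _ _ (P (A1 `|` A2 `|` A3 `|` A4))); first by apply: le_measure; rewrite ?inE.
rewrite !EFinD; apply: le_trans (measureU2 _ m123 m4) _; apply: leeD => //.
apply: le_trans (measureU2 _ m12 m3) _; apply: leeD => //.
by apply: le_trans (measureU2 _ m1 m2) _; apply: leeD.
Qed.

(** Limits in probability are only used through finitely many such bounds at a time. *)
Definition vanishes (u : nat -> \bar R) : Prop :=
  forall e : R, 0 < e -> \forall n \near \oo, (u n <= e%:E)%E.

Lemma cvg0_vanishes (u : nat -> \bar R) : (u n @[n --> \oo] --> 0%E) -> vanishes u.
Proof.
move=> u0 e e0.
have : \forall n \near \oo, (u n < e%:E)%E.
  suff /u0 : nbhs (0%E : \bar R) [set x | (x < e%:E)%E] by [].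
  by apply: open_nbhs_nbhs; split; [exact: open_ereal_lt_ereal|rewrite /= lte_fin].
by apply: filterS => n /ltW.
Qed.

Definition clip_process (Y : R -> Omega -> R) (t C : R) : R * Omega -> R :=
  (fun p => clip C (Y p.1 p.2)) \_ (`[0, t] `*` setT).

Let mD (s : R) : measurable (`[0, s] `*` [set: Omega]).
Proof. exact: measurableX. Qed.

Lemma bm_clip_process Y t C : 0 <= C -> jointly_measurable `[0, t] Y ->
  bm (clip_process Y t C).
Proof.
move=> C0 mY; apply: (bm_patch (M := C)) => //.
  by apply: measurableT_comp => //; exact: measurable_clip.
by move=> p _; exact: clip_le.
Qed.

Lemma bm_sec (q : R * Omega -> R) x : bm q -> bm (fun v : R => q (v, x)).
Proof. by move=> bq; apply: bm_comp bq; exact: pair2_measurable. Qed.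

Lemma EFin_itg (f : R -> R) a b : bm f ->
  ((itg f a b)%:E = \int[lebesgue_measure]_(v in `]a, b]) (f v)%:E)%E.
Proof.
move=> bf; rewrite /itg /Rintegral fineK//; apply: integrable_fin_num => //.
exact: bm_integrable_oc.
Qed.

Lemma bm_itg_path (q : R * Omega -> R) a b : bm q ->
  bm (fun x => itg (fun v => q (v, x)) a b).
Proof.
move=> bq; apply: (@bm_Rintegral R _ _ _ _ lebesgue_measure `]a, b]%classic
  (fun p : Omega * R => q (p.2, p.1))) => //; first exact: mu_oc_fin.
by apply: (bm_comp (p := fun p : Omega * R => (p.2, p.1))) => //; exact: measurable_swap.
Qed.

Section SquareDistance.
Variables (Y : R -> Omega -> R) (X : simple_process F) (s : R).
Hypothesis mY : jointly_measurable `[0, s] Y.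

Definition sqdist x : \bar R :=
  (\int[lebesgue_measure]_(v in `[0%R, s]) ((sp_value X v x - Y v x) ^+ 2)%:E)%E.

Let mD2 : measurable_fun (`[0, s] `*` [set: Omega])
  (fun p : R * Omega => (sp_value X p.1 p.2 - Y p.1 p.2) ^+ 2).
Proof.
apply: measurable_funX; apply: measurable_realfun.measurable_funB => //.
by apply: measurable_funTS; exact: (bm_sp_value_joint X).1.
Qed.

Lemma measurable_sqdist : measurable_fun setT sqdist.
Proof.
pose f (p : R * Omega) : \bar R :=
  (((fun p => (sp_value X p.1 p.2 - Y p.1 p.2) ^+ 2) \_ (`[0, s] `*` setT)) p)%:E.
have mf : measurable_fun setT f.
  by apply/measurable_EFinP; apply/(measurable_restrictT _ (mD s)).
have f0 p : (0 <= f p)%E by rewrite lee_fin patchE; case: ifP => // _; exact: sqr_ge0.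
have := @measurable_fun_fubini_tonelli_G _ _ _ _ R lebesgue_measure f mf f0.
congr measurable_fun; apply/funext => x; rewrite /fubini_G/= /sqdist [RHS]integral_mkcond.
apply: eq_integral => v _; rewrite /f !patchE.
have -> : ((v, x) \in `[0, s] `*` [set: Omega]) = (v \in `[0, s]%classic).
  by apply/idP/idP; rewrite !inE/=; [case|move=> ?; split].
by case: ifP.
Qed.

Lemma measurable_sqdist_path x :
  measurable_fun `[0, s] (fun v => ((sp_value X v x - Y v x) ^+ 2)%:E).
Proof.
apply/measurable_EFinP.
apply: (@measurable_comp _ _ _ _ _ _ (`[0, s] `*` setT)
  (fun p : R * Omega => (sp_value X p.1 p.2 - Y p.1 p.2) ^+ 2) _ (pair^~ x)) => //.
  by move=> _ [v vs <-].
by apply: measurable_funTS; exact: pair2_measurable.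
Qed.

End SquareDistance.

Let mgeset (f : Omega -> \bar R) (c : R) : measurable_fun setT f ->
  measurable [set x | (c%:E <= `|f x|)%E].
Proof.
move=> mf; rewrite -[X in measurable X]setTI.
by apply: emeasurable_fun_c_infty => //; exact: measurableT_comp.
Qed.

Let sqdist_ge0 Y X s x : (0 <= sqdist Y X s x)%E.
Proof. by apply: integral_ge0 => v _; rewrite lee_fin sqr_ge0. Qed.

Let subcc (s t : R) : s <= t -> `]0, s] `<=` `[0, t].
Proof. by move=> st v /=; rewrite !in_itv/= => /andP[/ltW-> /le_trans]; apply. Qed.

Let sqdist_clip_le Y X t C (C0 : 0 <= C) x : jointly_measurable `[0, t] Y ->
  ((itg (fun v => (sp_value (sp_clip C0 X) v x - clip_process Y t C (v, x)) ^+ 2) 0 t)%:E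
    <= sqdist Y X t x)%E.
Proof.
move=> mY; have b1 := bm_sp_path (sp_clip C0 X) x.
have b2 := bm_sec x (bm_clip_process C0 mY).
have b3 := bmX2 (bmB b1 b2).
rewrite EFin_itg//.
apply: (@le_trans _ _ (\int[lebesgue_measure]_(v in `]0%R, t])
  ((sp_value X v x - Y v x) ^+ 2)%:E)%E); last first.
  apply: ge0_subset_integral => //.
  - exact: measurable_sqdist_path.
  - by move=> v _; rewrite lee_fin sqr_ge0.
  - exact: subcc.
apply: ge0_le_integral => //.
- by move=> v _; rewrite lee_fin sqr_ge0.
- by apply/measurable_EFinP/measurable_funTS; exact: b3.1.
- apply: (measurable_funS _ _ (measurable_sqdist_path X mY x)) => //.
  exact: subcc.
- move=> v; rewrite /= in_itv/= => /andP[v0 vt].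
  rewrite lee_fin /clip_process patchE mem_set/=; last first.
    by split => //; rewrite /= in_itv/= (ltW v0) vt.
  rewrite sp_value_clip -(real_normK (num_real (clip C _ - _))).
  rewrite -(real_normK (num_real (sp_value X v x - Y v x))).
  by rewrite lerXn2r ?nnegrE//; exact: clip_lipschitz.
Qed.

Let sqdist_local_le Y X1 X2 s t C (C0 : 0 <= C) x : s <= t ->
  jointly_measurable `[0, s] Y -> jointly_measurable `[0, t] Y ->
  (forall v, 0 < v -> v <= s -> `|Y v x| <= C) ->
  ((itg (fun v => (sp_value X1 v x - sp_value (sp_clip C0 X2) v x) ^+ 2) 0 s)%:E
    <= 2%:E * sqdist Y X1 s x + 2%:E * sqdist Y X2 t x)%E.
Proof.
move=> st mYs mYt YC.
have b3 := bmX2 (bmB (bm_sp_path X1 x) (bm_sp_path (sp_clip C0 X2) x)).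
pose g (X : simple_process F) v := ((sp_value X v x - Y v x) ^+ 2)%:E.
have mg X r : s <= r -> jointly_measurable `[0, r] Y -> measurable_fun `]0, s] (g X).
  by move=> sr mYr; apply: (measurable_funS _ (subcc sr) (measurable_sqdist_path X mYr x)).
have g0 X v : (0 <= g X v)%E by rewrite lee_fin sqr_ge0.
have le X r : s <= r -> jointly_measurable `[0, r] Y ->
    (\int[lebesgue_measure]_(v in `]0%R, s]) g X v <= sqdist Y X r x)%E.
  move=> sr mYr; apply: ge0_subset_integral => //; last exact: subcc.
  exact: measurable_sqdist_path.
rewrite EFin_itg//.
apply: (@le_trans _ _ (2%:E * (\int[lebesgue_measure]_(v in `]0%R, s]) g X1 v)
  + 2%:E * (\int[lebesgue_measure]_(v in `]0%R, s]) g X2 v))%E); last first.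
  by apply: leeD; apply: lee_wpmul2l => //; [exact: le|exact: le].
rewrite -!ge0_integralZl//; [|exact: (mg X2 t)|exact: (mg X1 s)].
rewrite -ge0_integralD//; last 4 first.
- by move=> v _; rewrite mule_ge0.
- by apply: measurable_funeM; exact: (mg X1 s).
- by move=> v _; rewrite mule_ge0.
- by apply: measurable_funeM; exact: (mg X2 t).
apply: ge0_le_integral => //.
- by move=> v _; rewrite lee_fin sqr_ge0.
- by apply/measurable_EFinP/measurable_funTS; exact: b3.1.
- by apply: emeasurable_funD; apply: measurable_funeM; [exact: (mg X1 s)|exact: (mg X2 t)].
move=> v; rewrite /= in_itv/= => /andP[v0 vs].
rewrite /g -!EFinM -EFinD lee_fin sp_value_clip.
have := clip_lipschitz (sp_value X2 v x) (Y v x) C0.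
rewrite (clip_id (YC v v0 vs)); set c := clip C _; set y := Y v x.
set x1 := sp_value X1 v x; set x2 := sp_value X2 v x => h.
have : (c - y) ^+ 2 <= (x2 - y) ^+ 2.
  rewrite -(real_normK (num_real (c - y))) -(real_normK (num_real (x2 - y))).
  by rewrite lerXn2r ?nnegrE.
by have := sqr_ge0 ((x1 - y) + (c - y)); lra.
Qed.

(** The Ito integral only depends on the integrand where it is considered: one
    sequence of simple integrals with values in [[-C, C]] converges to every
    version of the integral up to time [s <= t], on any event on which
    [Y] stays in [[-C, C]] before [s]. *)
Lemma ito_localize (Y : R -> Omega -> R) (t C : R) (Zt : Omega -> R) :
  0 < t -> 0 <= C -> is_ito_integral P F w Y t Zt ->
  exists J : nat -> simple_process F,
    [/\ forall n v x, `|sp_value (J n) v x| <= C,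
      forall gamma : R, 0 < gamma -> vanishes (fun n => P [set x |
        gamma <= itg (fun v => (sp_value (J n) v x - clip_process Y t C (v, x)) ^+ 2) 0 t]) &
      forall s Zs, 0 < s -> s <= t -> is_ito_integral P F w Y s Zs ->
        forall B : set Omega, measurable B ->
        (forall x v, B x -> 0 < v -> v <= s -> `|Y v x| <= C) ->
        forall eta : R, 0 < eta -> vanishes (fun n =>
          P (B `&` [set x | eta <= `|sp_integral w (J n) s x - Zs x|]))].
Proof.
move=> t0 C0 [mY mZ [Yt [Yt2 YtZ]]].
exists (fun n => sp_clip C0 (Yt n)).
have bj n : bm (fun p : R * Omega =>
    (sp_value (sp_clip C0 (Yt n)) p.1 p.2 - clip_process Y t C p) ^+ 2).
  by apply: bmX2; apply: bmB; [exact: bm_sp_value_joint|exact: bm_clip_process].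
split.
- by move=> n v x; rewrite sp_value_clip; exact: clip_le.
- move=> gamma g0 e e0; have := cvg0_vanishes (Yt2 _ g0) e0.
  apply: filterS => n; apply: le_trans; apply: le_measure; rewrite ?inE.
  + by apply: measurable_leset; [exact: measurable_cst|exact: (bm_itg_path 0 t (bj n)).1].
  + by apply: (@mgeset (sqdist Y (Yt n) t)); exact: measurable_sqdist.
  + move=> x /=; rewrite -lee_fin => /le_trans; apply.
    by rewrite gee0_abs; [exact: sqdist_clip_le|exact: sqdist_ge0].
move=> s Zs s0 st [mYs mZs [Ys [Ys2 YsZ]]] B mB BC eta eta0 e e0.
have e4 : 0 < e / 4 by lra.
have h2 : 0 < eta / 2 by lra.
(* With this budget Lenglart's inequality gives the bound [e / 4]. *)
pose gamma := (eta / 2) ^+ 2 * (e / 4).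
have g0 : 0 < gamma by rewrite mulr_gt0// exprn_gt0.
have g4 : 0 < gamma / 4 by lra.
have s0' := ltW s0.
have n1 := cvg0_vanishes (Ys2 _ g4) e4.
have n2 := cvg0_vanishes (Yt2 _ g4) e4.
have n3 := cvg0_vanishes (YsZ _ h2) e4.
near=> n.
rewrite (_ : e = e / 4 + e / 4 + e / 4 + e / 4); last by lra.
have mI (X : simple_process F) : measurable_fun setT (sp_integral w X s).
  exact: measurable_sp_integral.
have bq : bm (fun x => itg (fun v => (sp_value (Ys n) v x
    - sp_value (sp_clip C0 (Yt n)) v x) ^+ 2) 0 s).
  apply: (@bm_itg_path (fun p => (sp_value (Ys n) p.1 p.2
    - sp_value (sp_clip C0 (Yt n)) p.1 p.2) ^+ 2)).
  by apply: bmX2; apply: bmB; exact: bm_sp_value_joint.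
have mabs (f g : Omega -> R) : measurable_fun setT f -> measurable_fun setT g ->
    measurable_fun setT (fun x => `|f x - g x|).
  by move=> mf mg; apply: measurableT_comp => //; exact: measurable_realfun.measurable_funB.
apply: (@probability_le4 _
  [set x | ((gamma / 4)%:E <= `|sqdist Y (Ys n) s x|)%E]
  [set x | ((gamma / 4)%:E <= `|sqdist Y (Yt n) t x|)%E]
  [set x | ((eta / 2)%:E <= `|(sp_integral w (Ys n) s x - Zs x)%:E|)%E]
  [set x | itg (fun v => (sp_value (Ys n) v x - sp_value (sp_clip C0 (Yt n)) v x) ^+ 2) 0 s
      <= gamma /\ eta / 2 <= `|sp_integral w (Ys n) s x - sp_integral w (sp_clip C0 (Yt n)) s x|]).
- apply: measurableI => //; apply: measurable_leset; first exact: measurable_cst.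
  exact: mabs.
- by apply: mgeset; exact: measurable_sqdist.
- by apply: mgeset; exact: measurable_sqdist.
- by apply: (@mgeset (fun x => (sp_integral w (Ys n) s x - Zs x)%:E));
    apply/measurable_EFinP; exact: measurable_realfun.measurable_funB.
- apply: measurableI; apply: measurable_leset; [exact: bq.1|exact: measurable_cst|exact: measurable_cst|].
  exact: mabs.
- move=> x [Bx /= etax].
  have [h1|h1] := leP (gamma / 4)%:E (sqdist Y (Ys n) s x).
    by left; left; left; rewrite /= gee0_abs//; exact: sqdist_ge0.
  have [h3|h3] := leP (gamma / 4)%:E (sqdist Y (Yt n) t x).
    by left; left; right; rewrite /= gee0_abs//; exact: sqdist_ge0.
  have [h4|h4] := leP (eta / 2) `|sp_integral w (Ys n) s x - Zs x|.
    by left; right; rewrite /= lee_fin.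
  right; split.
    have := @sqdist_local_le Y (Ys n) (Yt n) s t C C0 x st mYs mY (fun v => BC x v Bx).
    rewrite -lee_fin => /le_trans; apply.
    rewrite (_ : gamma = 2 * (gamma / 4) + 2 * (gamma / 4)); last by lra.
    by rewrite (EFinD (2 * (gamma / 4)) (2 * (gamma / 4))) (EFinM 2 (gamma / 4)); apply: leeD; apply: lee_wpmul2l => //; exact: ltW.
  have := ler_distD (sp_integral w (Ys n) s x) (sp_integral w (sp_clip C0 (Yt n)) s x) (Zs x).
  rewrite (distrC (sp_integral w (sp_clip _ _) s x) (sp_integral w (Ys n) s x)).
  by lra.
- by near: n.
- by near: n.
- by near: n.
- have := sp_integral_prob_le (Ys n) (sp_clip C0 (Yt n)) s0 (ltW g0) h2.
  have -> : gamma / (eta / 2) ^+ 2 = e / 4.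
    by rewrite /gamma mulrAC mulfV ?mul1r// gt_eqF// exprn_gt0.
  by [].
Unshelve. all: by end_near. Qed.

End DiscreteIntegral.

(** * Measurability of delayed and averaged paths *)

Section Windows.
Context {R : realType}.

Lemma bm_past_window (q : R * R -> R) h : bm q ->
  bm (fun s : R => itg (fun u => q (s, u)) (s - h) s).
Proof.
move=> bq; apply: (@bm_ext _ _ _ (fun s : R => itg (fun u => q (s, u)) (s - h) (s + 0))).
  by move=> s; rewrite addr0.
exact: bm_window.
Qed.

Lemma bm_past_window1 (p : R -> R) h : bm p -> bm (fun s : R => itg p (s - h) s).
Proof.
move=> bp; apply: (@bm_past_window (fun x => p x.2)).
by apply: (@bm_comp _ _ _ _ _ p (@snd R R)) => //; exact: measurable_snd.
Qed.

Lemma bm_future_window (q : R * R -> R) h : bm q ->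
  bm (fun s : R => itg (fun u => q (u, s)) s (s + h)).
Proof.
move=> bq; apply: (@bm_ext _ _ _ (fun s : R => itg (fun u => q (u, s)) (s + 0) (s + h))).
  by move=> s; rewrite addr0.
exact: bm_window'.
Qed.

Lemma bm_fst d (T : measurableType d) (p : R -> R) : bm p -> bm (fun x : R * T => p x.1).
Proof.
by move=> bp; apply: (@bm_comp _ _ _ _ _ p (@fst R T)) => //; exact: measurable_fst.
Qed.

Lemma bm_snd d (T : measurableType d) (p : R -> R) : bm p -> bm (fun x : T * R => p x.2).
Proof.
by move=> bp; apply: (@bm_comp _ _ _ _ _ p (@snd T R)) => //; exact: measurable_snd.
Qed.

Lemma sum_nat_le (V : nmodType) (m n : nat) (F : nat -> V) : (m <= n)%N ->
  \sum_(1 <= k < m.+1) F k = \sum_(1 <= k < n.+1) (if (k <= m)%N then F k else 0).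
Proof.
rewrite -big_mkcond/=.
move=> mn; rewrite (@big_cat_nat _ _ _ m.+1 1 n.+1)//= [X in _ = _ + X]big_nat_cond.
rewrite [X in _ = _ + X]big1 ?addr0; last first.
  by move=> i /andP[/andP[mi _]]; rewrite leqNgt mi.
rewrite big_nat_cond [RHS]big_nat_cond; apply: eq_bigl => i.
by case: (ltnP i m.+1) => im; rewrite ?andbF// ltnS in im *; rewrite im !andbT.
Qed.

Lemma sum_nat_gt (V : nmodType) (m n : nat) (F : nat -> V) : (m <= n)%N ->
  \sum_(m.+1 <= k < n.+1) F k = \sum_(1 <= k < n.+1) (if (m < k)%N then F k else 0).
Proof.
rewrite -big_mkcond/=.
move=> mn; rewrite (@big_cat_nat _ _ _ m.+1 1 n.+1)//= [X in _ = X + _]big_nat_cond.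
rewrite [X in _ = X + _]big1 ?add0r; last first.
  by move=> i /andP[/andP[_ im]]; rewrite ltnNge -ltnS im.
rewrite big_nat_cond [RHS]big_nat_cond; apply: eq_bigl => i.
by case: (ltnP m i) => im; rewrite ?andbF// andbT.
Qed.

Lemma bm_uniform d (U : measurableType d) (N : nat) (F : nat -> U -> R) :
  (forall k, bm (F k)) ->
  exists2 M : R, 0 <= M & forall k x, (k < N)%N -> `|F k x| <= M.
Proof.
move=> bF; have /bm_bound[M M0 FM] : bm (fun x => \sum_(k < N) `|F k x|).
  by apply: bm_sum => k _; apply: bm_norm; exact: bF.
exists M => // k x kN; rewrite (le_trans _ (FM x))// (le_trans _ (ler_norm _))//.
by rewrite (bigD1 (Ordinal kN))//= lerDl sumr_ge0.
Qed.

End Windows.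

Ltac bm_step := match goal with
  | H : bm ?f |- bm ?f => exact: H
  | |- bm (fun _ => ?c) => exact: bm_cst
  | |- bm (fun x => (@?f x + @?g x)%R) => apply: (@bmD _ _ _ f g)
  | |- bm (fun x => (- @?f x)%R) => apply: (@bmN _ _ _ f)
  | |- bm (fun x => (@?f x * @?g x)%R) => apply: (@bmM _ _ _ f g)
  | |- bm (fun x => (@?f x ^+ 2)%R) => apply: (@bmX2 _ _ _ f)
  | |- bm (fun x => `|@?f x|%R) => apply: (@bm_norm _ _ _ f)
  | |- bm (fun x => \sum_(i <- _ | _) _) =>
      apply: bm_sum; let i := fresh "i" in move=> i _
  | |- bm (fun x => itg ?p (x - ?h)%R x) => apply: (@bm_past_window1 _ p h)
  | |- _ => eassumption
  | |- bm (fun x => ?p (x + ?h)%R) => apply: (@bm_shift _ p h)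
  | |- bm (fun x => ?p x.1) => apply: (@bm_fst _ _ _ p)
  | |- bm (fun x => ?p x.2) => apply: (@bm_snd _ _ _ p)
  | H : forall _, bm _ |- bm _ => solve [exact: H]
  end.
Ltac bm_solve := repeat bm_step.

(** * Continuous adapted paths *)

Section ContinuousPaths.
Context {R : realType}.
Implicit Types (f : R -> R) (u s t T e : R).

Lemma path_continuous_at f s e : {within `[0, +oo[, continuous f} -> 0 <= s -> 0 < e ->
  exists2 dl, 0 < dl & forall u, 0 <= u -> `|s - u| < dl -> `|f s - f u| < e.
Proof.
move=> /subspace_continuousP cf s0 e0.
have {cf} := cf s; rewrite /= in_itv/= andbT => /(_ s0) /cvgrPdist_lt /(_ e e0).
rewrite near_withinE => /nbhs_ballP[dl dl0 sub]; exists dl => // u u0 su.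
by apply: sub => //=; rewrite in_itv/= u0.
Qed.

(** Approximating a time from the left keeps the approximating values known at that
    time. *)
Definition grid_floor (m : nat) u : R := (Num.truncn (u * m.+1%:R))%:R / m.+1%:R.

Lemma grid_floor_itv m u : 0 <= u -> grid_floor m u <= u < grid_floor m u + m.+1%:R^-1.
Proof.
move=> u0; have m0 : 0 < m.+1%:R :> R by rewrite ltr0n.
have /truncn_itv/andP[] : 0 <= u * m.+1%:R by rewrite mulr_ge0.
rewrite /grid_floor => l r; rewrite ler_pdivrMr// l/=.
by rewrite -[X in _ + X]mul1r -mulrDl ltr_pdivlMr// natr1.
Qed.

Lemma grid_floor_ge0 m u : 0 <= grid_floor m u.
Proof. by rewrite divr_ge0. Qed.

Lemma grid_floor_cvg f u : {within `[0, +oo[, continuous f} -> 0 <= u ->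
  f (grid_floor m u) @[m --> \oo] --> f u.
Proof.
move=> cf u0; apply/cvgrPdist_lt => e e0.
have [dl dl0 H] := path_continuous_at cf u0 e0.
near=> m; apply: H; first exact: grid_floor_ge0.
have /andP[l r] := grid_floor_itv m u0.
rewrite ger0_norm ?subr_ge0// (@lt_trans _ _ m.+1%:R^-1)//; first by rewrite ltrBlDl.
by near: m; exact: (near_infty_natSinv_lt (PosNum dl0)).
Unshelve. all: by end_near. Qed.

(** Heine's theorem on [[0, T]], with the modulus along the sequence [2 / N.+1]. *)
Lemma path_uniformly_continuous f T e : {within `[0, +oo[, continuous f} -> 0 < e ->
  \forall N \near \oo, forall s t, 0 <= s <= T -> 0 <= t <= T ->
    `|s - t| <= 2 / N.+1%:R -> `|f s - f t| <= e.
Proof.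
move=> cf e0.
have cpt : compact (`[0, T]%classic : set R) by exact: segment_compact.
have e20 : 0 < e / 2 by rewrite divr_gt0.
have /compact_near_coveringP cov := cpt.
have {cov} := cov nat \oo (fun N s => forall t, 0 <= s <= T -> 0 <= t <= T ->
    `|s - t| <= 2 / N.+1%:R -> `|f s - f t| <= e) _.
case.
  move=> s; rewrite /= in_itv/= => /andP[s0 sT].
  have [dl dl0 H] := path_continuous_at cf s0 e20.
  have dl20 : 0 < dl / 2 by rewrite divr_gt0.
  have dl40 : 0 < dl / 4 by rewrite divr_gt0.
  exists (ball s (dl / 2), [set N | N.+1%:R^-1 < dl / 4]) => /=.
    split; first exact: nbhsx_ballx.
    exact: (near_infty_natSinv_lt (PosNum dl40)).
  move=> [s' N] [/= ss' Ndl] t /andP[s'0 _] /andP[t0 _] s't.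
  have ss'' : `|s - s'| < dl / 2 by [].
  have h1 : `|f s - f s'| < e / 2 by apply: H => //; lra.
  have h2 : `|f s - f t| < e / 2.
    apply: H => //; have := ler_normD (s - s') (s' - t); rewrite addrA subrK.
    by move: s't ss'' Ndl; set r := N.+1%:R^-1; lra.
  rewrite (_ : f s' - f t = (f s - f t) - (f s - f s')); last by ring.
  by have := ler_normB (f s - f t) (f s - f s'); lra.
move=> N _ H; exists N => // k /H{}H s t sT tT; exact: H.
Qed.

End ContinuousPaths.

Section AdaptedPaths.
Context {R : realType} {d : measure_display} {Omega : measurableType d}.
Variables (P : probability Omega R) (F : R -> set_system Omega).
Hypothesis F_filtration : is_filtration F.
Variable x : R -> Omega -> R.
Hypothesis x_adapted : forall t, 0 <= t -> sub_measurable (F t) (x t).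
Hypothesis x_continuous : forall omega, {within `[0, +oo[, continuous (x ^~ omega)}.

Implicit Types (K s t T C eta e : R) (omega : Omega).

Let sF t : 0 <= t -> sigma_algebra setT (F t).
Proof. by case: F_filtration => + _ _; exact. Qed.

Let Fm t : 0 <= t -> F t `<=` measurable.
Proof. by case: F_filtration => _ + _; exact. Qed.

Let Fle s t : 0 <= s -> s <= t -> F s `<=` F t.
Proof. by case: F_filtration => _ _; exact. Qed.

Let gridpt (m j : nat) : R := j%:R / m.+1%:R.

Let gridpt_ge0 m j : 0 <= gridpt m j. Proof. by rewrite divr_ge0. Qed.

Let x_measurable t : 0 <= t -> measurable_fun setT (x t).
Proof. by move=> t0; apply: (sub_measurable_measurable (Fm t0)); exact: x_adapted. Qed.

(** The path stays in [[-K, K]] up to time [t]; by continuity it is enough to look at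
    rational times, which makes this an event. *)
Definition stays K t : set Omega :=
  \bigcap_m \bigcap_j [set omega | gridpt m j <= t -> `|x (gridpt m j) omega| <= K].

Lemma staysP K t omega :
  stays K t omega <-> forall u, 0 <= u -> u <= t -> `|x u omega| <= K.
Proof.
split=> [H u u0 ut|H m _ j _ jt]; last exact: H.
have /cvg_norm c := grid_floor_cvg (@x_continuous omega) u0.
apply: (cvgr_to_le c); near=> m.
apply: H => //; apply: le_trans ut.
by have /andP[] := grid_floor_itv m u0.
Unshelve. all: by end_near. Qed.

Lemma stays_adapted K t : 0 <= t -> F t (stays K t).
Proof.
move=> t0; suff : @measurable _ (g_sigma_algebraType (F t)) (stays K t).
  by rewrite /measurable/= sigma_algebra_id//; exact: sF.
apply: bigcapT_measurable => m; apply: bigcapT_measurable => j.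
have [jt|tj] := leP (gridpt m j) t; last first.
  rewrite [X in measurable X](_ : _ = setT)//.
  by apply/seteqP; split => // omega _ /=; rewrite leNgt tj.
have H : sub_measurable (F t) (x (gridpt m j)).
  by apply: (sub_measurableW (Fle (gridpt_ge0 m j) jt)); exact: x_adapted.
rewrite [X in measurable X](_ : _ = x (gridpt m j) @^-1` [set y | `|y| <= K]).
  rewrite /measurable/= sigma_algebra_id; last exact: sF.
  apply: (sub_measurable_set H).
  by apply: measurable_leset; [exact: normr_measurable|exact: measurable_cst].
by apply/seteqP; split => omega /= => [->//|].
Qed.

(** A modulus of continuity, again through rational times; allowing them to be twice as
    far apart as in [slow_le] leaves room for the approximation there. *)
Definition slow eta T N : set Omega :=
  \bigcap_m \bigcap_i \bigcap_j [set omega | gridpt m i <= T -> gridpt m j <= T ->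
    `|gridpt m i - gridpt m j| <= 2 / N.+1%:R ->
    `|x (gridpt m i) omega - x (gridpt m j) omega| <= eta].

Lemma slow_le eta T N omega : slow eta T N omega -> forall s t, 0 <= s <= T -> 0 <= t <= T ->
  `|s - t| <= N.+1%:R^-1 -> `|x s omega - x t omega| <= eta.
Proof.
move=> H s t /andP[s0 sT] /andP[t0 tT] st.
have c := grid_floor_cvg (@x_continuous omega) s0.
have c' := grid_floor_cvg (@x_continuous omega) t0.
have cc := cvg_norm (cvgB c c').
apply: (cvgr_to_le (cc _ _)); near=> m.
have /andP[sl sr] := grid_floor_itv m s0; have /andP[tl tr] := grid_floor_itv m t0.
apply: H => //; [exact: le_trans sT|exact: le_trans tT|].
have mN : m.+1%:R^-1 <= N.+1%:R^-1 :> R.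
  by rewrite lef_pV2 ?posrE ?ltr0n// ler_nat ltnS; near: m; exact: nbhs_infty_ge.
change (`|grid_floor m s - grid_floor m t| <= 2 / N.+1%:R).
move: st mN sr tr sl tl; set r := N.+1%:R^-1; set q := m.+1%:R^-1.
by rewrite !ler_norml => /andP[? ?] *; apply/andP; split; lra.
Unshelve. all: by end_near. Qed.

Lemma measurable_slow eta T N : measurable (slow eta T N).
Proof.
apply: bigcapT_measurable => m; apply: bigcapT_measurable => i; apply: bigcapT_measurable => j.
have [H|H] := pselect [/\ gridpt m i <= T, gridpt m j <= T &
    `|gridpt m i - gridpt m j| <= 2 / N.+1%:R]; last first.
  rewrite [X in measurable X](_ : _ = setT)//.
  by apply/seteqP; split => // omega _ /= h1 h2 h3; exfalso; apply: H.
case: H => h1 h2 h3.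
rewrite [X in measurable X](_ : _ = [set omega |
    `|x (gridpt m i) omega - x (gridpt m j) omega| <= eta]); last first.
  by apply/seteqP; split => omega /= => [|h _ _ _]; [apply|exact: h].
apply: measurable_leset; last exact: measurable_cst.
by apply: measurableT_comp => //; apply: measurable_realfun.measurable_funB; exact: x_measurable.
Qed.

(** Each path is slow for large [N], and the events increase with [N]. *)
Lemma slow_probability eta T e : 0 < eta -> 0 < e ->
  \forall N \near \oo, (P (~` slow eta T N) <= e%:E)%E.
Proof.
move=> eta0 e0.
have mono : nondecreasing_seq (slow eta T).
  move=> N M NM; apply/subsetPset => omega H m _ i _ j _ iT jT ij.
  apply: H => //; rewrite (le_trans ij)// ler_pM2l// lef_pV2 ?posrE ?ltr0n// ler_nat ltnS.
  exact: NM.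
have U : \bigcup_N slow eta T N = setT.
  apply/seteqP; split => // omega _.
  have [N _ H] := path_uniformly_continuous T (@x_continuous omega) eta0.
  by exists N => // m _ i _ j _ iT jT ij; apply: (H N) => //=; apply/andP.
have PU : P (\bigcup_N slow eta T N) = 1%E by rewrite U probability_setT.
have mU : measurable (\bigcup_N slow eta T N) by rewrite U.
have c : (P \o slow eta T) N @[N --> \oo] --> 1%E.
  by rewrite -PU; exact: nondecreasing_cvg_mu (measurable_slow eta T) mU mono.
have : \forall N \near \oo, ((1 - e)%:E < P (slow eta T N))%E.
  suff /c : nbhs (1%E : \bar R) [set y | ((1 - e)%:E < y)%E] by [].
  exists e => //= r; rewrite /ball_ /= => h; rewrite lte_fin.
  by move: h; rewrite ltr_norml => /andP[]; lra.
apply: filterS => N; rewrite probability_setC; last exact: measurable_slow.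
rewrite -[P _]fineK ?fin_num_measure//; last exact: measurable_slow.
by rewrite -EFinB lte_fin lee_fin; lra.
Qed.

(** The process is the pointwise limit of its values at the left grid points, which are
    step functions of time. *)
Lemma bm_clipped_path C T : 0 <= C ->
  bm (fun p : R * Omega => clip C (x p.1 p.2) * \1_(`[0, T]%classic) p.1).
Proof.
move=> C0.
pose h m (p : R * Omega) := clip C (x (grid_floor m p.1) p.2) * \1_(`[0, T]%classic) p.1.
have b1 : bm (fun p : R * Omega => \1_(`[0, T]%classic : set R) p.1 : R).
  by apply: bm_fst; apply: bm_indic; exact: measurable_itv.
have bh m : bm (h m).
  pose J := Num.truncn (T * m.+1%:R).
  apply: (@bm_ext _ _ _ (fun p : R * Omega => (\sum_(j < J.+1) clip C (x (gridpt m j) p.2) *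
     \1_(`[gridpt m j, gridpt m j.+1[%classic : set R) p.1) * \1_(`[0, T]%classic : set R) p.1)).
    move=> [s omega] /=; rewrite /h/= !indicE !mem_setE in_itv/=.
    have [/andP[s0 sT]|] := boolP (0 <= s <= T); last by rewrite !mulr0.
    rewrite !mulr1.
    have m0 : 0 < m.+1%:R :> R by rewrite ltr0n.
    have /truncn_itv/andP[tl tr] : 0 <= s * m.+1%:R by rewrite mulr_ge0.
    have tJ : (Num.truncn (s * m.+1%:R) < J.+1)%N.
      by rewrite ltnS /J le_truncn// ler_wpM2r.
    rewrite (bigD1 (Ordinal tJ))//= big1 ?addr0 => [|j /negP jn].
      rewrite indicE mem_setE in_itv/= /gridpt ler_pdivrMr// tl ltr_pdivlMr// tr mulr1.
      by [].
    rewrite indicE mem_setE in_itv/= /gridpt ler_pdivrMr// ltr_pdivlMr//.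
    have [/andP[jl jr]|] := boolP (j%:R <= s * m.+1%:R < j.+1%:R); last by rewrite mulr0.
    exfalso; apply: jn; apply/eqP/val_inj => /=; apply/eqP.
    rewrite eqn_leq -ltnS -(@ltr_nat R) (le_lt_trans jl tr)/=.
    by rewrite -ltnS -(@ltr_nat R) (le_lt_trans tl jr).
  apply: bmM => //; apply: bm_sum => j _; apply: bmM.
    apply: (@bm_comp _ _ _ _ _ (fun omega => clip C (x (gridpt m j) omega))
      (fun p : R * Omega => p.2)); first exact: measurable_snd.
    by apply: bm_clip => //; exact: x_measurable.
  apply: (@bm_fst _ _ _ (fun s => \1_(`[gridpt m j, gridpt m j.+1[%classic : set R) s : R)).
  by apply: bm_indic; exact: measurable_itv.
split; last first.
  exists C => p; rewrite normrM -[leRHS]mulr1 ler_pM ?clip_le//.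
  by rewrite indicE; case: (_ \in _); rewrite /= ?normr1 ?normr0.
apply: (measurable_fun_cvg (fun m => (bh m).1)) => -[s omega] _ /=.
rewrite /h/= indicE mem_setE in_itv/=.
have [/andP[s0 sT]|_] := boolP (0 <= s <= T); last first.
  by rewrite mulr0; under eq_fun do rewrite mulr0; exact: cvg_cst.
rewrite mulr1; under eq_fun do rewrite mulr1.
apply/cvgrPdist_lt => e e0.
have /cvgrPdist_lt /(_ e e0) := grid_floor_cvg (@x_continuous omega) s0.
by apply: filterS => m; apply: le_lt_trans; exact: clip_lipschitz.
Qed.

End AdaptedPaths.

(** * Energy of a process observed on a grid *)

Section WeightedFubini.
Context {R : realType} {d : measure_display} {Omega : measurableType d}.
Variable P : probability Omega R.
Local Notation mu := (@lebesgue_measure R).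

Lemma integrable_sum0 (l : seq nat) (f : nat -> Omega -> R) :
  (forall k, P.-integrable setT (EFin \o f k)) -> (forall k, \int[P]_omega f k omega = 0) ->
  P.-integrable setT (EFin \o (fun omega => \sum_(k <- l) f k omega)) /\
  \int[P]_omega (\sum_(k <- l) f k omega) = 0.
Proof.
move=> fi f0; elim: l => [|k l [IHi IH0]].
  have E : (fun omega => \sum_(k <- [::]) f k omega) = fun=> 0.
    by apply/funext => omega; rewrite big_nil.
  rewrite E; split; last by rewrite Rintegral_cst// mul0r.
  by apply: bm_integrable => //; [exact: fin_num_fun_lty|exact: bm_cst].
have E : (fun omega => \sum_(j <- k :: l) f j omega) =
    fun omega => f k omega + \sum_(j <- l) f j omega.
  by apply/funext => omega; rewrite big_cons.
rewrite E; split; first exact: integrableD (fi k) IHi.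
by rewrite RintegralD// f0 IH0 addr0.
Qed.

Lemma Rintegral_indic_itv (g : R -> R) (a s : R) :
  \int[mu]_u (\1_(`]a, s]%classic) u * g u) = itg g a s.
Proof.
rewrite /itg [RHS]Rintegral_mkcond; apply: eq_Rintegral => u _.
by rewrite patchE indicE; case: (u \in _); rewrite ?mul1r ?mul0r.
Qed.

(** Fubini with a factor that is only integrable: [W] will be an increment of a
    stochastic integral. *)
Lemma Rintegral_itg_weight (W : Omega -> R) (q : R * Omega -> R) (a s : R) :
  P.-integrable setT (EFin \o W) -> bm q ->
  \int[P]_omega (W omega * itg (fun u => q (u, omega)) a s) =
  itg (fun u => \int[P]_omega (W omega * q (u, omega))) a s.
Proof.
move=> iW bq; have [M M0 qM] := bm_bound bq.
have mW : measurable_fun setT W by apply/measurable_EFinP; exact: measurable_int iW.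
pose D : set R := `]a, s]%classic.
have mD : measurable D by exact: measurable_itv.
pose fr (p : R * Omega) : R := \1_D p.1 * (W p.2 * q p).
pose f (p : R * Omega) : \bar R := (fr p)%:E.
have b1 : bm (fun p : R * Omega => \1_D p.1 : R) by apply: bm_fst; exact: bm_indic.
have mf : measurable_fun setT f.
  apply/measurable_EFinP; apply: measurable_realfun.measurable_funM; first exact: b1.1.
  apply: measurable_realfun.measurable_funM; last exact: bq.1.
  by apply: (measurableT_comp mW); exact: measurable_snd.
have bqu u : bm (fun omega => q (u, omega)) by apply: bm_comp bq; exact: pair1_measurable.
have iWq u : P.-integrable setT (EFin \o (fun omega => W omega * q (u, omega))).
  have := bm_integrableM (bqu u) iW; apply: eq_integrable => // omega _ /=.
  by rewrite mulrC.
pose c := fine (\int[P]_omega `|W omega|%:E)%E.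
have cE : (\int[P]_omega `|W omega|%:E = c%:E)%E.
  by rewrite /c fineK//; apply: integrable_fin_num => //; exact: integrable_abse iW.
have intf : (mu \x P)%E.-integrable setT f.
  apply/integrable12ltyP => //.
  apply: (@le_lt_trans _ _ (\int[mu]_u (\1_D u * (M * c))%:E)%E); last first.
    have : mu.-integrable setT (EFin \o (fun u => \1_D u * (M * c))).
      apply: (@eq_integrable _ _ _ mu _ measurableT ((EFin \o (fun=> M * c)) \_ D)).
        by move=> u _ /=; rewrite patchE indicE; case: (u \in _); rewrite ?mul1r ?mul0r.
      by rewrite -integrable_mkcond//; apply: bm_integrable_oc; exact: bm_cst.
    move=> /integrable_fin_num -/(_ measurableT).
    by rewrite ge0_fin_numE//; apply: integral_ge0 => u _; rewrite lee_fin mulr_ge0 ?indicE//;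
      rewrite mulr_ge0// -lee_fin -cE; apply: integral_ge0 => omega _; rewrite lee_fin.
  apply: ge0_le_integral => //.
  - by move=> u _; apply: integral_ge0.
  - apply: (@measurable_fun_fubini_tonelli_F _ _ _ _ _ P (abse \o f)).
      by apply: measurableT_comp.
    by move=> p; exact: abse_ge0.
  - apply/measurable_EFinP; apply: measurable_realfun.measurable_funM => //.
  move=> u _; rewrite mulrA EFinM -cE -ge0_integralZl//; last first.
  - by rewrite lee_fin mulr_ge0.
  - by apply/measurable_EFinP; apply: measurableT_comp.
  apply: ge0_le_integral => //.
  - apply: (@measurableT_comp _ _ _ _ _ _ abse) => //.
    by apply: (measurableT_comp mf); exact: pair1_measurable.
  - by apply: measurable_funeM; apply/measurable_EFinP; exact: measurableT_comp.
  move=> omega _; rewrite -EFinM lee_fin /fr/= !normrM.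
  rewrite [`|\1_D u|]ger0_norm// -mulrA ler_wpM2l// [leRHS]mulrC ler_wpM2l//.
have FE := Fubini intf.
rewrite -[RHS]Rintegral_indic_itv.
transitivity (fine (\int[P]_omega \int[mu]_u f (u, omega))%E).
  congr fine; apply: eq_integral => omega _.
  rewrite /Rintegral; under [in RHS]eq_integral do rewrite /f.
  have bw : bm (fun u => W omega * q (u, omega)).
    by apply: bmM; [exact: bm_cst|exact: bm_sec].
  rewrite -itgZl; last exact: bm_sec.
  rewrite -Rintegral_indic_itv /Rintegral fineK//.
  apply: integrable_fin_num => //.
  apply: (@eq_integrable _ _ _ mu _ measurableT ((EFin \o (fun u => W omega * q (u, omega))) \_ D)).
    by move=> u _ /=; rewrite patchE indicE; case: (u \in _); rewrite ?mul1r ?mul0r.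
  by rewrite -integrable_mkcond//; exact: bm_integrable_oc.
rewrite -FE; congr fine; apply: eq_integral => u _.
under eq_integral do rewrite /f /fr EFinM.
rewrite [LHS](integralZl measurableT (iWq u) (\1_D u)).
have fn := integrable_fin_num measurableT (iWq u).
by rewrite /Rintegral EFinM fineK.
Qed.

End WeightedFubini.

Section DiscreteEnergy.
Context {R : realType} {d : measure_display} {Omega : measurableType d}.
Variables (P : probability Omega R) (F : R -> set_system Omega).
Hypothesis F_filtration : is_filtration F.
Variable w : R -> Omega -> R.
Hypothesis w_wiener : is_wiener P F w.
Variables (Y : simple_process F) (C : R).
Hypothesis Y_le : forall u omega, `|sp_value Y u omega| <= C.

Let Fm t : 0 <= t -> F t `<=` measurable.
Proof. by case: F_filtration => _ + _; exact. Qed.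

Let sF t : 0 <= t -> sigma_algebra setT (F t).
Proof. by case: F_filtration => + _ _; exact. Qed.

Let bmP U : bm U -> P.-integrable setT (EFin \o U).
Proof.
have P1 : (P setT < +oo)%E by rewrite probability_setT ltry.
by move=> bU; exact: bm_integrable.
Qed.

Let Ecst (r : R) : \int[P]_omega r = r.
Proof.
have P1 : P setT = 1%E by exact: probability_setT.
by rewrite Rintegral_cst// [X in fine X]P1 mulr1.
Qed.

(** Young's inequality with parameter [k] keeps the coefficient of the stochastic term
    close to [1]; the other square is of second order in the length of the step. *)
Lemma energy_split (k z h j : R) : 0 < k ->
  2 * z * - (h + j) + (h + j) ^+ 2 <=
  - 2 * z * h - 2 * (z * j) + (1 + k^-1) * h ^+ 2 + (1 + k) * j ^+ 2.
Proof.
move=> k0; have kn : k != 0 by rewrite gt_eqF.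
have -> : - 2 * z * h - 2 * (z * j) + (1 + k^-1) * h ^+ 2 + (1 + k) * j ^+ 2 =
  2 * z * - (h + j) + (h + j) ^+ 2 + k^-1 * (h - k * j) ^+ 2 by field.
by rewrite lerDl mulr_ge0 ?sqr_ge0// invr_ge0 ltW.
Qed.

(** Ito's formula for the square over one step, as an inequality for expectations: the
    product of [z] with the stochastic increment has mean zero.  The last terms are of
    higher order in the step if [k] is small and [c] is of the order of the step. *)
Lemma step_energy (A : set Omega) (s t : R) (z h : Omega -> R) (c k : R) :
  0 <= s -> s < t -> F s A -> bm z -> bm h -> 0 < k ->
  (forall omega, `|h omega| <= c) ->
  \int[P]_omega (\1_A omega * z omega *
     (sp_integral w Y t omega - sp_integral w Y s omega)) = 0 ->
  let D omega := - (h omega + (sp_integral w Y t omega - sp_integral w Y s omega)) in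
  P.-integrable setT (EFin \o (fun omega => \1_A omega * (2 * z omega * D omega + D omega ^+ 2)))
  /\ \int[P]_omega (\1_A omega * (2 * z omega * D omega + D omega ^+ 2)) <=
     \int[P]_omega (\1_A omega * (- 2 * z omega * h omega
       + itg (fun v => sp_value Y v omega ^+ 2) s t))
     + ((1 + k^-1) * c ^+ 2 + k * (C ^+ 2 * (t - s))).
Proof.
move=> s0 st FA bz bh k0 hc mart D.
pose J omega := sp_integral w Y t omega - sp_integral w Y s omega.
have mA : measurable A by exact: Fm FA.
have b1 : bm (\1_A : Omega -> R) by exact: bm_indic.
have F1 : sub_measurable (F s) (\1_A : Omega -> R).
  exact: (@sub_measurable_indic _ _ _ _ (sF s0)).
have i0 omega : 0 <= \1_A omega :> R by rewrite indicE.
have i1 omega : \1_A omega <= 1 :> R by rewrite indicE; case: (_ \in _).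
have [iJ2 EJ2] := sp_increment_sqr F_filtration w_wiener Y s0 st F1 b1 i0.
have F11 : sub_measurable (F s) (fun=> 1 : R) by exact: (@sub_measurable_cst _ _ _ _ (sF s0)).
have [iJ _] := sp_increment0 F_filtration w_wiener Y s0 st F11 (bm_cst 1).
have {}iJ : P.-integrable setT (EFin \o J).
  by apply: eq_integrable iJ => // omega _; rewrite /= mul1r.
have bY : bm (fun omega => itg (fun v => sp_value Y v omega ^+ 2) s t).
  exact: (bm_itg_path s t (bmX2 (bm_sp_value_joint F_filtration Y))).
have b1z : bm (fun omega => \1_A omega * z omega) by exact: bmM.
have iA2 : P.-integrable setT (EFin \o (fun omega => \1_A omega * J omega ^+ 2)).
  exact: bm_integrableM.
have iAz : P.-integrable setT (EFin \o (fun omega => \1_A omega * z omega * J omega)).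
  exact: bm_integrableM.
pose B omega := \1_A omega * (- 2 * z omega * h omega) + (1 + k^-1) * c ^+ 2.
have bB : bm B.
  by apply: bmD; [apply: bmM => //; apply: bmM => //; apply: bmM => //; exact: bm_cst|exact: bm_cst].
have iD : P.-integrable setT
    (EFin \o (fun omega => \1_A omega * (2 * z omega * D omega + D omega ^+ 2))).
  pose b omega := \1_A omega * (- 2 * z omega * h omega + h omega ^+ 2).
  pose b' omega := 2 * \1_A omega * h omega.
  have bb : bm b by rewrite /b; apply: bmM => //; apply: bmD; [apply: bmM => //; apply: bmM => //; exact: bm_cst|exact: bmX2].
  have bb' : bm b' by rewrite /b'; apply: bmM => //; apply: bmM => //; exact: bm_cst.
  have i2 := bm_integrableM (bm_cst (-2)) iAz.
  have i3 := bm_integrableM bb' iJ.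
  have i4 := integrableD measurableT (integrableD measurableT (integrableD measurableT (bmP bb) i2) i3) iA2.
  apply: eq_integrable i4 => // omega _ /=.
  by rewrite -!EFinD; congr EFin; rewrite /b /b' /D -/(J omega); ring.
split=> //.
have iz : P.-integrable setT (EFin \o (fun omega => - 2 * (\1_A omega * z omega * J omega))).
  exact: (bm_integrableM (bm_cst (-2)) iAz).
have i2 : P.-integrable setT (EFin \o (fun omega => (1 + k) * (\1_A omega * J omega ^+ 2))).
  exact: (bm_integrableM (bm_cst (1 + k)) iA2).
have iBz : P.-integrable setT (EFin \o (fun omega => B omega + - 2 * (\1_A omega * z omega * J omega))).
  exact: integrableD (bmP bB) iz.
apply: (@le_trans _ _ (\int[P]_omega ((B omega + - 2 * (\1_A omega * z omega * J omega))
    + (1 + k) * (\1_A omega * J omega ^+ 2)))).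
  apply: le_Rintegral => //; first exact: integrableD iBz i2.
  move=> omega _; rewrite /B.
  have e := energy_split (z omega) (h omega) (J omega) k0.
  have h2 : h omega ^+ 2 <= c ^+ 2.
    rewrite -(real_normK (num_real (h omega))) lerXn2r ?nnegrE//.
    exact: le_trans (hc omega).
  have k1 : 0 <= 1 + k^-1 by rewrite addr_ge0// invr_ge0 ltW.
  have {}h2 := ler_wpM2l k1 h2; have h20 : 0 <= (1 + k^-1) * c ^+ 2 by rewrite mulr_ge0 ?sqr_ge0.
  rewrite /D -/(J omega) !indicE; case: (omega \in A); rewrite ?mul1r ?mul0r ?mulr0 ?addr0 ?add0r//.
  rewrite sqrrN; move: e h2; lra.
rewrite RintegralD// RintegralD//; last exact: bmP.
have mart' : \int[P]_omega (\1_A omega * z omega * J omega) = 0 by exact: mart.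
rewrite (RintegralZl (-2) measurableT iAz) mart' mulr0 addr0 (RintegralZl (1 + k) measurableT iA2).
rewrite /B RintegralD//; last 2 first.
- by apply: bmP; apply: bmM => //; apply: bmM => //; apply: bmM => //; exact: bm_cst.
- by apply: bmP; exact: bm_cst.
rewrite Ecst.
have bAY : bm (fun omega => \1_A omega * itg (fun v => sp_value Y v omega ^+ 2) s t) by exact: bmM.
have -> : \int[P]_omega (\1_A omega * (- 2 * z omega * h omega
       + itg (fun v => sp_value Y v omega ^+ 2) s t)) =
    \int[P]_omega (\1_A omega * (- 2 * z omega * h omega)) +
    \int[P]_omega (\1_A omega * itg (fun v => sp_value Y v omega ^+ 2) s t).
  rewrite -RintegralD//; last 2 first.
  - by apply: bmP; apply: bmM => //; apply: bmM => //; apply: bmM => //; exact: bm_cst.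
  - exact: bmP.
  by apply: eq_Rintegral => omega _; rewrite mulrDr.
have EC : \int[P]_omega (\1_A omega * itg (fun v => sp_value Y v omega ^+ 2) s t) <= C ^+ 2 * (t - s).
  apply: (@le_trans _ _ (\int[P]_omega (C ^+ 2 * (t - s)))); last first.
    by rewrite Ecst.
  apply: le_Rintegral => //; [exact: bmP|by apply: bmP; exact: bm_cst|move=> omega _].
  rewrite -[leRHS]mul1r ler_pM//.
    by apply: itg_ge0 => v _ _; exact: sqr_ge0.
  apply: itg_le_cst; [by apply: bmX2; exact: bm_sp_path|exact: ltW|move=> v _ _].
  rewrite -(real_normK (num_real (sp_value Y v omega))) lerXn2r ?nnegrE//.
  exact: le_trans (Y_le v omega).
have EJ2' : \int[P]_omega (\1_A omega * J omega ^+ 2) <= _ := EJ2.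
have k1 : 0 <= 1 + k by rewrite addr_ge0// ltW.
have := ler_wpM2l k1 EJ2'; have := ler_wpM2l (ltW k0) EC; lra.
Qed.

Lemma grid_energy (A : nat -> set Omega) (z h : nat -> Omega -> R) (N : nat) (Delta c k : R) :
  0 < Delta -> 0 < k -> (forall i, (i < N)%N -> F (i%:R * Delta) (A i)) ->
  (forall i, bm (z i)) -> (forall i, bm (h i)) -> (forall i omega, `|h i omega| <= c) ->
  (forall i, (i < N)%N -> \int[P]_omega (\1_(A i) omega * z i omega *
     (sp_integral w Y (i.+1%:R * Delta) omega - sp_integral w Y (i%:R * Delta) omega)) = 0) ->
  let D i omega := - (h i omega + (sp_integral w Y (i.+1%:R * Delta) omega
    - sp_integral w Y (i%:R * Delta) omega)) in
  let Psi omega := \sum_(i < N)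
    \1_(A i) omega * (2 * z i omega * D i omega + D i omega ^+ 2) in
  let Theta omega := \sum_(i < N) \1_(A i) omega * (- 2 * z i omega * h i omega
    + itg (fun v => sp_value Y v omega ^+ 2) (i%:R * Delta) (i.+1%:R * Delta)) in
  [/\ P.-integrable setT (EFin \o Psi), bm Theta &
    \int[P]_omega Psi omega <= \int[P]_omega Theta omega
      + N%:R * ((1 + k^-1) * c ^+ 2 + k * (C ^+ 2 * Delta))].
Proof.
move=> D0 k0 FA bz bh hc + D; elim: N FA => [|N IH] FA mart Psi Theta.
  have PE : Psi = fun=> 0 by apply/funext => omega; rewrite /Psi big_ord0.
  have TE : Theta = fun=> 0 by apply/funext => omega; rewrite /Theta big_ord0.
  rewrite PE TE; split; [by apply: bmP; exact: bm_cst|exact: bm_cst|].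
  by rewrite mul0r addr0.
have [iP bT le] := IH (fun i iN => FA i (leqW iN)) (fun i iN => mart i (leqW iN)).
have tS : N%:R * Delta < N.+1%:R * Delta by rewrite ltr_pM2r// ltr_nat.
have t0 : 0 <= N%:R * Delta by rewrite mulr_ge0// ltW.
have [iP1 le1] := step_energy t0 tS (FA N (ltnSn N)) (bz N) (bh N) k0 (hc N) (mart N (ltnSn N)).
have mA : measurable (A N) by exact: Fm (FA N (ltnSn N)).
have bY : bm (fun omega => itg (fun v => sp_value Y v omega ^+ 2) (N%:R * Delta) (N.+1%:R * Delta)).
  exact: (bm_itg_path _ _ (bmX2 (bm_sp_value_joint F_filtration Y))).
have bT1 : bm (fun omega => \1_(A N) omega * (- 2 * z N omega * h N omega
    + itg (fun v => sp_value Y v omega ^+ 2) (N%:R * Delta) (N.+1%:R * Delta))).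
  apply: bmM; first exact: bm_indic.
  by apply: bmD => //; apply: bmM => //; apply: bmM => //; exact: bm_cst.
have PE : Psi = fun omega => (\sum_(i < N)
    \1_(A i) omega * (2 * z i omega * D i omega + D i omega ^+ 2)) +
    \1_(A N) omega * (2 * z N omega * D N omega + D N omega ^+ 2).
  by apply/funext => omega; rewrite /Psi big_ord_recr.
have TE : Theta = fun omega => (\sum_(i < N) \1_(A i) omega * (- 2 * z i omega * h i omega
    + itg (fun v => sp_value Y v omega ^+ 2) (i%:R * Delta) (i.+1%:R * Delta))) +
    \1_(A N) omega * (- 2 * z N omega * h N omega
    + itg (fun v => sp_value Y v omega ^+ 2) (N%:R * Delta) (N.+1%:R * Delta)).
  by apply/funext => omega; rewrite /Theta big_ord_recr.
rewrite PE TE; split; [exact: integrableD iP iP1|exact: bmD|].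
rewrite RintegralD// RintegralD//; [|exact: bmP..].
rewrite -natr1 mulrDl mul1r.
have DE : N.+1%:R * Delta - N%:R * Delta = Delta by rewrite -natr1; ring.
move: le le1; rewrite DE; lra.
Qed.

End DiscreteEnergy.

(** Summing over the steps that begin before the exit amounts to summing up to a random
    index [m]: this replaces stopping times. *)
Lemma exit_index (A : nat -> Prop) (N : nat) : (forall i j, (i <= j)%N -> A j -> A i) ->
  exists m, [/\ (m <= N)%N, forall i, (i < N)%N -> (A i <-> (i < m)%N) & ~ A N -> ~ A m].
Proof.
move=> mono; have ex : exists m, (m == N) || ~~ `[< A m >] by exists N; rewrite eqxx.
case: (ex_minnP ex) => m mP mmin; exists m.
have mN : (m <= N)%N by apply: mmin; rewrite eqxx.
split => //.
  move=> i iN; split=> [Ai|im].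
    rewrite ltnNge; apply/negP => mi.
    move: mP; rewrite ltn_eqF ?(leq_ltn_trans mi)//= => /negP; apply; apply/asboolP.
    exact: mono Ai.
  apply/asboolP; apply/negPn/negP => nAi.
  by have := mmin i; rewrite nAi orbT leqNgt im => /(_ isT).
by move=> nAN; case/orP: mP => [/eqP->//|/asboolPn].
Qed.

Lemma sum_exit {R : realType} (f c : nat -> R) (m N : nat) : (m <= N)%N ->
  (forall i, (i < N)%N -> c i = (i < m)%:R) ->
  \sum_(i < N) c i * f i = \sum_(i < m) f i.
Proof.
move=> mN cE; rewrite (big_ord_widen N f mN) [RHS]big_mkcond/=.
by apply: eq_bigr => i _; rewrite cE//; case: (i < m)%N; rewrite ?mul1r ?mul0r.
Qed.

(** * Expectations and probabilities *)

Section ProbabilityEstimates.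
Context {R : realType} {d : measure_display} {Omega : measurableType d}.
Variable P : probability Omega R.

Lemma Rintegral_probability_cst (r : R) : \int[P]_omega r = r.
Proof.
have P1 : P setT = 1%E by exact: probability_setT.
by rewrite Rintegral_cst// [X in fine X]P1 mulr1.
Qed.

Lemma Rintegral_probability_indic (A : set Omega) : measurable A ->
  \int[P]_omega (\1_A omega : R) = fine (P A).
Proof. by move=> mA; rewrite /Rintegral integral_indic// setIT. Qed.

Lemma bm_integrableP (U : Omega -> R) : bm U -> P.-integrable setT (EFin \o U).
Proof.
have P1 : (P setT < +oo)%E by rewrite probability_setT ltry.
by move=> bU; exact: bm_integrable.
Qed.

Lemma Rintegral_affine_indic (p0 p1 p2 : R) (A1 A2 : set Omega) :
  measurable A1 -> measurable A2 ->
  \int[P]_omega (p0 + p1 * \1_A1 omega + p2 * \1_A2 omega) =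
  p0 + p1 * fine (P A1) + p2 * fine (P A2).
Proof.
move=> m1 m2; have b1 : bm (\1_A1 : Omega -> R) by exact: bm_indic.
have b2 : bm (\1_A2 : Omega -> R) by exact: bm_indic.
have b3 p : bm (fun=> p : R) by move=> *; exact: bm_cst.
rewrite RintegralD//; last 2 first.
- by apply: bm_integrableP; apply: bmD => //; exact: bmM.
- by apply: bm_integrableP; exact: bmM.
rewrite RintegralD//; last 2 first.
- exact: bm_integrableP.
- by apply: bm_integrableP; exact: bmM.
rewrite Rintegral_probability_cst RintegralZl//; last exact: bm_integrableP.
by rewrite RintegralZl ?Rintegral_probability_indic//; exact: bm_integrableP.
Qed.

Lemma le_Rintegral_full (A : set Omega) (f h : Omega -> R) : measurable A ->
  P (~` A) = 0%E -> P.-integrable setT (EFin \o f) -> P.-integrable setT (EFin \o h) ->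
  (forall omega, A omega -> f omega <= h omega) ->
  \int[P]_omega f omega <= \int[P]_omega h omega.
Proof.
move=> mA A0 fi hi fh.
have E (u : Omega -> R) : P.-integrable setT (EFin \o u) ->
    \int[P]_omega u omega = \int[P]_(omega in A) u omega.
  move=> ui; have mu : measurable_fun setT (EFin \o u) by exact: measurable_int ui.
  rewrite [RHS]Rintegral_mkcond; congr fine; apply: ae_eq_integral => //.
  - apply/measurable_EFinP; apply/(measurable_restrictT _ mA); apply: measurable_funTS.
    exact/measurable_EFinP.
  exists (~` A); split => //; first exact: measurableC.
  move=> omega; apply: contra_not => Aom _.
  by rewrite /= patchE ifT// inE.
rewrite (E f fi) (E h hi); apply: le_Rintegral => //.
- exact: integrableS fi.
- exact: integrableS hi.
Qed.

(** Countably many almost sure properties hold on one measurable event of probability one. *)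
Lemma ae_full_set (Q : nat -> Omega -> Prop) : (forall i, {ae P, forall omega, Q i omega}) ->
  exists A, [/\ measurable A, P (~` A) = 0%E & forall omega, A omega -> forall i, Q i omega].
Proof.
move=> aeQ; have [M [mM M0 sub]] := negligible_bigcup aeQ.
exists (~` M); split; [exact: measurableC|by rewrite setCK|move=> omega nM i].
by apply: contrapT => nQ; apply: nM; apply: sub; exists i.
Qed.

Lemma probability_bigU (A : nat -> set Omega) (N : nat) (e : R) :
  (forall i, measurable (A i)) -> (forall i, (i < N)%N -> (P (A i) <= e%:E)%E) ->
  fine (P (\big[setU/set0]_(i < N) A i)) <= N%:R * e.
Proof.
move=> mA Ae; rewrite -lee_fin fineK ?fin_num_measure//; last exact: bigsetU_measurable.
apply: (le_trans (@Boole_inequality _ _ _ P A N (fun i _ => mA i))).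
rewrite (_ : (N%:R * e)%:E = \sum_(i < N) e%:E)%E; last first.
  by rewrite sumEFin sumr_const card_ord mulr_natl.
by apply: lee_sum => i _; apply: Ae.
Qed.

Lemma near_all_lt (N : nat) (Q : nat -> nat -> Prop) :
  (forall i, (i < N)%N -> \forall n \near \oo, Q i n) ->
  \forall n \near \oo, forall i, (i < N)%N -> Q i n.
Proof.
elim: N => [|N IH] H; first by near=> n.
have H1 := IH (fun i iN => H i (leqW iN)); have H2 := H N (ltnSn N).
near=> n => i; rewrite ltnS leq_eqVlt => /predU1P[->|iN]; first by near: n.
by move: i iN; near: n.
Unshelve. all: by end_near. Qed.

Lemma small_multiple (M e : R) : 0 <= M -> 0 < e -> exists2 q, 0 < q & M * q <= e.
Proof.
move=> M0 e0; exists (e / (M + 1)); first by rewrite divr_gt0// ltr_wpDl.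
by rewrite mulrCA ger_pMr// ler_pdivrMr ?mul1r ?lerDl// ltr_wpDl.
Qed.

End ProbabilityEstimates.

Section Budgets.
Context {R : realType}.

Lemma upper_budget (cd e B1 t eta dl k2 ck gamma q : R) :
  e * B1 * t * eta <= q -> t * k2 <= q -> ck * gamma <= q ->
  cd + e * B1 * (eta + B1 * dl) * t + (k2 * t + ck * gamma) <=
  cd + e * B1 * B1 * t * dl + 3 * q.
Proof. by lra. Qed.

Lemma exit_budget (k2 fex fS fsl fbad ffar psi theta low up c2 m MT p1 p2 p3 a1 dl ck k q
    cd d4 ed : R) :
  k2 * fex <= k2 * (fS + fsl) -> k2 * fsl <= k2 * p1 -> c2 * fbad <= c2 * (m * p2) ->
  MT * fsl <= MT * p1 -> MT * ffar <= MT * p3 -> k2 * fS - low - c2 * fbad <= psi ->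
  theta <= up + MT * fsl + MT * ffar -> psi <= theta + (a1 * dl + ck * k) ->
  ck * k <= q -> (k2 + MT) * p1 <= q -> (ed + a1) * dl <= q -> c2 * m * p2 <= q ->
  MT * p3 <= q -> low <= d4 + q -> up <= cd + ed * dl + 3 * q ->
  k2 * fex <= cd + d4 + 9 * q.
Proof. by lra. Qed.

Lemma drop_budget (p q l u : R) : 0 <= l -> p <= q -> p - l - (u + q) <= - u.
Proof. by lra. Qed.

Lemma square_budget (z dd b : R) : z ^+ 2 <= b -> - b <= 2 * z * dd + dd ^+ 2.
Proof.
move=> zb; have -> : 2 * z * dd + dd ^+ 2 = (z + dd) ^+ 2 - z ^+ 2 by ring.
by have := sqr_ge0 (z + dd); lra.
Qed.

End Budgets.
(** * The neutral variable and its drift *)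

Section NeutralForm.
Context {R : realType}.
Variables (n n1 n2 : nat) (hd : nat -> R) (a b : nat -> R -> R).
Hypothesis n1_le : (n1 <= n)%N.
Hypothesis n2_le : (n2 <= n)%N.
Hypothesis hd0 : hd 0%N = 0.
Hypothesis hd_ge0 : forall k, (1 <= k <= n)%N -> 0 <= hd k.
Hypothesis ba : forall k, bm (a k).
Hypothesis bb : forall k, bm (b k).
Implicit Types y : R -> R.

(** The kernel [R_k], extended by [0] to the indices where the criterion masks it. *)
Definition rho k t s : R :=
  (k <= n1)%:R * a k (s + hd k) + (k <= n2)%:R * (clamp0 (hd k) (s - t + hd k) * b k s).

(** The neutral variable is [y t - memory y t].  Its memory contains the delayed terms with
    [k <= n1] and the distributed delays with [k <= n2], which it trades for undelayed
    ones with the coefficient [S]. *)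
Definition memory y t : R :=
  \sum_(1 <= k < n.+1) itg (fun s => rho k t s * y s) (t - hd k) t.

Definition linear_drift y s : R := Ssum n1 n2 hd a b s * y s
  + \sum_(n1.+1 <= i < n.+1) a i s * y (s - hd i)
  + \sum_(n2.+1 <= i < n.+1) itg (fun u => b i u * y u) (s - hd i) s.

Lemma bm_Ssum : bm (Ssum n1 n2 hd a b).
Proof. by rewrite /Ssum; bm_solve. Qed.

Lemma bm_linear_drift y : bm y -> bm (linear_drift y).
Proof. by move=> by_; rewrite /linear_drift; have bS := bm_Ssum; bm_solve. Qed.

Lemma bm_rho k : bm (fun p : R * R => rho k p.1 p.2).
Proof.
rewrite /rho; bm_solve.
  by apply: (@bm_snd _ _ _ (fun s => a k (s + hd k))); bm_solve.
apply: bm_clamp0.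
by do 2?apply: measurable_realfun.measurable_funD => //; apply: measurableT_comp.
Qed.

(** The time derivative of [memory y] exchanges the delayed terms of the drift for those of
    [linear_drift]: a discrete delay by a shift of time, a distributed one by
    [itg_window_prim]. *)
Lemma itg_drift y t : bm y -> 0 <= t ->
  itg (fun s => \sum_(0 <= k < n.+1) a k s * y (s - hd k)
     + \sum_(1 <= k < n.+1) itg (fun u => b k u * y u) (s - hd k) s) 0 t =
  itg (linear_drift y) 0 t + memory y 0 - memory y t.
Proof.
move=> by_ t0.
have bS := bm_Ssum.
rewrite itgD; [|by bm_solve|by bm_solve].
rewrite /linear_drift itgD; [|by bm_solve|by bm_solve].
rewrite itgD; [|by bm_solve|by bm_solve].
have sumE c F : (forall k, bm (F k)) -> itg (fun x => \sum_(c <= k < n.+1) F k x) 0 t =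
    \sum_(c <= k < n.+1) itg (F k) 0 t by move=> bF; exact: itg_sum.
rewrite (sumE _ (fun k x => a k x * y (x - hd k))); last by move=> k; bm_solve.
rewrite (sumE _ (fun k x => itg (fun u => b k u * y u) (x - hd k) x)); last by move=> k; bm_solve.
rewrite (sumE _ (fun k x => a k x * y (x - hd k))); last by move=> k; bm_solve.
rewrite (sumE _ (fun k x => itg (fun u => b k u * y u) (x - hd k) x)); last by move=> k; bm_solve.
have -> : itg (fun x => Ssum n1 n2 hd a b x * y x) 0 t =
    itg (fun s => a 0%N s * y s) 0 t
    + \sum_(1 <= k < n.+1) (if (k <= n1)%N then itg (fun s => a k (s + hd k) * y s) 0 t else 0)
    + \sum_(1 <= k < n.+1) (if (k <= n2)%N then hd k * itg (fun s => b k s * y s) 0 t else 0).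
  rewrite -!sum_nat_le//.
  rewrite -itg_sum; last by move=> k _; bm_solve.
  have -> : \sum_(1 <= k < n2.+1) hd k * itg (fun s => b k s * y s) 0 t =
      \sum_(1 <= k < n2.+1) itg (fun s => hd k * (b k s * y s)) 0 t.
    by apply: eq_bigr => k _; rewrite itgZl//; bm_solve.
  rewrite -itg_sum; last by move=> k _; bm_solve.
  rewrite -itgD; [|by bm_solve|by bm_solve].
  rewrite -itgD; [|by bm_solve|by bm_solve].
  apply: eq_itg => s _ _.
  rewrite /Ssum big_ltn// hd0 addr0 !mulrDl !mulr_suml; congr (_ + _ + _).
  by apply: eq_bigr => k _; rewrite mulrAC mulrC.
rewrite !(sum_nat_gt _ n1_le) !(sum_nat_gt _ n2_le).
rewrite big_ltn// hd0 (@eq_itg _ (fun s => a 0%N s * y (s - 0)) (fun s => a 0%N s * y s)); last first.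
  by move=> s _ _; rewrite subr0.
rewrite /memory -!addrA; congr (_ + _).
rewrite -sumrN !addrA -!big_split/=.
rewrite big_nat_cond [RHS]big_nat_cond; apply: eq_bigr => k; rewrite andbT => kn.
have hk := hd_ge0 kn.
have shiftE : itg (fun s => a k s * y (s - hd k)) 0 t =
    itg (fun s => a k (s + hd k) * y s) 0 t
    + itg (fun s => a k (s + hd k) * y s) (0 - hd k) 0
    - itg (fun s => a k (s + hd k) * y s) (t - hd k) t.
  have ba' : bm (fun s : R => a k (s + hd k) * y s) by bm_solve.
  rewrite [LHS](_ : _ = itg (fun s => a k (s + hd k) * y s) (0 - hd k) (t - hd k)); last first.
    by rewrite -itg_shift//; apply: eq_itg => s _ _; rewrite subrK.
  apply/eqP; rewrite -subr_eq opprK -itg_split//; last 2 first.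
  - by rewrite lerD2r.
  - by rewrite gerBl.
  rewrite [eqbRHS]addrC -(itg_split ba') ?sub0r ?oppr_le0; [exact: eqxx|exact: hk|exact: t0].
have bby : bm (fun s : R => b k s * y s) by bm_solve.
have windowE := itg_window_prim bby t0 hk.
have bc c : bm (fun s : R => clamp0 (hd k) (s - c + hd k) * (b k s * y s)).
  apply: bmM => //; apply: bm_clamp0.
  by do 2?apply: measurable_realfun.measurable_funD.
have rhoE c : itg (fun s => rho k c s * y s) (c - hd k) c =
    (k <= n1)%:R * itg (fun s => a k (s + hd k) * y s) (c - hd k) c
    + (k <= n2)%:R * itg (fun s => clamp0 (hd k) (s - c + hd k) * (b k s * y s)) (c - hd k) c.
  rewrite -!itgZl; [|exact: bc|by bm_solve].
  rewrite -itgD; [|by bm_solve|by apply: bmM => //; exact: bm_cst].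
  by apply: eq_itg => s _ _; rewrite /rho; ring.
have clE : itg (fun s => clamp0 (hd k) (s - 0 + hd k) * (b k s * y s)) (0 - hd k) 0 =
    itg (fun s => clamp0 (hd k) (s + hd k) * (b k s * y s)) (- hd k) 0.
  by rewrite sub0r; apply: eq_itg => s _ _; rewrite subr0.
rewrite !rhoE clE windowE shiftE.
by case: (leqP k n1) => _; case: (leqP k n2) => _; rewrite /= ?mulr1n ?mulr0n; ring.
Qed.

Definition rho_mass t : R :=
  \sum_(1 <= k < n.+1) itg (fun s => `|rho k t s|) (t - hd k) t.

Definition rho_energy y t : R :=
  \sum_(1 <= k < n.+1) itg (fun s => `|rho k t s| * y s ^+ 2) (t - hd k) t.

Definition rho0 k t s : R :=
  Ssum n1 n2 hd a b t * rho k t s - (n2 < k)%:R * b k s.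

Definition P0 t : R := \sum_(n1.+1 <= i < n.+1) `|a i t|
  + \sum_(n2.+1 <= i < n.+1) itg (fun u => `|b i u|) (t - hd i) t.

Definition Q0 k t s : R :=
  `|rho0 k t s| + P0 t * `|rho k t s| + rho_mass t * ((n2 < k)%:R * `|b k s|).

Lemma bm_rho_sec k t : bm (fun s : R => rho k t s).
Proof. exact: (bm_sec1 t (bm_rho k)). Qed.

Lemma bm_rho_mass : bm rho_mass.
Proof.
apply: bm_sum => k _; apply: (@bm_past_window R (fun p => `|rho k p.1 p.2|)).
by apply: bm_norm; exact: bm_rho.
Qed.

Lemma bm_rho_energy y : bm y -> bm (rho_energy y).
Proof.
move=> by_; apply: bm_sum => k _.
apply: (@bm_past_window R (fun p => `|rho k p.1 p.2| * y p.2 ^+ 2)).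
have br := bm_rho k; apply: bmM; first exact: bm_norm.
by apply: (@bm_snd R _ R (fun x => y x ^+ 2)); bm_solve.
Qed.

Lemma bm_memory y : bm y -> bm (memory y).
Proof.
move=> by_; apply: bm_sum => k _.
apply: (@bm_past_window R (fun p => rho k p.1 p.2 * y p.2)).
by have br := bm_rho k; bm_solve.
Qed.

Lemma bm_rho0 k : bm (fun p : R * R => rho0 k p.1 p.2).
Proof. by have br := bm_rho k; have bS := bm_Ssum; rewrite /rho0; bm_solve. Qed.

Lemma bm_P0 : bm P0.
Proof. by rewrite /P0; bm_solve. Qed.

Lemma bm_Q0 k : bm (fun p : R * R => Q0 k p.1 p.2).
Proof.
have br := bm_rho k; have br0 := bm_rho0 k; have bP := bm_P0; have bR := bm_rho_mass.
by rewrite /Q0; bm_solve.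
Qed.

Lemma rho_mass_ge0 t : 0 <= rho_mass t.
Proof. by apply: sumr_ge0 => k _; apply: itg_ge0. Qed.

Lemma P0_ge0 t : 0 <= P0 t.
Proof. by apply: addr_ge0; apply: sumr_ge0 => k _ //; apply: itg_ge0. Qed.

Lemma Q0_ge0 k t s : 0 <= Q0 k t s.
Proof. by rewrite !addr_ge0 ?mulr_ge0 ?P0_ge0 ?rho_mass_ge0. Qed.

Let young (x z : R) : 2 * `|x| * `|z| <= x ^+ 2 + z ^+ 2.
Proof.
rewrite -(real_normK (num_real x)) -(real_normK (num_real z)).
by have := sqr_ge0 (`|x| - `|z|); lra.
Qed.

(** Young's inequality under the integrals that define the memory. *)
Lemma memory_cross y t c : bm y ->
  2 * `|memory y t| * `|c| <= rho_energy y t + rho_mass t * c ^+ 2.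
Proof.
move=> by_; have br k := bm_rho_sec k t.
apply: (@le_trans _ _ (\sum_(1 <= k < n.+1)
    itg (fun s => 2 * `|c| * (`|rho k t s| * `|y s|)) (t - hd k) t)).
  rewrite mulrAC (le_trans (ler_wpM2l _ (ler_norm_sum _ _ _)))// mulr_sumr.
  apply: ler_sum => k _; have {}br := br k.
  rewrite itgZl; last by bm_solve.
  apply: ler_wpM2l => //; rewrite (le_trans (itg_norm _ _ _))//; first by bm_solve.
  by rewrite (@eq_itg _ _ (fun s => `|rho k t s| * `|y s|))// => s _ _; rewrite normrM.
rewrite /rho_energy /rho_mass mulr_suml -big_split/=.
apply: ler_sum => k _; have {}br := br k.
rewrite -itgZr; last by bm_solve.
rewrite -itgD; [|by bm_solve|by bm_solve].
apply: le_itg; [by bm_solve|by bm_solve|move=> s _ _].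
rewrite -mulrDr mulrCA; apply: ler_wpM2l => //.
by have := young (y s) c; rewrite mulrAC.
Qed.

Lemma neutral_cross y t c : bm y ->
  2 * `|y t - memory y t| * `|c| <=
  y t ^+ 2 + rho_energy y t + (1 + rho_mass t) * c ^+ 2.
Proof.
move=> by_; have := memory_cross t c by_; have := young (y t) c.
have : `|y t - memory y t| * `|c| <= (`|y t| + `|memory y t|) * `|c|.
  by apply: ler_wpM2r => //; exact: ler_normB.
by lra.
Qed.

(** Expand [- 2 (y - m) (S y + A + B)], where [m] is the memory, [A] the discrete and [B] the
    distributed delays that are left.  The terms [2 y (S m - B)] produce the kernel
    [rho0], while [m B] and [(y - m) A] produce the other parts of [Q0] and the last sum; each
    product of two values of the path is split by Young's inequality. *)
Lemma linear_drift_le y t : bm y ->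
  - 2 * (y t - memory y t) * linear_drift y t <=
  (- 2 * Ssum n1 n2 hd a b t
   + \sum_(1 <= k < n.+1) itg (fun s => `|rho0 k t s|) (t - hd k) t
   + \sum_(n1.+1 <= i < n.+1) `|a i t|) * y t ^+ 2
  + \sum_(1 <= k < n.+1) itg (fun s => Q0 k t s * y s ^+ 2) (t - hd k) t
  + \sum_(n1.+1 <= i < n.+1) (1 + rho_mass t) * `|a i t| * y (t - hd i) ^+ 2.
Proof.
move=> by_; have br k := bm_rho_sec k t.
have br0 k : bm (fun s : R => rho0 k t s) by exact: (bm_sec1 t (bm_rho0 k)).
set S := Ssum n1 n2 hd a b t.
set m := memory y t; set z := y t - m.
set A := \sum_(n1.+1 <= i < n.+1) a i t * y (t - hd i).
set B := \sum_(n2.+1 <= i < n.+1) itg (fun u => b i u * y u) (t - hd i) t.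
have -> : linear_drift y t = S * y t + A + B by [].
have -> : - 2 * z * (S * y t + A + B) =
    - 2 * S * y t ^+ 2 + 2 * y t * (S * m - B) + 2 * m * B + (- 2 * z * A).
  by rewrite /z; ring.
have hA : - 2 * z * A <= (\sum_(n1.+1 <= i < n.+1) `|a i t|) *
    (y t ^+ 2 + rho_energy y t)
    + \sum_(n1.+1 <= i < n.+1) (1 + rho_mass t) * `|a i t| * y (t - hd i) ^+ 2.
  rewrite mulr_suml -big_split/= mulr_sumr; apply: ler_sum => i _.
  rewrite (le_trans (ler_norm _))// !normrM normrN (@ger0_norm _ 2)//.
  have := neutral_cross t (y (t - hd i)) by_; rewrite -/m -/z => H.
  have := ler_wpM2l (normr_ge0 (a i t)) H.
  by rewrite !mulrDr !mulrDl; lra.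
have hB : 2 * m * B <= (\sum_(n2.+1 <= i < n.+1) itg (fun u => `|b i u|) (t - hd i) t)
      * rho_energy y t
    + rho_mass t * \sum_(n2.+1 <= i < n.+1)
        itg (fun u => `|b i u| * y u ^+ 2) (t - hd i) t.
  rewrite [in leRHS]mulr_suml [in leRHS]mulr_sumr -big_split/= /B mulr_sumr.
  apply: ler_sum => i _; rewrite -itgZl; last by bm_solve.
  rewrite -itgZl; last by bm_solve.
  rewrite -itgZr; last by bm_solve.
  rewrite -itgD; [|by bm_solve|by bm_solve].
  apply: le_itg; [by bm_solve|by bm_solve|move=> s _ _].
  rewrite (le_trans (ler_norm _))// !normrM (@ger0_norm _ 2)//.
  have := ler_wpM2l (normr_ge0 (b i s)) (memory_cross t (y s) by_); rewrite -/m.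
  by rewrite !mulrDr; lra.
have hS : S * m - B = \sum_(1 <= k < n.+1) itg (fun s => rho0 k t s * y s) (t - hd k) t.
  rewrite /m /B /memory (sum_nat_gt _ n2_le) mulr_sumr -sumrB; apply: eq_bigr => k _.
  have {}br := br k.
  rewrite (_ : (if _ then _ else _) =
    itg (fun s => (n2 < k)%:R * (b k s * y s)) (t - hd k) t); last first.
    by rewrite itgZl ?mulrb; [case: ifP => _; rewrite ?mul1r ?mul0r|bm_solve].
  rewrite -itgZl; last by bm_solve.
  rewrite -itgB; [|by bm_solve|by bm_solve].
  by apply: eq_itg => s _ _; rewrite /rho0 -/S; ring.
have hC : 2 * y t * (S * m - B) <=
    (\sum_(1 <= k < n.+1) itg (fun s => `|rho0 k t s|) (t - hd k) t) * y t ^+ 2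
    + \sum_(1 <= k < n.+1) itg (fun s => `|rho0 k t s| * y s ^+ 2) (t - hd k) t.
  rewrite hS mulr_sumr mulr_suml -big_split/=; apply: ler_sum => k _.
  have {}br0 := br0 k.
  rewrite -itgZl; last by bm_solve.
  rewrite -itgZr; last by bm_solve.
  rewrite -itgD; [|by bm_solve|by bm_solve].
  apply: le_itg; [by bm_solve|by bm_solve|move=> s _ _].
  rewrite (le_trans (ler_norm _))// !normrM (@ger0_norm _ 2)//.
  by have := ler_wpM2l (normr_ge0 (rho0 k t s)) (young (y t) (y s)); lra.
have hQ : \sum_(1 <= k < n.+1) itg (fun s => Q0 k t s * y s ^+ 2) (t - hd k) t =
    \sum_(1 <= k < n.+1) itg (fun s => `|rho0 k t s| * y s ^+ 2) (t - hd k) t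
    + P0 t * rho_energy y t
    + rho_mass t * \sum_(n2.+1 <= i < n.+1)
        itg (fun u => `|b i u| * y u ^+ 2) (t - hd i) t.
  rewrite (sum_nat_gt _ n2_le) !mulr_sumr -!big_split/=; apply: eq_bigr => k _.
  have {}br := br k; have {}br0 := br0 k.
  rewrite (_ : (if _ then _ else _) =
    itg (fun s => (n2 < k)%:R * (`|b k s| * y s ^+ 2)) (t - hd k) t); last first.
    by rewrite itgZl ?mulrb; [case: ifP => _; rewrite ?mul1r ?mul0r|bm_solve].
  rewrite -itgZl; last by bm_solve.
  rewrite -itgZl; last by bm_solve.
  rewrite -itgD; [|by bm_solve|by bm_solve].
  rewrite -itgD; [|by bm_solve|by bm_solve].
  by apply: eq_itg => s _ _; rewrite /Q0; ring.
rewrite hQ /P0; move: hA hB hC.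
set sa := \sum_(n1.+1 <= i < n.+1) `|a i t|.
set sb := \sum_(n2.+1 <= i < n.+1) itg (fun u => `|b i u|) (t - hd i) t.
by lra.
Qed.

(** * The energy estimate *)

Section Lyapunov.
Variables (sigma : R -> R) (tau H c0 G0 : R).
Hypothesis bsigma : bm sigma.
Hypothesis tau_ge0 : 0 <= tau.
Hypothesis tau_le : tau <= H.
Hypothesis hd_le : forall k, (1 <= k <= n)%N -> hd k <= H.
Hypothesis c0_gt0 : 0 < c0.
Hypothesis G0_ge0 : 0 <= G0.
Hypothesis criterion : forall t, 0 <= t ->
  \sum_(1 <= k < n.+1) (itg (fun s => `|rho0 k t s|) (t - hd k) t
     + itg (fun u => Q0 k u t) t (t + hd k))
  + \sum_(n1.+1 <= k < n.+1)
      (`|a k t| + (1 + rho_mass (t + hd k)) * `|a k (t + hd k)|)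
  + sigma (t + tau) ^+ 2 <= 2 * Ssum n1 n2 hd a b t - c0.

(** Integrate [linear_drift_le] over [[0, T]] and move every past value of the path to the
    time at which it occurs: the coefficients of [y s ^ 2] then add up to the left side of
    the criterion minus [2 S].  The margin [c0] pays for the terms with [kappa], and the
    values before time [0] contribute a multiple of [delta ^ 2].  [W] stands for the energy
    of the nonlinear term. *)
Lemma lyapunov_bound : exists kappa0 C, [/\ 0 < kappa0, 0 <= C &
  forall (y W : R -> R) (kappa T delta : R), bm y -> bm W -> (forall s, 0 <= W s) ->
    0 <= kappa <= kappa0 -> 0 <= T ->
    (forall u, - H <= u -> u <= 0 -> `|y u| <= delta) ->
    itg W 0 T <= G0 * itg (fun s => y s ^+ 2) 0 T + G0 * H * delta ^+ 2 ->
    itg (fun s => - 2 * (y s - memory y s) * linear_drift y s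
      + sigma s ^+ 2 * y (s - tau) ^+ 2
      + kappa * (G0 * (y s ^+ 2 + rho_energy y s) + (1 + rho_mass s) * W s)) 0 T
    <= C * delta ^+ 2].
Proof.
have bS := bm_Ssum; have bRm := bm_rho_mass.
have [Mq Mq0 Qle] := bm_uniform n.+1 bm_Q0.
have [Mr Mr0 rle] := bm_uniform n.+1 bm_rho.
have bra k : bm (fun s : R => (1 + rho_mass s) * `|a k s|) by bm_solve.
have [Ma Ma0 ale] := bm_uniform n.+1 bra.
have [Ms Ms0 sle] := bm_bound (bmX2 bsigma).
have [Mm Mm0 mass_le] := bm_bound bRm.
have H0 : 0 <= H by exact: le_trans tau_le.
pose C2 := G0 * (1 + \sum_(1 <= k < n.+1) hd k * Mr) + (1 + Mm) * G0.
have hd0' k : (1 <= k < n.+1)%N -> 0 <= hd k by move=> kn; apply: hd_ge0.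
have C20 : 0 <= C2.
  rewrite addr_ge0// ?mulr_ge0// ?addr_ge0//.
  by rewrite big_nat_cond sumr_ge0// => k; rewrite andbT => /hd0' ?; rewrite mulr_ge0.
pose C3 := G0 * (\sum_(1 <= k < n.+1) hd k * (hd k * Mr)) + (1 + Mm) * (G0 * H).
have C30 : 0 <= C3.
  rewrite addr_ge0// ?mulr_ge0// ?addr_ge0//.
  by rewrite big_nat_cond sumr_ge0// => k; rewrite andbT => /hd0' ?; rewrite !mulr_ge0.
pose C1 := \sum_(1 <= k < n.+1) hd k * (hd k * Mq) + \sum_(n1.+1 <= k < n.+1) hd k * Ma
  + tau * Ms.
have hd0'' k : (n1.+1 <= k < n.+1)%N -> (1 <= k < n.+1)%N.
  by move=> /andP[k1 ->]; rewrite andbT; apply: leq_trans k1.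
have C10 : 0 <= C1.
  rewrite !addr_ge0 ?mulr_ge0//.
    by rewrite big_nat_cond sumr_ge0// => k; rewrite andbT => /hd0' ?; rewrite !mulr_ge0.
  by rewrite big_nat_cond sumr_ge0// => k; rewrite andbT => /hd0''/hd0' ?; rewrite !mulr_ge0.
(* [C2] bounds the coefficient of [kappa] times the energy. *)
pose kappa0 := c0 / (C2 + 1).
have kappa0_gt0 : 0 < kappa0 by rewrite divr_gt0// ltr_wpDl.
exists kappa0, (C1 + kappa0 * C3); split => //.
  by rewrite addr_ge0// mulr_ge0// ltW.
move=> y W kappa T delta by_ bW W0 /andP[kap0 kapk] T0 ydelta Wle.
have bv : bm (fun s => y s ^+ 2) by exact: bmX2.
have v0 u : 0 <= y u ^+ 2 by exact: sqr_ge0.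
have vdelta h : 0 <= h -> h <= H -> forall u, u <= 0 -> - h <= u -> y u ^+ 2 <= delta ^+ 2.
  move=> h0 hH u u0 hu; rewrite -(real_normK (num_real (y u))) lerXn2r ?nnegrE//.
    by rewrite (le_trans (normr_ge0 (y u)))// ydelta// (le_trans _ hu)// lerN2.
  by rewrite ydelta// (le_trans _ hu)// lerN2.
have bQs k : bm (fun t : R => itg (fun u => Q0 k u t) t (t + hd k)).
  exact: (@bm_future_window R (fun p => Q0 k p.1 p.2) (hd k) (bm_Q0 k)).
have bQw k : bm (fun s : R => itg (fun u => Q0 k s u * y u ^+ 2) (s - hd k) s).
  apply: (@bm_past_window R (fun p => Q0 k p.1 p.2 * y p.2 ^+ 2) (hd k)).
  by apply: bmM; [exact: bm_Q0|apply: (@bm_snd R _ R (fun u => y u ^+ 2))].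
have br0 k : bm (fun t : R => itg (fun s => `|rho0 k t s|) (t - hd k) t).
  apply: (@bm_past_window R (fun p => `|rho0 k p.1 p.2|)); apply: bm_norm; exact: bm_rho0.
have brw k : bm (fun s : R => itg (fun u => `|rho k s u| * y u ^+ 2) (s - hd k) s).
  apply: (@bm_past_window R (fun p => `|rho k p.1 p.2| * y p.2 ^+ 2) (hd k)).
  apply: bmM; first by apply: bm_norm; exact: bm_rho.
  exact: (@bm_snd R _ R (fun u => y u ^+ 2)).
have bld := bm_linear_drift by_; have bmem := bm_memory by_.
have ben := bm_rho_energy by_.
have ydel : bm (fun s : R => y (s - tau)) by bm_solve.
have ydl k : bm (fun s : R => y (s - hd k)) by bm_solve.
pose e1 s := (- 2 * Ssum n1 n2 hd a b s
   + \sum_(1 <= k < n.+1) itg (fun u => `|rho0 k s u|) (s - hd k) s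
   + \sum_(n1.+1 <= i < n.+1) `|a i s|) * y s ^+ 2.
pose e2 s := \sum_(1 <= k < n.+1) itg (fun u => Q0 k s u * y u ^+ 2) (s - hd k) s.
pose e3 s := \sum_(n1.+1 <= i < n.+1) (1 + rho_mass s) * `|a i s| * y (s - hd i) ^+ 2.
pose e4 s := sigma s ^+ 2 * y (s - tau) ^+ 2.
pose e5 s := (kappa * G0) * (y s ^+ 2 + rho_energy y s).
pose e6 s := kappa * ((1 + rho_mass s) * W s).
have be1 : bm e1.
  apply: bmM => //; apply: bmD; last by bm_solve.
  by apply: bmD; [bm_solve|apply: bm_sum => k _; exact: br0].
have be2 : bm e2 by apply: bm_sum => k _; exact: bQw.
have be3 : bm e3 by rewrite /e3; bm_solve.
have be4 : bm e4 by rewrite /e4; bm_solve.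
have be5 : bm e5 by rewrite /e5; bm_solve.
have be6 : bm e6 by rewrite /e6; bm_solve.
apply: (@le_trans _ _ (itg (fun s => e1 s + e2 s + e3 s + e4 s + e5 s + e6 s) 0 T)).
  apply: le_itg; [by bm_solve|by bm_solve|move=> s _ _].
  have := linear_drift_le s by_; rewrite -/(e1 s) -/(e2 s) -/(e3 s) => le.
  by rewrite /e4 /e5 /e6; lra.
do 5 (rewrite itgD; [|by bm_solve|by bm_solve]).
pose Y := itg (fun s => y s ^+ 2) 0 T.
have Y0 : 0 <= Y by apply: itg_ge0.
have i2 : itg e2 0 T <= \sum_(1 <= k < n.+1)
    (itg (fun u => y u ^+ 2 * itg (fun s => Q0 k s u) u (u + hd k)) 0 T
     + hd k * (hd k * Mq * delta ^+ 2)).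
  rewrite /e2 (@itg_sum R nat (index_iota 1 n.+1) xpredT
    (fun k s => itg (fun u => Q0 k s u * y u ^+ 2) (s - hd k) s)); last by move=> k _.
  apply: ler_sum_nat => k kn.
  apply: (@itg_window_le R (fun p => Q0 k p.1 p.2) (fun u => y u ^+ 2)) => //.
  - exact: bm_Q0.
  - move=> p; rewrite Q0_ge0/= (le_trans (ler_norm _))//.
    by apply: (Qle k p); case/andP: kn.
  - by apply: vdelta; [exact: hd0'|exact: hd_le].
  - exact: hd0'.
have i3 : itg e3 0 T <= \sum_(n1.+1 <= k < n.+1)
    (itg (fun u => y u ^+ 2 * ((1 + rho_mass (u + hd k)) * `|a k (u + hd k)|)) 0 T
     + hd k * Ma * delta ^+ 2).
  rewrite /e3 (@itg_sum R nat (index_iota n1.+1 n.+1) xpredT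
    (fun k s => (1 + rho_mass s) * `|a k s| * y (s - hd k) ^+ 2)); last by move=> k _; bm_solve.
  apply: ler_sum_nat => k /hd0'' kn.
  apply: (@itg_delay_le R (fun s => (1 + rho_mass s) * `|a k s|) (fun u => y u ^+ 2)) => //.
  - move=> s; rewrite mulr_ge0 ?addr_ge0 ?rho_mass_ge0//= (le_trans (ler_norm _))//.
    by apply: ale; case/andP: kn.
  - by apply: vdelta; [exact: hd0'|exact: hd_le].
  - exact: hd0'.
have i4 : itg e4 0 T <= itg (fun u => y u ^+ 2 * sigma (u + tau) ^+ 2) 0 T
    + tau * Ms * delta ^+ 2.
  apply: (@itg_delay_le R (fun s => sigma s ^+ 2) (fun u => y u ^+ 2)) => //.
  - exact: bmX2.
  - by move=> s; rewrite sqr_ge0/= (le_trans (ler_norm _)).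
  - exact: vdelta.
have i5 : itg e5 0 T <= kappa * G0 * (Y + \sum_(1 <= k < n.+1)
    (hd k * Mr * Y + hd k * (hd k * Mr * delta ^+ 2))).
  rewrite /e5 itgZl; last by bm_solve.
  rewrite itgD//; apply: ler_wpM2l; first exact: mulr_ge0.
  rewrite lerD2l /rho_energy (@itg_sum R nat (index_iota 1 n.+1) xpredT
    (fun k s => itg (fun u => `|rho k s u| * y u ^+ 2) (s - hd k) s)); last by move=> k _.
  apply: ler_sum_nat => k kn; have hk0 := hd0' _ kn.
  have brn : bm (fun p : R * R => `|rho k p.1 p.2|) by apply: bm_norm; exact: bm_rho.
  have rM p : `|rho k p.1 p.2| <= Mr by apply: (rle k p); case/andP: kn.
  apply: (@le_trans _ _ (itg (fun u => y u ^+ 2 * itg (fun s => `|rho k s u|) u (u + hd k)) 0 T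
      + hd k * (hd k * Mr * delta ^+ 2))).
    apply: (@itg_window_le R (fun p => `|rho k p.1 p.2|) (fun u => y u ^+ 2)) => //.
    - by move=> p; rewrite normr_ge0/=.
    - by apply: vdelta => //; exact: hd_le.
  rewrite lerD2r /Y -itgZl//.
  have brs : bm (fun s : R => itg (fun u => `|rho k u s|) s (s + hd k)).
    exact: (@bm_future_window R (fun p => `|rho k p.1 p.2|)).
  apply: le_itg; [by bm_solve|by bm_solve|move=> u _ _].
  rewrite mulrC; apply: ler_wpM2r => //.
  rewrite (mulrC (hd k)) (_ : hd k = u + hd k - u); last by rewrite addrAC subrr add0r.
  rewrite {1}(_ : u + hd k - u = hd k); last by rewrite addrAC subrr add0r.
  apply: itg_le_cst; [exact: (bm_sec2 u brn)|by rewrite lerDl|].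
  by move=> s _ _; exact: (rM (s, u)).
have i6 : itg e6 0 T <= kappa * ((1 + Mm) * (G0 * Y + G0 * H * delta ^+ 2)).
  rewrite /e6 itgZl; last by bm_solve.
  apply: ler_wpM2l => //; apply: (@le_trans _ _ (itg (fun s => (1 + Mm) * W s) 0 T)).
    apply: le_itg; [by bm_solve|by bm_solve|move=> s _ _].
    by apply: ler_wpM2r => //; rewrite lerD2l (le_trans (ler_norm _)).
  by rewrite itgZl//; apply: ler_wpM2l => //; rewrite addr_ge0.
pose J := itg e1 0 T + \sum_(1 <= k < n.+1)
    itg (fun u => y u ^+ 2 * itg (fun s => Q0 k s u) u (u + hd k)) 0 T
  + \sum_(n1.+1 <= k < n.+1)
    itg (fun u => y u ^+ 2 * ((1 + rho_mass (u + hd k)) * `|a k (u + hd k)|)) 0 T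
  + itg (fun u => y u ^+ 2 * sigma (u + tau) ^+ 2) 0 T.
have iJ : J <= - c0 * Y.
  have rms k : bm (fun u : R => rho_mass (u + hd k)) by bm_solve.
  have ams k : bm (fun u : R => a k (u + hd k)) by bm_solve.
  have sms : bm (fun u : R => sigma (u + tau)) by bm_solve.
  pose q2 k u := y u ^+ 2 * itg (fun s => Q0 k s u) u (u + hd k).
  pose q3 k u := y u ^+ 2 * ((1 + rho_mass (u + hd k)) * `|a k (u + hd k)|).
  pose q4 u := y u ^+ 2 * sigma (u + tau) ^+ 2.
  have bq2 k : bm (q2 k) by apply: bmM; [exact: bv|exact: bQs].
  have bq3 k : bm (q3 k).
    by apply: bmM; [exact: bv|apply: bm_comp (bra k); exact: measurable_shift].
  have bq4 : bm q4 by apply: bmM; [exact: bv|apply: bmX2; exact: sms].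
  have bs2 : bm (fun u : R => \sum_(1 <= k < n.+1) q2 k u) by apply: bm_sum => k _.
  have bs3 : bm (fun u : R => \sum_(n1.+1 <= k < n.+1) q3 k u) by apply: bm_sum => k _.
  rewrite /J -/q4.
  rewrite -(itg_sum (index_iota 1 n.+1) (p := xpredT) (F := q2) _ _ (fun k _ => bq2 k)).
  rewrite -(itg_sum (index_iota n1.+1 n.+1) (p := xpredT) (F := q3) _ _ (fun k _ => bq3 k)).
  rewrite -(itgD _ _ be1 bs2) -(itgD _ _ (bmD be1 bs2) bs3).
  rewrite -(itgD _ _ (bmD (bmD be1 bs2) bs3) bq4) /Y -itgZl//.
  apply: le_itg; [by do 3 apply: bmD => //|by bm_solve|move=> s s0 _].
  have := ler_wpM2r (v0 s) (criterion (ltW s0)).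
  by rewrite /e1 /q2 /q3 /q4 -!mulr_sumr !big_split/=; lra.
have kC2 : kappa * C2 * Y <= c0 * Y.
  apply: ler_wpM2r => //; apply: (@le_trans _ _ (kappa0 * C2)); first exact: ler_wpM2r.
  by rewrite /kappa0 mulrAC ler_pdivrMr ?ltr_wpDl// ler_wpM2l ?ltW//; lra.
have kC3 : kappa * C3 * delta ^+ 2 <= kappa0 * C3 * delta ^+ 2.
  by apply: ler_wpM2r; rewrite ?sqr_ge0//; apply: ler_wpM2r.
move: i2 i3 i5; rewrite !big_split/= -!mulr_suml => i2 i3 i5.
have E2 : \sum_(1 <= k < n.+1) hd k * (hd k * Mq * delta ^+ 2) =
    (\sum_(1 <= k < n.+1) hd k * (hd k * Mq)) * delta ^+ 2.
  by rewrite mulr_suml; apply: eq_bigr => k _; rewrite mulrA.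
have E5 : \sum_(1 <= k < n.+1) hd k * (hd k * Mr * delta ^+ 2) =
    (\sum_(1 <= k < n.+1) hd k * (hd k * Mr)) * delta ^+ 2.
  by rewrite mulr_suml; apply: eq_bigr => k _; rewrite mulrA.
rewrite E2 in i2; rewrite E5 in i5.
move: iJ kC2 kC3 i2 i3 i4 i5 i6; rewrite /J /C1 /C2 /C3 -!mulr_suml.
by lra.
Qed.

Section StieltjesTerm.
Variable nu : {sigma_finite_measure set (measurableTypeR R) -> \bar R}.
Local Notation I := (`[(- H)%R, 0%R]%classic : set (measurableTypeR R)).
Hypothesis nu_fin : (nu I < +oo)%E.
Hypothesis nu_G0 : fine (nu I) = G0.

Definition lag_mean y u : R := \int[nu]_(th in I) `|y (u + th)|.
Definition lag_energy y u : R := \int[nu]_(th in I) y (u + th) ^+ 2.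

Let mI : measurable I. Proof. exact: measurable_itv. Qed.

Let bm_lag y : bm y -> bm (fun p : R * measurableTypeR R => y (p.1 + p.2)).
Proof.
by move=> by_; apply: (bm_comp (p := fun p : R * R => p.1 + p.2)) => //; exact: measurable_addR.
Qed.

Let bm_lag1 y u : bm y -> bm (fun th : measurableTypeR R => y (u + th)).
Proof.
move=> by_; apply: (@bm_comp _ _ _ _ _ (fun p : R * measurableTypeR R => y (p.1 + p.2)) (pair u)).
- exact: pair1_measurable.
- exact: bm_lag.
Qed.

Lemma bm_lag_mean y : bm y -> bm (lag_mean y).
Proof.
move=> by_; exact: (@bm_Rintegral R _ _ _ _ nu I (fun p : R * measurableTypeR R => `|y (p.1 + p.2)|)
  mI nu_fin (bm_norm (bm_lag by_))).
Qed.

Lemma bm_lag_energy y : bm y -> bm (lag_energy y).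
Proof.
move=> by_; exact: (@bm_Rintegral R _ _ _ _ nu I (fun p : R * measurableTypeR R => y (p.1 + p.2) ^+ 2)
  mI nu_fin (bmX2 (bm_lag by_))).
Qed.

Lemma lag_mean_ge0 y u : 0 <= lag_mean y u.
Proof. by apply: Rintegral_ge0. Qed.

Lemma lag_energy_ge0 y u : 0 <= lag_energy y u.
Proof. by apply: Rintegral_ge0 => th _; exact: sqr_ge0. Qed.

Lemma lag_mean_le y u B : bm y -> (forall v, `|y v| <= B) -> lag_mean y u <= G0 * B.
Proof.
move=> by_ yB; rewrite mulrC -nu_G0 -Rintegral_cst//; apply: le_Rintegral => //.
- by apply: bm_integrable => //; apply: bm_norm; exact: bm_lag1.
- by apply: bm_integrable => //; exact: bm_cst.
Qed.

(** By Fubini the energy of the path is averaged over its shifts into the past. *)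
Lemma itg_lag_energy_le y T delta : bm y -> 0 <= T ->
  (forall u, - H <= u -> u <= 0 -> `|y u| <= delta) ->
  itg (lag_energy y) 0 T <= G0 * itg (fun s => y s ^+ 2) 0 T + G0 * H * delta ^+ 2.
Proof.
move=> by_ T0 ydelta.
have bv : bm (fun s => y s ^+ 2) by exact: bmX2.
have H0 : 0 <= H by exact: le_trans tau_le.
have bl2 : bm (fun p : R * measurableTypeR R => y (p.1 + p.2) ^+ 2).
  by apply: bmX2; exact: bm_lag.
have -> : itg (lag_energy y) 0 T =
    \int[nu]_(th in I) itg (fun u => y (u + th) ^+ 2) 0 T.
  exact: (@Rintegral_Fubini R _ _ _ _ lebesgue_measure nu _ I (fun p => y (p.1 + p.2) ^+ 2)
    (measurable_itv _) mI (mu_oc_fin 0 T) nu_fin bl2).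
have bi : bm (fun th : measurableTypeR R => itg (fun u => y (u + th) ^+ 2) 0 T).
  apply: (@bm_Rintegral R _ _ _ _ lebesgue_measure `]0, T]%classic
    (fun p : measurableTypeR R * R => y (p.2 + p.1) ^+ 2)) => //; first exact: mu_oc_fin.
  apply: (@bm_comp _ _ _ _ _ (fun p : R * measurableTypeR R => y (p.1 + p.2) ^+ 2)
    (fun p : measurableTypeR R * R => (p.2, p.1))) => //; exact: measurable_swap.
rewrite (_ : G0 * _ + _ = (itg (fun s => y s ^+ 2) 0 T + H * delta ^+ 2) * fine (nu I)); last first.
  by rewrite nu_G0; ring.
rewrite -Rintegral_cst//; apply: le_Rintegral => //.
- by apply: bm_integrable.
- by apply: bm_integrable => //; exact: bm_cst.
move=> th /=; rewrite in_itv/= => /andP[Hth th0].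
rewrite (itg_shift _ _ _ bv) add0r.
apply: (@le_trans _ _ (itg (fun s => y s ^+ 2) th T)).
  rewrite [leRHS](@itg_split _ _ th (T + th) T)//; last 2 first.
  - by rewrite lerDr.
  - by rewrite gerDl.
  by rewrite lerDl itg_ge0// => u _ _; exact: sqr_ge0.
rewrite (itg_split bv th0 T0) addrC lerD2l.
apply: (@le_trans _ _ (delta ^+ 2 * (0 - th))).
  apply: itg_le_cst => // u thu u0; have hu : - H <= u by exact: le_trans Hth (ltW thu).
  rewrite -(real_normK (num_real (y u))) lerXn2r ?nnegrE ?ydelta//.
  by rewrite (le_trans (normr_ge0 (y u)))// ydelta.
by rewrite mulrC ler_wpM2r ?sqr_ge0//; lra.
Qed.

(** Apply [neutral_cross] to each lag and integrate over the lags. *)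
Lemma lag_cross y u : bm y -> 2 * `|y u - memory y u| * lag_mean y u <=
  G0 * (y u ^+ 2 + rho_energy y u) + (1 + rho_mass u) * lag_energy y u.
Proof.
move=> by_; have b1 := bm_lag1 u by_.
rewrite /lag_mean -RintegralZl//; last by apply: bm_integrable => //; exact: bm_norm.
rewrite (mulrC G0) -nu_G0 -Rintegral_cst// /lag_energy -RintegralZl//; last first.
  by apply: bm_integrable => //; exact: bmX2.
rewrite -RintegralD//; last 2 first.
- by apply: bm_integrable => //; exact: bm_cst.
- by apply: bm_integrable => //; apply: bmM; [exact: bm_cst|exact: bmX2].
apply: le_Rintegral => //.
- by apply: bm_integrable => //; apply: bmM; [exact: bm_cst|exact: bm_norm].
- by apply: bm_integrable => //; apply: bmD; [exact: bm_cst|apply: bmM; [exact: bm_cst|exact: bmX2]].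
by move=> th _; exact: neutral_cross.
Qed.

(** Where the path is small, [|x|^alpha <= kappa |x|] with a small [kappa]: the
    nonlinearity adds [2 kappa |z|] times the mean of the path over the lags, which the
    margin [c0] of the criterion absorbs. *)
Lemma path_energy_bound : exists kappa0 C, [/\ 0 < kappa0, 0 <= C &
  forall (y : R -> R) (kappa T delta : R), bm y ->
    0 <= kappa <= kappa0 -> 0 <= T ->
    (forall u, - H <= u -> u <= 0 -> `|y u| <= delta) ->
    itg (fun s => - 2 * (y s - memory y s) * linear_drift y s
      + 2 * kappa * `|y s - memory y s| * lag_mean y s
      + sigma s ^+ 2 * y (s - tau) ^+ 2) 0 T
    <= C * delta ^+ 2].
Proof.
have [kappa0 [C [k0 C0 HC]]] := lyapunov_bound.
exists kappa0, C; split => // y kappa T delta by_ kap T0 yd.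
have := HC y (lag_energy y) kappa T delta by_ (bm_lag_energy by_)
  (lag_energy_ge0 y) kap T0 yd (itg_lag_energy_le by_ T0 yd).
apply: le_trans.
have bl := bm_lag_mean by_; have be := bm_lag_energy by_.
have bm' := bm_memory by_; have bd := bm_linear_drift by_.
have br := bm_rho_energy by_; have brm := bm_rho_mass.
have ydel : bm (fun s : R => y (s - tau)) by bm_solve.
apply: le_itg; [by bm_solve|by bm_solve|move=> s _ _].
have k0' : 0 <= kappa by case/andP: kap.
by have := ler_wpM2l k0' (lag_cross s by_); lra.
Qed.

End StieltjesTerm.

(** * The equation along one path *)

(** The constant depends neither on the path nor on the time, hence not on chance. *)
Definition path_bounded (D : (R -> R) -> R -> R) := exists2 c, 0 <= c &
  forall y B s, bm y -> (forall v, `|y v| <= B) -> `|D y s| <= c * B.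

Lemma path_boundedD D E : path_bounded D -> path_bounded E ->
  path_bounded (fun y s => D y s + E y s).
Proof.
move=> [c c_ge0 Dc] [e e0 Ee]; exists (c + e); first exact: addr_ge0.
by move=> y B s by_ yB; rewrite mulrDl (le_trans (ler_normD _ _))// lerD ?Dc ?Ee.
Qed.

Lemma path_bounded_sum m D :
  (forall k, (m <= k < n.+1)%N -> path_bounded (D k)) ->
  path_bounded (fun y s => \sum_(m <= k < n.+1) D k y s).
Proof.
move=> bD; rewrite /path_bounded.
elim: n bD => [|l IH] bD.
  have [m0|m0] := posnP m; last first.
    by exists 0 => // y B s _ _; rewrite big_geq// normr0 mul0r.
  have [c c_ge0 Dc] := bD 0%N ltac:(by rewrite m0); exists c => // y B s by_ yB.
  by rewrite m0 big_nat1 Dc.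
have [|ml] := leqP m l.+1; last first.
  by exists 0 => // y B s _ _; rewrite big_geq// normr0 mul0r.
move=> ml; have [|c c_ge0 Dc] := IH.
  by move=> k /andP[mk kl]; apply: bD; rewrite mk ltnW.
have [e e0 De] := bD l.+1 ltac:(by rewrite ml ltnS leqnn).
exists (c + e); first exact: addr_ge0.
move=> y B s by_ yB; rewrite big_nat_recr//= mulrDl (le_trans (ler_normD _ _))//.
by rewrite lerD ?Dc ?De.
Qed.

Lemma path_bounded_delay f h : bm f -> path_bounded (fun y s => f s * y (s - h)).
Proof.
move=> /bm_bound[M M0 fM]; exists M => // y B s _ yB.
by rewrite normrM ler_pM.
Qed.

Lemma path_bounded_window (q : R * R -> R) h : bm q -> 0 <= h ->
  path_bounded (fun y s => itg (fun u => q (s, u) * y u) (s - h) s).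
Proof.
move=> bq h0; have [M M0 qM] := bm_bound bq; exists (M * h); first exact: mulr_ge0.
move=> y B s by_ yB; rewrite mulrAC.
have sh : s - h <= s by rewrite gerBl.
have bqs := bm_sec1 s bq.
rewrite (_ : _ * h = M * B * (s - (s - h))); last by ring.
by apply: itg_norm_le; [exact: bmM|exact: sh|move=> u _ _; rewrite normrM ler_pM].
Qed.

Definition linear_part y s : R := \sum_(0 <= k < n.+1) a k s * y (s - hd k)
  + \sum_(1 <= k < n.+1) itg (fun u => b k u * y u) (s - hd k) s.

Lemma bm_linear_part y : bm y -> bm (linear_part y).
Proof. by move=> by_; rewrite /linear_part; bm_solve. Qed.

Let bounded_window_b k : (1 <= k <= n)%N ->
  path_bounded (fun y s => itg (fun u => b k u * y u) (s - hd k) s).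
Proof.
move=> kn; apply: (@path_bounded_window (fun p => b k p.2)); last exact: hd_ge0.
exact: bm_snd.
Qed.

Lemma path_bounded_linear_part : path_bounded linear_part.
Proof.
apply: path_boundedD; apply: path_bounded_sum => k kn; last exact: bounded_window_b.
exact: path_bounded_delay.
Qed.

Lemma path_bounded_linear_drift : path_bounded linear_drift.
Proof.
apply: path_boundedD; first apply: path_boundedD.
- have [c c_ge0 cP] := path_bounded_delay 0 bm_Ssum; exists c => // y B s by_ yB.
  by have := cP y B s by_ yB; rewrite subr0.
- by apply: path_bounded_sum => k _; exact: path_bounded_delay.
- apply: path_bounded_sum => k /andP[k2 kn]; apply: bounded_window_b.
  by apply/andP; split; [exact: leq_ltn_trans k2|rewrite -ltnS].
Qed.

Lemma memory_le y B u : bm y ->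
  (forall v, u - H <= v -> v <= u -> `|y v| <= B) -> `|memory y u| <= rho_mass u * B.
Proof.
move=> by_ yB; rewrite /memory /rho_mass (le_trans (ler_norm_sum _ _ _))// mulr_suml.
rewrite big_nat_cond [leRHS]big_nat_cond; apply: ler_sum => k; rewrite andbT => kn.
have br := bm_rho_sec k u.
rewrite (le_trans (itg_norm _ _ _))//; first by bm_solve.
rewrite -itgZr; last exact: bm_norm.
apply: le_itg; [by bm_solve|by bm_solve|move=> s us su].
rewrite normrM ler_wpM2l// yB//; rewrite (le_trans _ (ltW us))//.
by rewrite lerD2l lerN2 hd_le.
Qed.

Lemma memory_increment y s t : bm y -> 0 <= s -> s <= t ->
  memory y t - memory y s = itg (linear_drift y) s t - itg (linear_part y) s t.
Proof.
move=> by_ s0 st; have t0 := le_trans s0 st.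
have bl := bm_linear_drift by_; have bp := bm_linear_part by_.
have Et : itg (linear_part y) 0 t = _ := itg_drift by_ t0.
have Es : itg (linear_part y) 0 s = _ := itg_drift by_ s0.
move: Et Es; rewrite (itg_split bl s0 st) (itg_split bp s0 st).
by lra.
Qed.

(** By [memory_increment] the memory is the time integral of a quantity that is linear in
    the path. *)
Lemma memory_lipschitz : exists2 c, 0 <= c & forall y B s t, bm y ->
  (forall v, `|y v| <= B) -> 0 <= s -> s <= t ->
  `|memory y t - memory y s| <= c * B * (t - s).
Proof.
have [c c_ge0 cP] := path_bounded_linear_drift.
have [e e_ge0 eP] := path_bounded_linear_part.
exists (c + e); first exact: addr_ge0.
move=> y B s t by_ yB s0 st; rewrite memory_increment// !mulrDl.
rewrite (le_trans (ler_normB _ _))// lerD//.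
  by apply: itg_norm_le => // [|u _ _]; [exact: bm_linear_drift|exact: cP].
by apply: itg_norm_le => // [|u _ _]; [exact: bm_linear_part|exact: eP].
Qed.

Section PathEquation.
Local Notation mu := (@lebesgue_measure R).
Variable nu : {sigma_finite_measure set (measurableTypeR R) -> \bar R}.
Local Notation I := (`[(- H)%R, 0%R]%classic : set (measurableTypeR R)).
Hypothesis nu_fin : (nu I < +oo)%E.
Hypothesis nu_G0 : fine (nu I) = G0.
Variables (a' b' : nat -> R -> R) (g : R -> (R -> R) -> R) (alpha : R).
Hypothesis a'E : forall k t, (k <= n)%N -> 0 <= t -> a' k t = a k t.
Hypothesis b'E : forall k t, (1 <= k <= n)%N -> - H <= t -> b' k t = b k t.
Hypothesis HE : max_delay n hd tau = H.
Hypothesis alpha_gt1 : 1 < alpha.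
Hypothesis g_growth : forall t (f : R -> R), 0 <= t ->
  measurable_fun (`[- max_delay n hd tau, 0] : set R) f ->
  (`|g t (f \_ `[(- max_delay n hd tau)%R, 0%R])|%:E <=
     \int[nu]_(s in `[(- max_delay n hd tau)%R, 0%R]) (`|f s| `^ alpha)%:E)%E.

Let hd_range k : (k <= n)%N -> 0 <= hd k <= H.
Proof.
case: k => [_|k kn]; first by rewrite hd0 lexx (le_trans _ tau_le).
by rewrite hd_ge0// hd_le.
Qed.

(** [|y|^alpha <= B^(alpha - 1) |y|] if [|y| <= B]. *)
Lemma nonlinearity_le (xi y : R -> R) (B u : R) : bm y -> (forall v, `|y v| <= B) -> 0 <= u ->
  (forall v, - H <= v -> v <= u -> xi v = y v) ->
  `|g u (segment n hd tau xi u)| <= B `^ (alpha - 1) * lag_mean nu y u.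
Proof.
move=> by_ yB u0 xiy.
have B0 : 0 <= B by rewrite (le_trans _ (yB 0)).
have bl : bm (fun th : measurableTypeR R => y (u + th)).
  by have := bm_shift u by_; apply: bm_ext => th; rewrite addrC.
have segE : segment n hd tau xi u = (fun th => y (u + th)) \_ `[(- max_delay n hd tau), 0].
  apply/funext => th; rewrite /segment !patchE; case: ifPn => //.
  rewrite inE/= in_itv/= HE => /andP[Hth th0]; rewrite xiy//; last by rewrite gerDl.
  by rewrite (le_trans Hth)// lerDr.
rewrite segE.
have mf : measurable_fun (`[- max_delay n hd tau, 0] : set R) (fun th => y (u + th)).
  by apply: measurable_funTS; exact: bl.1.
rewrite -lee_fin (le_trans (g_growth u0 mf))// HE.
have i1 : nu.-integrable I (EFin \o (fun th => B `^ (alpha - 1) * `|y (u + th)|)).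
  by apply: bm_integrable => //; apply: bmM; [exact: bm_cst|exact: bm_norm].
rewrite /lag_mean -RintegralZl//; last by apply: bm_integrable => //; exact: bm_norm.
rewrite /Rintegral fineK; last exact: integrable_fin_num.
apply: ge0_le_integral => //.
- apply/measurable_EFinP; apply: measurable_funTS.
  by apply: (measurableT_comp (measurable_powR alpha)); apply: measurableT_comp => //; exact: bl.1.
- by apply/measurable_EFinP; apply: measurable_funTS; apply: measurable_realfun.measurable_funM => //;
    apply: measurableT_comp => //; exact: bl.1.
move=> th _; rewrite lee_fin.
have [->|y0] := eqVneq (y (u + th)) 0.
  by rewrite normr0 mulr0 powR0// gt_eqF// (lt_trans ltr01).
have -> : `|y (u + th)| `^ alpha = `|y (u + th)| `^ (alpha - 1) * `|y (u + th)|.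
  rewrite -[X in _ = _ * X]powRr1// -powRD ?subrK//.
  by rewrite normr_eq0 y0 implybT.
by rewrite ler_wpM2r// ge0_ler_powR// ?nnegrE// subr_ge0 ltW.
Qed.

(** The memory is chosen so that its motion turns the delayed drift of the equation into
    [linear_drift]; what remains is the integral of the nonlinearity.  The path [xi] of
    the solution may be replaced by any bounded [y] that agrees with it so far. *)
Lemma neutral_increment (xi y : R -> R) (B s t p0 Zs Zt : R) : bm y -> (forall v, `|y v| <= B) ->
  0 <= s -> s <= t -> (forall v, - H <= v -> v <= t -> xi v = y v) ->
  mu.-integrable `[0, t] (fun u => (g u (segment n hd tau xi u))%:E) ->
  xi s + \int[mu]_(u in `[0, s]) drift n hd tau a' b' g xi u + Zs = p0 ->
  xi t + \int[mu]_(u in `[0, t]) drift n hd tau a' b' g xi u + Zt = p0 ->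
  `|(y t - memory y t) - (y s - memory y s) + (Zt - Zs) + itg (linear_drift y) s t|
    <= B `^ (alpha - 1) * itg (lag_mean nu y) s t.
Proof.
move=> by_ yB s0 st xiy ig Es Et.
have t0 := le_trans s0 st.
have Ht : - H <= t by rewrite (le_trans _ t0)// oppr_le0 (le_trans _ tau_le).
have Hs : - H <= s by rewrite (le_trans _ s0)// oppr_le0 (le_trans _ tau_le).
have bp := bm_linear_part by_; have bl := bm_linear_drift by_.
pose G u := g u (segment n hd tau xi u).
have iG v : 0 <= v -> v <= t -> mu.-integrable `[0, v] (EFin \o G).
  move=> v0 vt; apply: integrableS ig => //.
  by move=> r/=; rewrite !in_itv/= => /andP[-> /le_trans->].
have driftE u : 0 <= u -> u <= t -> drift n hd tau a' b' g xi u = linear_part y u + G u.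
  move=> u0 ut; rewrite /drift /linear_part; congr (_ + _ + _).
    rewrite big_nat_cond [RHS]big_nat_cond; apply: eq_bigr => k; rewrite andbT => kn.
    have /andP[h0 hH] := hd_range (kn : (k <= n)%N).
    rewrite a'E// xiy//; last by rewrite (le_trans _ ut)// gerBl.
    by rewrite (@le_trans _ _ (0 - hd k))// ?lerD2r// sub0r lerN2.
  rewrite big_nat_cond [RHS]big_nat_cond; apply: eq_bigr => k; rewrite andbT => kn.
  rewrite -itg_cc; last exact: bmM.
  apply: eq_Rintegral => v; rewrite inE/= in_itv/= => /andP[kv vu].
  have Hv : - H <= v.
    rewrite (le_trans _ kv)// (@le_trans _ _ (0 - hd k))// ?lerD2r// sub0r lerN2.
    exact: hd_le.
  by rewrite b'E// xiy// (le_trans vu).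
have intE v : 0 <= v -> v <= t -> \int[mu]_(u in `[0, v]) drift n hd tau a' b' g xi u =
    itg (linear_part y) 0 v + \int[mu]_(u in `[0, v]) G u.
  move=> v0 vt; rewrite -(itg_cc 0 v bp).
  rewrite -RintegralD; [|exact: measurable_itv|exact: bm_integrable_cc|exact: iG].
  apply: eq_Rintegral => u; rewrite inE/= in_itv/= => /andP[u0 uv].
  by rewrite driftE// (le_trans uv).
have GE : \int[mu]_(u in `[0, t]) G u - \int[mu]_(u in `[0, s]) G u =
    \int[mu]_(u in `]s, t]) G u.
  rewrite (@Rintegral_itvB R G (BLeft 0) (BRight t) s)//; exact: iG.
have iGst : mu.-integrable `]s, t] (EFin \o G).
  apply: integrableS (iG t t0 (lexx _)) => //.
  by move=> r/=; rewrite !in_itv/= => /andP[/ltW/(le_trans s0)-> ->].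
have Gle : `|\int[mu]_(u in `]s, t]) G u| <= B `^ (alpha - 1) * itg (lag_mean nu y) s t.
  have bm1 := bm_lag_mean nu_fin by_.
  rewrite -itgZl// (le_trans (le_normr_Rintegral _ _))//.
  apply: le_Rintegral => //.
  - by have := integrable_abse iGst; apply: eq_integrable.
  - by apply: bm_integrable_oc; apply: bmM => //; exact: bm_cst.
  move=> u /=; rewrite in_itv/= => /andP[su ut].
  apply: nonlinearity_le => //; first by rewrite (le_trans s0)// ltW.
  by move=> v Hv vu; rewrite xiy// (le_trans vu).
apply: le_trans Gle; rewrite -GE -[leRHS]normrN le_eqVlt; apply/predU1P; left; congr `|_|.
move: Es Et; rewrite !intE ?(xiy s Hs st) ?(xiy t Ht)// => Es Et.
have := memory_increment by_ s0 st.
rewrite -(_ : itg (linear_part y) 0 t - itg (linear_part y) 0 s = itg (linear_part y) s t).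
  by lra.
by rewrite (itg_split bp s0 st); ring.
Qed.
End PathEquation.

(** * The energy estimate on a grid *)

Section GridSums.
Variables (Delta : R) (Delta_ge0 : 0 <= Delta).
Local Notation tt i := (i%:R * Delta).

Let tt_ge0 i : 0 <= tt i. Proof. by rewrite mulr_ge0. Qed.

Let ttS i : tt i <= tt i.+1. Proof. by rewrite ler_wpM2r// ler_nat. Qed.

Lemma itg_grid f N : bm f -> \sum_(i < N) itg f (tt i) (tt i.+1) = itg f 0 (tt N).
Proof.
move=> bf; elim: N => [|N IH].
  by rewrite big_ord0 mul0r /itg set_itvoc0// Rintegral_set0.
by rewrite big_ord_recr/= IH -(itg_split bf).
Qed.

(** Complete the square: [2 z D + D ^ 2 = (z + D) ^ 2 - z ^ 2], so that the sums of
    these terms telescope when [D] is the increment of [z]. *)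
Lemma square_telescope (z D : nat -> R) (N : nat) (B eta : R) :
  (forall i, (i <= N)%N -> `|z i| <= B) ->
  (forall i, (i < N)%N -> `|D i - (z i.+1 - z i)| <= eta) ->
  z N ^+ 2 - z 0%N ^+ 2 - N%:R * (2 * B * eta) <= \sum_(i < N) (2 * z i * D i + D i ^+ 2).
Proof.
elim: N => [|N IH] zB De; first by rewrite big_ord0 mul0r subr0 subrr.
rewrite big_ord_recr/=.
have {}IH := IH (fun i iN => zB i (leqW iN)) (fun i iN => De i (leqW iN)).
have := De N (ltnSn N); have zN := zB N.+1 (leqnn _).
set e := D N - _ => eeta.
have -> : 2 * z N * D N + D N ^+ 2 = z N.+1 ^+ 2 - z N ^+ 2 + 2 * (z N.+1 * e) + e ^+ 2.
  by rewrite /e; ring.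
have : - (B * eta) <= z N.+1 * e.
  have : `|z N.+1 * e| <= B * eta by rewrite normrM ler_pM.
  by rewrite ler_norml => /andP[].
have := sqr_ge0 e; rewrite -[N.+1]addn1 natrD mulrDl mul1r.
by move: IH; lra.
Qed.

End GridSums.

Section PathEnergy.
Variable nu : {sigma_finite_measure set (measurableTypeR R) -> \bar R}.
Local Notation I := (`[(- H)%R, 0%R]%classic : set (measurableTypeR R)).
Hypothesis nu_fin : (nu I < +oo)%E.
Hypothesis nu_G0 : fine (nu I) = G0.

Definition neutral y u : R := y u - memory y u.

(** A discretized form of [path_energy_bound]: the neutral variable is frozen at the
    grid points and its drift is replaced by quantities [h i] which are only known up
    to the size of the nonlinearity. *)
Definition grid_energy_estimate (kappa0 C E : R) : Prop :=
  forall (y : R -> R) (h : nat -> R) (N : nat) (kappa Delta delta eta B : R), bm y ->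
    (forall v, `|y v| <= B) -> 0 <= kappa <= kappa0 -> 0 <= Delta -> 0 <= eta ->
    (forall u, - H <= u -> u <= 0 -> `|y u| <= delta) ->
    (forall i s, (i < N)%N -> i%:R * Delta <= s -> s <= i.+1%:R * Delta ->
      `|y s - y (i%:R * Delta)| <= eta) ->
    (forall i, (i < N)%N ->
      `|h i - itg (linear_drift y) (i%:R * Delta) (i.+1%:R * Delta)| <=
      kappa * itg (lag_mean nu y) (i%:R * Delta) (i.+1%:R * Delta)) ->
    \sum_(i < N) (- 2 * neutral y (i%:R * Delta) * h i
      + itg (fun s => sigma s ^+ 2 * y (s - tau) ^+ 2) (i%:R * Delta) (i.+1%:R * Delta))
    <= C * delta ^+ 2 + E * B * (eta + B * Delta) * (N%:R * Delta).

Lemma grid_energy_bound : exists kappa0 C E,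
  [/\ 0 < kappa0, 0 <= C, 0 <= E & grid_energy_estimate kappa0 C E].
Proof.
have [kappa0 [C [k0 C0 HC]]] := path_energy_bound nu_fin nu_G0.
have [cL cL0 HL] := path_bounded_linear_drift.
have [cM cM0 HM] := memory_lipschitz.
pose E1 := 2 * (cL + kappa0 * G0).
have E10 : 0 <= E1 by rewrite mulr_ge0// addr_ge0// mulr_ge0// ltW.
exists kappa0, C, (E1 * (1 + cM)); split => //; first by rewrite mulr_ge0// addr_ge0.
move=> y h N kappa Delta delta eta B by_ yB kap D0 eta0 yd osc hL.
have /andP[kap0 kap1] := kap.
have B0 : 0 <= B by rewrite (le_trans _ (yB 0)).
have bL := bm_linear_drift by_; have bW := bm_lag_mean nu_fin by_.
have bM := bm_memory by_.
have byt : bm (fun s : R => y (s - tau)) by bm_solve.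
have t0 i : 0 <= i%:R * Delta by rewrite mulr_ge0.
have tS i : i%:R * Delta <= i.+1%:R * Delta by rewrite ler_wpM2r// ler_nat.
pose f s := - 2 * (y s - memory y s) * linear_drift y s
      + 2 * kappa * `|y s - memory y s| * lag_mean nu y s
      + sigma s ^+ 2 * y (s - tau) ^+ 2.
have bf : bm f by rewrite /f; bm_solve.
have fC : itg f 0 (N%:R * Delta) <= C * delta ^+ 2 by apply: HC.
have fE s : f s = - 2 * (y s - memory y s) * linear_drift y s
  + 2 * kappa * `|y s - memory y s| * lag_mean nu y s + sigma s ^+ 2 * y (s - tau) ^+ 2 by [].
clearbody f.
pose e1 := E1 * (1 + cM) * B * (eta + B * Delta).
apply: (@le_trans _ _ (\sum_(i < N) (itg f (i%:R * Delta) (i.+1%:R * Delta) + e1 * Delta))).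
  apply: ler_sum => i _; set s0 := i%:R * Delta; set s1 := i.+1%:R * Delta.
  have s01 : s0 <= s1 by exact: tS.
  set z := neutral y s0.
  have bq : bm (fun s : R => sigma s ^+ 2 * y (s - tau) ^+ 2) by bm_solve.
  have h1 : - 2 * z * h i <=
      itg (fun s => - 2 * z * linear_drift y s + 2 * kappa * `|z| * lag_mean nu y s) s0 s1.
    rewrite itgD; [|by bm_solve|by bm_solve]; rewrite !itgZl//.
    have := hL i (ltn_ord i); rewrite -/s0 -/s1.
    set HL' := itg (linear_drift y) s0 s1; set W' := itg _ _ _ => hle.
    have : - (z * (h i - HL')) <= `|z| * (kappa * W').
      by rewrite -mulNr (le_trans (ler_norm _))// normrM normrN ler_wpM2l.
    by lra.
  rewrite -lerBrDr; apply: (le_trans h1).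
  have -> : itg f s0 s1 + e1 * Delta - itg (fun s => sigma s ^+ 2 * y (s - tau) ^+ 2) s0 s1 =
      itg (fun s => f s - sigma s ^+ 2 * y (s - tau) ^+ 2 + e1) s0 s1.
    rewrite itgD; [|exact: bmB|exact: bm_cst]; rewrite itgB// itg_cst//.
    by rewrite (_ : s1 - s0 = Delta); [ring|rewrite /s1 /s0 -natr1; ring].
  apply: le_itg; [by bm_solve|by apply: bmD; [exact: bmB|exact: bm_cst]|move=> s ss0 ss1].
  rewrite fE addrK.
  have Ls := HL y B s by_ yB.
  have Ws := lag_mean_le nu_fin nu_G0 s by_ yB.
  have W0 := lag_mean_ge0 nu y s.
  have dz : `|z - (y s - memory y s)| <= (1 + cM) * (eta + B * Delta).
    have o1 := osc i s (ltn_ord i) (ltW ss0) ss1.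
    have o2 := HM y B s0 s by_ yB (t0 i) (ltW ss0).
    have -> : z - (y s - memory y s) = (memory y s - memory y s0) - (y s - y s0).
      by rewrite /z /neutral; ring.
    rewrite (le_trans (ler_normB _ _))//.
    have : cM * B * (s - s0) <= cM * B * Delta.
      rewrite ler_wpM2l ?mulr_ge0//.
      have : s1 - s0 = Delta by rewrite /s1 /s0 -natr1; ring.
      by lra.
    have : 0 <= cM * eta by rewrite mulr_ge0.
    have : 0 <= B * Delta by rewrite mulr_ge0.
    by move: o1 o2; rewrite -/s0; lra.
  set zs := y s - memory y s in dz *; set g := (1 + cM) * _ in dz.
  have g0 : 0 <= g by exact: le_trans dz.
  have zz : `|z| <= `|zs| + g.
    by have := ler_normD zs (z - zs); rewrite addrCA subrr addr0 => /le_trans; apply; rewrite lerD2l.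
  have i1 : - ((z - zs) * linear_drift y s) <= g * (cL * B).
    by rewrite -mulNr (le_trans (ler_norm _))// normrM normrN ler_pM.
  have i2 : kappa * `|z| * lag_mean nu y s <=
      kappa * `|zs| * lag_mean nu y s + kappa0 * (g * (G0 * B)).
    have : kappa * (`|z| * lag_mean nu y s) <= kappa * ((`|zs| + g) * lag_mean nu y s).
      by rewrite ler_wpM2l// ler_wpM2r.
    have : kappa * (g * lag_mean nu y s) <= kappa0 * (g * (G0 * B)).
      by apply: ler_pM => //; [exact: mulr_ge0|exact: ler_wpM2l].
    by lra.
  have -> : e1 = 2 * (g * (cL * B)) + 2 * (kappa0 * (g * (G0 * B))).
    by rewrite /e1 /g /E1; ring.
  by lra.
rewrite big_split/= itg_grid// lerD//.
by rewrite sumr_const card_ord -[leLHS]mulr_natl /e1 mulrCA (mulrC _ Delta) mulrA (mulrC Delta).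
Qed.

End PathEnergy.

(** * The truncated solution *)

Section Solution.
Local Notation mu := (@lebesgue_measure R).
Context {d : measure_display} {Omega : measurableType d}.
Variables (P : probability Omega R) (F : R -> set_system Omega).
Hypothesis F_filtration : is_filtration F.
Variable w : R -> Omega -> R.
Hypothesis w_wiener : is_wiener P F w.
Variable nu : {sigma_finite_measure set (measurableTypeR R) -> \bar R}.
Local Notation I := (`[(- H)%R, 0%R]%classic : set (measurableTypeR R)).
Hypothesis nu_fin : (nu I < +oo)%E.
Hypothesis nu_G0 : fine (nu I) = G0.
Variables (a' b' : nat -> R -> R) (sigma' : R -> R).
Variables (g : R -> (R -> R) -> R) (alpha : R).
Hypothesis a'E : forall k t, (k <= n)%N -> 0 <= t -> a' k t = a k t.
Hypothesis b'E : forall k t, (1 <= k <= n)%N -> - H <= t -> b' k t = b k t.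
Hypothesis sigma'E : forall t, 0 <= t -> sigma' t = sigma t.
Hypothesis HE : max_delay n hd tau = H.
Hypothesis alpha_gt1 : 1 < alpha.
Hypothesis g_growth : forall t (f : R -> R), 0 <= t ->
  measurable_fun (`[- max_delay n hd tau, 0] : set R) f ->
  (`|g t (f \_ `[(- max_delay n hd tau)%R, 0%R])|%:E <=
     \int[nu]_(s in `[(- max_delay n hd tau)%R, 0%R]) (`|f s| `^ alpha)%:E)%E.

Section OneSolution.
Variables (phi x : R -> Omega -> R).
Hypothesis phi_H2 : in_H2 P F n hd tau phi.
Hypothesis x_sol : is_solution P F w n hd tau a' b' sigma' g phi x.
Variables (B : R) (B_ge0 : 0 <= B) (T : nat).

Let H_ge0 : 0 <= H. Proof. exact: le_trans tau_le. Qed.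

Let sF t : 0 <= t -> sigma_algebra setT (F t).
Proof. by case: F_filtration => + _ _; exact. Qed.

Let Fm t : 0 <= t -> F t `<=` measurable.
Proof. by case: F_filtration => _ + _; exact. Qed.

Let Fle s t : 0 <= s -> s <= t -> F s `<=` F t.
Proof. by case: F_filtration => _ _; exact. Qed.

Let x_phi s omega : - H <= s -> s <= 0 -> x s omega = phi s omega.
Proof.
by move=> Hs s0; case: x_sol => + _ _ _ _; apply; rewrite in_itv/= HE Hs.
Qed.

Let x_adapted t : 0 <= t -> sub_measurable (F t) (x t).
Proof. by case: x_sol => _ [+ _] _ _ _; exact. Qed.

Let x_continuous omega : {within `[0, +oo[, continuous (x ^~ omega)}.
Proof. by case: x_sol => _ [_ +] _ _ _; exact. Qed.

(** A bounded process that agrees with the solution up to time [T] or to the exit from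
    [[-B, B]], so that all expectations below exist. *)
Definition clipped_solution (p : R * Omega) : R :=
  clip B (x p.1 p.2) * \1_(`[0, T%:R]%classic) p.1
  + (fun p => clip B (phi p.1 p.2)) \_ (`[- H, 0] `*` setT) p * \1_(`[- H, 0[%classic) p.1.

Lemma clipped_solutionE s omega : - H <= s -> s <= T%:R ->
  clipped_solution (s, omega) = clip B (x s omega).
Proof.
move=> Hs sT; rewrite /clipped_solution/= !indicE !mem_setE !in_itv/= Hs sT andbT/=.
have [s0|s0] := leP 0 s; first by rewrite mulr1 mulr0 addr0.
rewrite mulr0 mulr1 add0r patchE ifT; last by rewrite inE; split => //=; rewrite in_itv/= Hs ltW.
by rewrite x_phi// ltW.
Qed.

Lemma clipped_solution_out s omega : ~ (- H <= s <= T%:R) -> clipped_solution (s, omega) = 0.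
Proof.
move=> Hs; rewrite /clipped_solution/= !indicE !mem_setE !in_itv/=.
rewrite (_ : 0 <= s <= T%:R = false) ?mulr0 ?add0r; last first.
  by apply/negP => /andP[s0 sT]; apply: Hs; rewrite sT (le_trans _ s0)// oppr_le0.
rewrite (_ : - H <= s < 0 = false) ?mulr0//.
by apply/negP => /andP[Hs' s0]; apply: Hs; rewrite Hs'/= (le_trans (ltW s0)).
Qed.

Lemma clipped_solution_le p : `|clipped_solution p| <= B.
Proof.
case: p => s omega; have [/andP[Hs sT]|Hs] := pselect (- H <= s <= T%:R).
  by rewrite clipped_solutionE// clip_le.
by rewrite clipped_solution_out// normr0.
Qed.

Lemma bm_clipped_solution : bm clipped_solution.
Proof.
apply: bmD.
  exact: (bm_clipped_path F_filtration x_adapted x_continuous T%:R B_ge0).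
apply: bmM; last by apply: bm_fst; apply: bm_indic; exact: measurable_itv.
case: phi_H2 => mphi _ _; rewrite HE in mphi.
apply: (bm_patch (M := B)).
- exact: measurableX.
- by apply: measurableT_comp => //; exact: measurable_clip.
- by move=> p _; exact: clip_le.
Qed.

Lemma clipped_solution_adapted s t : s <= t -> 0 <= t ->
  sub_measurable (F t) (fun omega => clipped_solution (s, omega)).
Proof.
move=> st t0; have [/andP[Hs sT]|Hs] := pselect (- H <= s <= T%:R); last first.
  rewrite (_ : (fun _ => _) = fun=> 0).
    exact: (@sub_measurable_cst _ _ _ _ (sF t0)).
  by apply/funext => omega; rewrite clipped_solution_out.
rewrite (_ : (fun _ => _) = clip B \o x s); last first.
  by apply/funext => omega; rewrite clipped_solutionE.
apply: (@sub_measurable_comp _ _ _ _ (sF t0) (clip B)); first exact: measurable_clip.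
have [s0|s0] := leP 0 s.
  by apply: (sub_measurableW (Fle s0 st)); exact: x_adapted.
rewrite (_ : x s = phi s); last by apply/funext => omega; rewrite x_phi// ltW.
apply: (sub_measurableW (Fle (lexx 0) t0)).
by case: phi_H2 => _ + _; apply; rewrite in_itv/= HE Hs ltW.
Qed.

Definition solution_path omega : R -> R := fun s => clipped_solution (s, omega).

Lemma bm_solution_path omega : bm (solution_path omega).
Proof. exact: bm_sec bm_clipped_solution. Qed.

Lemma bm_solution_memory k t :
  bm (fun p : R * Omega => rho k t p.1 * clipped_solution p).
Proof. by apply: bmM bm_clipped_solution; apply: bm_fst; exact: bm_rho_sec. Qed.

Lemma bm_neutral_solution t : bm (fun omega => neutral (solution_path omega) t).
Proof.
apply: bmB.
  by apply: bm_comp bm_clipped_solution; exact: pair1_measurable.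
by apply: bm_sum => k _; exact: (bm_itg_path _ _ (bm_solution_memory k t)).
Qed.

(** The neutral variable involves the path at all times before [s]: it is handled
    one time at a time, by Fubini, so that joint measurability is enough. *)
Lemma neutral_martingale (Y : simple_process F) (A : set Omega) s t :
  0 <= s -> s < t -> F s A ->
  \int[P]_omega (\1_A omega * neutral (solution_path omega) s *
    (sp_integral w Y t omega - sp_integral w Y s omega)) = 0.
Proof.
move=> s0 st FA; have mA : measurable A by exact: Fm FA.
have b1 : bm (\1_A : Omega -> R) by exact: bm_indic.
have F1 : sub_measurable (F s) (\1_A : Omega -> R).
  exact: (@sub_measurable_indic _ _ _ _ (sF s0)).
pose J omega := sp_integral w Y t omega - sp_integral w Y s omega.
have [iW _] := sp_increment0 F_filtration w_wiener Y s0 st F1 b1.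
pose W omega := \1_A omega * J omega.
have {}iW : P.-integrable setT (EFin \o W) by exact: iW.
have zero u : u <= s -> \int[P]_omega (W omega * clipped_solution (u, omega)) = 0.
  move=> us; have FX := clipped_solution_adapted us s0.
  have bX : bm (fun omega => clipped_solution (u, omega)).
    by apply: bm_comp bm_clipped_solution; exact: pair1_measurable.
  have F1X : sub_measurable (F s) (fun omega => \1_A omega * clipped_solution (u, omega)).
    exact: (@sub_measurableM _ _ _ _ (sF s0)).
  have [_ <-] := sp_increment0 F_filtration w_wiener Y s0 st F1X (bmM b1 bX).
  by apply: eq_Rintegral => omega _; rewrite /W /J; ring.
have E omega : \1_A omega * neutral (solution_path omega) s * J omega =
    W omega * clipped_solution (s, omega) - \sum_(1 <= k < n.+1)
      W omega * itg (fun u => rho k s u * clipped_solution (u, omega)) (s - hd k) s.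
  by rewrite -mulr_sumr /neutral /memory /solution_path /W; ring.
rewrite (eq_Rintegral _ (fun omega _ => E omega)).
have iX u : P.-integrable setT (EFin \o (fun omega => W omega * clipped_solution (u, omega))).
  have bX : bm (fun omega => clipped_solution (u, omega)).
    by apply: bm_comp bm_clipped_solution; exact: pair1_measurable.
  by have := bm_integrableM bX iW; apply: eq_integrable => // omega _ /=; rewrite mulrC.
have iI k : P.-integrable setT (EFin \o (fun omega =>
    W omega * itg (fun u => rho k s u * clipped_solution (u, omega)) (s - hd k) s)).
  have := bm_integrableM (bm_itg_path (s - hd k) s (bm_solution_memory k s)) iW.
  by apply: eq_integrable => // omega _ /=; rewrite mulrC.
have zI k : \int[P]_omega (W omega *
    itg (fun u => rho k s u * clipped_solution (u, omega)) (s - hd k) s) = 0.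
  rewrite (Rintegral_itg_weight (s - hd k) s iW (bm_solution_memory k s))/=.
  rewrite -[RHS](itg0 (s - hd k) s); apply: eq_itg => u _ us.
  rewrite -[RHS](mulr0 (rho k s u)) -(zero u us) -RintegralZl//.
  by apply: eq_Rintegral => omega _; ring.
have [iS zS] := integrable_sum0 (index_iota 1 n.+1) iI zI.
by rewrite RintegralB// zero// zS subrr.
Qed.

(** * One outcome on a grid *)

Section PathAtGrid.
Variables (K delta eta Delta r cf : R) (Z : nat -> Omega -> R) (N N0 : nat) (omega : Omega).
Hypothesis K_gt0 : 0 < K.
Hypothesis BK : B = 2 * K.
Hypothesis delta_ge0 : 0 <= delta.
Hypothesis delta_le : delta <= K.
Hypothesis eta_ge0 : 0 <= eta.
Hypothesis eta_le : eta <= K.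
Hypothesis Delta_gt0 : 0 < Delta.
Hypothesis Delta_le : Delta <= N0.+1%:R^-1.
Hypothesis N_Delta : N%:R * Delta = T%:R.
Hypothesis rho_mass_le : forall u, 0 <= u -> rho_mass u <= r.
Hypothesis r_lt1 : r < 1.
Local Notation tt i := (i%:R * Delta).
Local Notation y := (solution_path omega).
Local Notation kappa := (B `^ (alpha - 1)).

(* The rate at which the drift and the nonlinearity can move the neutral variable. *)
Hypothesis cf_rate : forall s t, 0 <= s -> s <= t ->
  `|itg (linear_drift y) s t| + kappa * itg (lag_mean nu y) s t <= cf * (t - s).

Hypothesis initial_le : forall u, - H <= u -> u <= 0 -> `|x u omega| <= delta.
Hypothesis g_integrable : forall t, 0 <= t ->
  mu.-integrable `[0, t] (fun u => (g u (segment n hd tau (x ^~ omega) u))%:E).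
Hypothesis equation : forall i, x (tt i) omega
  + \int[mu]_(u in `[0, tt i]) drift n hd tau a' b' g (x ^~ omega) u + Z i omega = phi 0 omega.

Let tt_ge0 i : 0 <= tt i. Proof. by rewrite mulr_ge0// ltW. Qed.

Let ttS i : tt i <= tt i.+1. Proof. by apply: ler_wpM2r; [exact: ltW|rewrite ler_nat]. Qed.

Let tt_le i j : (i <= j)%N -> tt i <= tt j.
Proof. by move=> ij; apply: ler_wpM2r; [exact: ltW|rewrite ler_nat]. Qed.

Let ttT i : (i <= N)%N -> tt i <= T%:R.
Proof. by move=> iN; rewrite -N_Delta tt_le. Qed.

Let stays_le C s t : s <= t -> stays x C t omega -> stays x C s omega.
Proof.
move=> st /(staysP x_continuous) H0; apply/(staysP x_continuous) => u u0 us.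
by apply: H0 => //; exact: le_trans st.
Qed.

Let pathE u : - H <= u -> u <= T%:R -> `|x u omega| <= B -> y u = x u omega.
Proof. by move=> Hu uT xB; rewrite /solution_path clipped_solutionE// clip_id. Qed.

Let stepE i : tt i.+1 = tt i + Delta.
Proof. by rewrite -natr1 mulrDl mul1r. Qed.

Let near_left i u : tt i <= u -> u <= tt i.+1 -> `|u - tt i| <= N0.+1%:R^-1.
Proof.
move=> iu ui; rewrite ger0_norm ?subr_ge0//; apply: le_trans Delta_le.
by rewrite lerBlDl -stepE.
Qed.

Let near_right i u : tt i <= u -> u <= tt i.+1 -> `|u - tt i.+1| <= N0.+1%:R^-1.
Proof.
move=> iu ui; rewrite distrC ger0_norm ?subr_ge0//; apply: le_trans Delta_le.
by rewrite stepE lerBlDr addrC lerD2l.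
Qed.

Let KB : K <= B.
Proof. by rewrite BK ler_peMl ?ler1n// ltW. Qed.

Let KetaB : K + eta <= B.
Proof. by rewrite BK mulr_natl mulr2n lerD2l. Qed.

(** The drift of the neutral variable over the [i]-th step, as read off from its
    increment; the truncation makes it bounded even beyond the exit. *)
Definition step_drift i omega' : R := clip (cf * Delta)
  (- (neutral (solution_path omega') (tt i.+1) - neutral (solution_path omega') (tt i))
   - (Z i.+1 omega' - Z i omega')).

Let full_bound C t : stays x C t omega -> K <= C ->
  forall u, - H <= u -> u <= t -> `|x u omega| <= C.
Proof.
move=> /(staysP x_continuous) xC KC u Hu ut; have [u0|u0] := leP 0 u; first exact: xC.
by rewrite (le_trans (initial_le Hu (ltW u0)))// (le_trans delta_le).
Qed.

(** Before the exit the truncation in [step_drift] is inactive, by the choice of [cf]. *)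
Lemma step_exact i : (i < N)%N -> stays x B (tt i.+1) omega ->
  `|step_drift i omega - itg (linear_drift y) (tt i) (tt i.+1)| <=
    kappa * itg (lag_mean nu y) (tt i) (tt i.+1) /\
  step_drift i omega = - (neutral y (tt i.+1) - neutral y (tt i)) - (Z i.+1 omega - Z i omega).
Proof.
move=> iN sB.
have xB := full_bound sB KB.
have xy v : - H <= v -> v <= tt i.+1 -> x v omega = y v.
  move=> Hv vt; rewrite pathE ?xB//; exact: le_trans (ttT iN).
have inc := neutral_increment nu_fin a'E b'E HE alpha_gt1 g_growth
  (bm_solution_path omega) (fun v => clipped_solution_le (v, omega)) (tt_ge0 i) (ttS i) xy
  (g_integrable (tt_ge0 i.+1)) (equation i) (equation i.+1).
pose e := - (neutral y (tt i.+1) - neutral y (tt i)) - (Z i.+1 omega - Z i omega).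
have ee : `|e - itg (linear_drift y) (tt i) (tt i.+1)| <= kappa * itg (lag_mean nu y) (tt i) (tt i.+1).
  apply: le_trans inc; rewrite -normrN le_eqVlt; apply/predU1P; left; congr `|_|.
  by rewrite /e /neutral; ring.
have se : step_drift i omega = e.
  rewrite /step_drift clip_id// -/e.
  have := cf_rate (tt_ge0 i) (ttS i).
  rewrite (_ : tt i.+1 - tt i = Delta); last by rewrite stepE addrAC subrr add0r.
  apply: le_trans; rewrite -{1}(subrK (itg (linear_drift y) (tt i) (tt i.+1)) e).
  by rewrite (le_trans (ler_normD _ _))// addrC lerD2l.
by rewrite se.
Qed.

(** The first step after the last grid point before the exit cannot lead far, if the path
    is slow. *)
Lemma one_step i : (i < N)%N -> stays x K (tt i) omega -> slow x eta T%:R N0 omega ->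
  forall u, - H <= u -> u <= tt i.+1 -> `|x u omega| <= K + eta.
Proof.
move=> iN sK sl u Hu ut; have xK := full_bound sK (lexx K).
have [ui|iu] := leP u (tt i); first by rewrite (le_trans (xK u Hu ui))// lerDl.
have uT : u <= T%:R by exact: le_trans (ttT iN).
have : `|x u omega - x (tt i) omega| <= eta.
  apply: (slow_le x_continuous sl).
  - by rewrite uT andbT (le_trans _ (ltW iu)).
  - by rewrite tt_ge0 ttT// ltnW.
  exact: near_left (ltW iu) ut.
have := xK (tt i) (le_trans (_ : - H <= 0) (tt_ge0 i)) (lexx _).
rewrite oppr_le0 => /(_ H_ge0).
have := ler_normD (x u omega - x (tt i) omega) (x (tt i) omega).
by rewrite subrK; lra.
Qed.

Let HtT i : - H <= tt i. Proof. by rewrite (le_trans _ (tt_ge0 i))// oppr_le0. Qed.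

Lemma step_oscillation i : (i < N)%N -> stays x K (tt i) omega -> slow x eta T%:R N0 omega ->
  forall s, tt i <= s -> s <= tt i.+1 -> `|y s - y (tt i)| <= eta.
Proof.
move=> iN sK sl s is_ si; have sT : s <= T%:R by exact: le_trans (ttT iN).
rewrite /solution_path !clipped_solutionE//; last 2 first.
- by rewrite (le_trans is_).
- exact: le_trans is_.
rewrite (le_trans (clip_lipschitz _ _ B_ge0))//.
apply: (slow_le x_continuous sl).
- by rewrite sT (le_trans _ is_).
- by rewrite tt_ge0 (le_trans is_).
exact: near_left.
Qed.

Lemma path_memory_le u C : 0 <= u -> (forall v, u - H <= v -> v <= u -> `|y v| <= C) ->
  `|memory y u| <= r * C.
Proof.
move=> u0 yC; have Hu : u - H <= u by rewrite gerBl.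
have C0 : 0 <= C by rewrite (le_trans _ (yC u Hu (lexx u))).
apply: (le_trans (memory_le (bm_solution_path omega) yC)).
by rewrite ler_wpM2r ?rho_mass_le.
Qed.

Lemma neutral_bound u : 0 <= u -> `|neutral y u| <= 2 * B.
Proof.
move=> u0; have yB v : `|y v| <= B := clipped_solution_le (v, omega).
have := path_memory_le u0 (fun v _ _ => yB v).
have rB : r * B <= B by rewrite ler_piMl// ltW.
by have := ler_normB (y u) (memory y u); have := yB u; rewrite /neutral; lra.
Qed.

Lemma neutral_start : `|neutral y 0| <= 2 * delta.
Proof.
have yd v : 0 - H <= v -> v <= 0 -> `|y v| <= delta.
  rewrite sub0r => Hv v0; have xv := initial_le Hv v0.
  rewrite pathE//; first exact: le_trans (ler0n _ _).
  by rewrite (le_trans xv)// (le_trans delta_le).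
have := path_memory_le (lexx 0) yd.
have y0 : `|y 0| <= delta by apply: yd; rewrite // sub0r oppr_le0.
have rd : r * delta <= delta by rewrite ler_piMl// ltW.
by have := ler_normB (y 0) (memory y 0); rewrite /neutral; lra.
Qed.

(** At the exit the neutral variable is large, because its memory part cannot
    compensate for more than the fraction [r] of the bound on the path. *)
Lemma neutral_exit i : (i < N)%N -> 4 * eta <= (1 - r) * K -> slow x eta T%:R N0 omega ->
  stays x K (tt i) omega -> ~ stays x K (tt i.+1) omega ->
  (1 - r) * K / 2 <= `|neutral y (tt i.+1)|.
Proof.
move=> iN etaK sl sK nsK.
have xKe := one_step iN sK sl.
have yKe v : tt i.+1 - H <= v -> v <= tt i.+1 -> `|y v| <= K + eta.
  move=> Hv vi; have Hv' : - H <= v by rewrite (le_trans _ Hv)// lerDr.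
  rewrite pathE ?xKe//; first exact: le_trans (ttT iN).
  by rewrite (le_trans (xKe v Hv' vi)).
have mem := path_memory_le (tt_ge0 i.+1) yKe.
have yE : y (tt i.+1) = x (tt i.+1) omega.
  rewrite pathE//; [exact: ttT|by rewrite (le_trans (xKe _ _ _))].
have xbig : K - eta <= `|x (tt i.+1) omega|.
  rewrite leNgt; apply/negP => small; apply: nsK; apply/(staysP x_continuous) => u u0 ui.
  have [uti|tiu] := leP u (tt i); first by move/(staysP x_continuous): sK; apply.
  have uT : u <= T%:R by exact: le_trans (ttT iN).
  have : `|x u omega - x (tt i.+1) omega| <= eta.
    apply: (slow_le x_continuous sl); [by rewrite u0|by rewrite tt_ge0 ttT|].
    exact: near_right (ltW tiu) ui.
  have := ler_normD (x u omega - x (tt i.+1) omega) (x (tt i.+1) omega).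
  by rewrite subrK; lra.
have : `|y (tt i.+1)| <= `|neutral y (tt i.+1)| + `|memory y (tt i.+1)|.
  by rewrite -{1}(subrK (memory y (tt i.+1)) (y (tt i.+1))) ler_normD.
have re : r * eta <= eta by rewrite ler_piMl// ltW.
rewrite yE; move: mem xbig etaK re; lra.
Qed.

Let exit : exists m, [/\ (m <= N)%N, forall i, (i < m)%N -> stays x K (tt i) omega,
  ~ stays x K T%:R omega -> ~ stays x K (tt m) omega &
  forall f : nat -> R, \sum_(i < N) \1_(stays x K (tt i)) omega * f i = \sum_(i < m) f i].
Proof.
have mono i j : (i <= j)%N -> stays x K (tt j) omega -> stays x K (tt i) omega.
  by move=> ij; apply: stays_le; exact: tt_le.
have [m [mN mP ex]] := exit_index N mono.
exists m; split => //.
- by move=> i im; apply/(mP i (leq_trans im mN)).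
- by rewrite -N_Delta.
move=> f; apply: (@sum_exit _ _ (fun i => \1_(stays x K (tt i)) omega)) => // i iN.
rewrite indicE; congr (nat_of_bool _)%:R; apply/idP/idP => [/set_mem/(mP i iN)//|im].
by apply/mem_set/(mP i iN).
Qed.

(** For one outcome: the sums over the steps before the exit only see times at which the
    truncated quantities agree with those of the solution. *)
Lemma grid_reduction (cs : R) : (forall v, `|sigma v| <= cs) -> slow x eta T%:R N0 omega ->
  exists m, [/\ (m <= N)%N,
    forall f : nat -> R, \sum_(i < N) \1_(stays x K (tt i)) omega * f i = \sum_(i < m) f i,
    forall i s, (i < m)%N -> tt i <= s -> s <= tt i.+1 -> `|y s - y (tt i)| <= eta,
    forall i, (i < m)%N -> `|step_drift i omega - itg (linear_drift y) (tt i) (tt i.+1)| <=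
      kappa * itg (lag_mean nu y) (tt i) (tt i.+1) &
    forall i v, (i < m)%N -> tt i < v -> v <= tt i.+1 ->
      clip_process (fun s omega => sigma' s * x (s - tau) omega) T%:R (cs * B) (v, omega) =
      sigma v * y (v - tau)].
Proof.
move=> scs sl; have [m [mN mK _ sumE]] := exit.
have cs0 : 0 <= cs by rewrite (le_trans _ (scs 0)).
exists m; split => // [i s im|i im|i v im iv vi]; have iN := leq_trans im mN.
- by apply: step_oscillation => //; exact: mK.
- apply: (step_exact iN _).1; apply/(staysP x_continuous) => u u0 ui.
  by rewrite (le_trans (one_step iN (mK i im) sl _ ui))// (le_trans _ u0)// oppr_le0.
have v0 : 0 <= v by rewrite (le_trans (tt_ge0 i))// ltW.
have vT : v <= T%:R by exact: le_trans (ttT iN).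
have Hv : - H <= v - tau by rewrite (@le_trans _ _ (0 - tau)) ?lerD2r// sub0r lerN2.
have vtv : v - tau <= v by rewrite gerBl.
have xB : `|x (v - tau) omega| <= B.
  by rewrite (le_trans (one_step iN (mK i im) sl Hv _))// (le_trans vtv).
rewrite /clip_process patchE ifT; last by rewrite inE; split => //=; rewrite in_itv/= v0.
rewrite /= sigma'E// pathE//; last exact: le_trans vT.
by rewrite clip_id// normrM ler_pM.
Qed.

(** Without the exit the sum is bounded below by telescoping; at an exit along a slowly
    moving path the last neutral variable gives a definite contribution.  If the path
    leaves [[-B, B]] during the last step, then that step still contributes at least
    minus the square of the neutral variable at its left end. *)
Lemma energy_lower (J D : nat -> R) (eta1 : R) : 0 <= eta1 -> 4 * eta <= (1 - r) * K ->
  (forall i, (i <= N)%N -> stays x B (tt i) omega -> `|J i - Z i omega| <= eta1) ->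
  (forall i, D i = - (step_drift i omega + (J i.+1 - J i))) ->
  ((1 - r) * K / 2) ^+ 2 *
      `[< slow x eta T%:R N0 omega /\ ~ stays x K T%:R omega >]%:R
    - 4 * delta ^+ 2 - N%:R * (8 * B * eta1) <=
  \sum_(i < N) \1_(stays x K (tt i)) omega *
    (2 * neutral y (tt i) * D i + D i ^+ 2).
Proof.
move=> eta10 etaK close DE; have [m [mN mK mexit sumE]] := exit.
rewrite (sumE (fun i => 2 * neutral y (tt i) * D i + D i ^+ 2)).
pose z i := neutral y (tt i).
have zB i : `|z i| <= 2 * B by exact: neutral_bound.
have z0 : z 0%N ^+ 2 <= 4 * delta ^+ 2.
  have := neutral_start; rewrite -(mul0r Delta) -/(z 0%N) => h.
  rewrite (_ : 4 * delta ^+ 2 = (2 * delta) ^+ 2); last by ring.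
  by rewrite -(real_normK (num_real (z 0%N))) lerXn2r ?nnegrE ?mulr_ge0.
have De i : (i < N)%N -> stays x B (tt i.+1) omega -> `|D i - (z i.+1 - z i)| <= 2 * eta1.
  move=> iN sB; rewrite DE; have [_ ->] := step_exact iN sB; rewrite -/(z i) -/(z i.+1).
  have c1 := close i.+1 iN sB; have ci := close i (ltnW iN) (stays_le (ttS i) sB).
  have -> : - (- (z i.+1 - z i) - (Z i.+1 omega - Z i omega) + (J i.+1 - J i)) - (z i.+1 - z i)
    = (J i - Z i omega) - (J i.+1 - Z i.+1 omega) by ring.
  by rewrite (le_trans (ler_normB _ _))// mulr_natl mulr2n lerD.
have err j : (j <= N)%N -> j%:R * (2 * (2 * B) * (2 * eta1)) <= N%:R * (8 * B * eta1).
  move=> jN; rewrite (_ : 2 * (2 * B) * (2 * eta1) = 8 * B * eta1); last by ring.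
  by rewrite ler_wpM2r ?mulr_ge0// ler_nat.
have sBm i : (i < m)%N -> stays x B (tt i) omega.
  move=> im; have := mK i im; move=> /(staysP x_continuous) xK.
  by apply/(staysP x_continuous) => u u0 ui; exact: le_trans (xK u u0 ui) KB.
have tele j : (j <= m)%N -> (forall i, (i < j)%N -> stays x B (tt i.+1) omega) ->
    z j ^+ 2 - 4 * delta ^+ 2 - N%:R * (8 * B * eta1) <=
    \sum_(i < j) (2 * z i * D i + D i ^+ 2).
  move=> jm sB; have jN := leq_trans jm mN.
  have := square_telescope (N := j) (fun i _ => zB i)
    (fun i ij => De i (leq_trans ij jN) (sB i ij)).
  by have := err j jN; move: z0; lra.
case: m mN mK mexit sBm tele {sumE} => [|m] mN mK mexit sBm tele.
  rewrite big_ord0; have := tele 0%N (leqnn _) (fun i => ltac:(by [])); rewrite big_ord0.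
  have := sqr_ge0 (z 0%N).
  rewrite asboolF ?mulr0; first by lra.
  case=> _ /mexit; apply; rewrite mul0r; apply/(staysP x_continuous) => u u0 ui.
  have -> : u = 0 by apply/eqP; rewrite eq_le u0 ui.
  by rewrite (le_trans (initial_le _ _))// oppr_le0.
have [sB|nsB] := pselect (stays x B (tt m.+1) omega).
  apply: le_trans (tele m.+1 (leqnn _) _); last first.
    by move=> i im; apply: stays_le sB; exact: tt_le.
  rewrite lerD2r lerD2r; case: asboolP => [[sl nT]|_]; last by rewrite mulr0 sqr_ge0.
  rewrite mulr1 -(real_normK (num_real (z m.+1))) lerXn2r ?nnegrE//.
    by rewrite divr_ge0// mulr_ge0// ?subr_ge0 ltW.
  by apply: neutral_exit => //; [exact: mK|exact: mexit].
rewrite asboolF; last first.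
  case=> sl _; apply: nsB; apply/(staysP x_continuous) => u u0 ui.
  rewrite (le_trans (one_step mN (mK m (ltnSn m)) sl _ ui))//.
  by rewrite (le_trans _ u0)// oppr_le0.
rewrite mulr0 big_ord_recr/=.
have := tele m (leqnSn m) (fun i im => sBm i.+1 im).
have := sqr_ge0 (z m + D m).
rewrite -/(z m) sqrrD -mulr_natl; lra.
Qed.

Lemma square_close (c k j z : R) : 0 < k -> `|j| <= c -> `|z| <= c ->
  j ^+ 2 <= z ^+ 2 + (k + c ^+ 2 / k * (j - z) ^+ 2).
Proof.
move=> k0 jc zc; have kn : k != 0 by rewrite gt_eqF.
have h : j ^+ 2 - z ^+ 2 <= 2 * (c * `|j - z|).
  rewrite subr_sqr (le_trans (ler_norm _))// normrM.
  rewrite (_ : 2 * (c * `|j - z|) = `|j - z| * (2 * c)); last by ring.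
  by rewrite ler_wpM2l// (le_trans (ler_normD _ _))// mulr_natl mulr2n lerD.
have : 0 <= k^-1 * (k - c * `|j - z|) ^+ 2 by rewrite mulr_ge0 ?sqr_ge0// invr_ge0 ltW.
rewrite (_ : k^-1 * _ = k + c ^+ 2 / k * (j - z) ^+ 2 - 2 * (c * `|j - z|)).
  by move: h; lra.
by rewrite -[in RHS](real_normK (num_real (j - z))); field.
Qed.

(** Replace the simple process by the diffusion coefficient that it approximates, and use
    the estimate of the path energy up to the exit. *)
Lemma energy_upper (cs k gamma kappa0 C1 E : R) (X : simple_process F) :
  (forall v, `|sigma v| <= cs) -> slow x eta T%:R N0 omega -> 0 < k ->
  0 <= E -> grid_energy_estimate nu kappa0 C1 E -> kappa <= kappa0 ->
  (forall v, `|sp_value X v omega| <= cs * B) ->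
  itg (fun v => (sp_value X v omega - clip_process (fun s omega => sigma' s * x (s - tau) omega)
    T%:R (cs * B) (v, omega)) ^+ 2) 0 T%:R <= gamma ->
  \sum_(i < N) \1_(stays x K (tt i)) omega * (- 2 * neutral y (tt i) * step_drift i omega
    + itg (fun v => sp_value X v omega ^+ 2) (tt i) (tt i.+1)) <=
  C1 * delta ^+ 2 + E * B * (eta + B * Delta) * T%:R
  + (k * T%:R + (cs * B) ^+ 2 / k * gamma).
Proof.
move=> scs sl k0 E0 est kap Xc close; set c := cs * B in Xc close *.
have cs0 : 0 <= cs by rewrite (le_trans _ (scs 0)).
have c0' : 0 <= c by exact: mulr_ge0.
have [m [mN sumE osc hL clipE]] := grid_reduction scs sl; rewrite -/c in clipE.
rewrite (sumE (fun i => - 2 * neutral y (tt i) * step_drift i omega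
    + itg (fun v => sp_value X v omega ^+ 2) (tt i) (tt i.+1))).
have by_ := bm_solution_path omega.
have yd u : - H <= u -> u <= 0 -> `|y u| <= delta.
  move=> Hu u0; have xd := initial_le Hu u0.
  rewrite pathE//; first exact: le_trans (ler0n _ _).
  by rewrite (le_trans xd)// (le_trans delta_le).
have kap0 : 0 <= kappa <= kappa0 by rewrite powR_ge0.
have main := est y (fun i => step_drift i omega) m kappa Delta delta eta B by_
  (fun v => clipped_solution_le (v, omega)) kap0 (ltW Delta_gt0) eta_ge0 yd osc hL.
have mT : m%:R * Delta <= T%:R by rewrite -N_Delta tt_le.
have b1 : bm (fun v => sp_value X v omega) by exact: bm_sp_path.
have b2 : bm (fun v : R => sigma v * y (v - tau)) by bm_solve.
pose q v := k + c ^+ 2 / k * (sp_value X v omega - sigma v * y (v - tau)) ^+ 2.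
have bdiff : bm (fun v => (sp_value X v omega - sigma v * y (v - tau)) ^+ 2).
  by apply: bmX2; exact: bmB.
have bq : bm q.
  by apply: bmD; [exact: bm_cst|apply: bmM => //; exact: bm_cst].
have bs : bm (fun s : R => sigma s ^+ 2 * y (s - tau) ^+ 2) by bm_solve.
apply: (@le_trans _ _ (\sum_(i < m) (- 2 * neutral y (tt i) * step_drift i omega
   + itg (fun s => sigma s ^+ 2 * y (s - tau) ^+ 2) (tt i) (tt i.+1))
   + \sum_(i < m) itg q (tt i) (tt i.+1))).
  rewrite -big_split/=; apply: ler_sum => i _; rewrite -[leRHS]addrA lerD2l.
  rewrite -itgD//; apply: le_itg; [exact: bmX2|exact: bmD|move=> v iv vi].
  rewrite -exprMn; apply: square_close => //.
  by rewrite normrM ler_pM//; exact: clipped_solution_le.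
apply: lerD.
  apply: (le_trans main); rewrite lerD2l ler_wpM2l// mulr_ge0//; first exact: mulr_ge0.
  by rewrite addr_ge0// mulr_ge0// ltW.
have m0 : 0 <= m%:R * Delta by exact: tt_ge0.
rewrite itg_grid//; last exact: ltW.
rewrite /q itgD//; last 2 first.
- exact: bm_cst.
- by apply: bmM => //; exact: bm_cst.
rewrite itg_cst// subr0 itgZl// lerD//; first by rewrite ler_wpM2l// ltW.
have ck : 0 <= c ^+ 2 / k by rewrite mulr_ge0 ?sqr_ge0// invr_ge0 ltW.
rewrite ler_wpM2l//; apply: le_trans close.
have mY : jointly_measurable `[0, T%:R] (fun s omega => sigma' s * x (s - tau) omega).
  by case: x_sol => _ _ _ _ /(_ T%:R (ler0n _ _)) [Z' [[]]].
have bcl : bm (fun v => (sp_value X v omega - clip_process (fun s omega =>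
    sigma' s * x (s - tau) omega) T%:R c (v, omega)) ^+ 2).
  apply: bmX2; apply: bmB => //.
  exact: (bm_sec omega (bm_clip_process c0' mY)).
rewrite [leRHS](itg_split bcl m0 mT).
rewrite -[leLHS]addr0 lerD//; last by apply: itg_ge0 => v _ _; exact: sqr_ge0.
rewrite -itg_grid//; last exact: ltW.
rewrite -[leRHS]itg_grid//; last exact: ltW.
apply: ler_sum => i _; rewrite le_eqVlt; apply/predU1P; left.
by apply: eq_itg => v iv vi; rewrite (clipE i v (ltn_ord i) iv vi).
Qed.

End PathAtGrid.

(** * The probability of an exit *)

Section ExitEnergy.
Variables (K delta r kappa0 C1 E : R).
Hypothesis K_gt0 : 0 < K.
Hypothesis BK : B = 2 * K.
Hypothesis delta_ge0 : 0 <= delta.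
Hypothesis delta_le : delta <= K.
Hypothesis T_gt0 : (0 < T)%N.
Hypothesis rho_mass_le : forall u, 0 <= u -> rho_mass u <= r.
Hypothesis r_lt1 : r < 1.
Hypothesis C1_ge0 : 0 <= C1.
Hypothesis E_ge0 : 0 <= E.
Hypothesis energy_estimate : grid_energy_estimate nu kappa0 C1 E.
Hypothesis kappa_le : B `^ (alpha - 1) <= kappa0.
Hypothesis phi_small :
  {ae P, forall omega, (sup_norm `[(- H)%R, 0%R] (phi ^~ omega) < delta%:E)%E}.
Local Notation kappa := (B `^ (alpha - 1)).

(** The solution provides a version of the stochastic integral for each time separately;
    countably many times and one full event are enough. *)
Lemma solution_on_grid (Delta : R) : 0 < Delta -> exists (Z : nat -> Omega -> R) (A : set Omega),
  [/\ forall i, is_ito_integral P F w (fun s omega => sigma' s * x (s - tau) omega)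
        (i%:R * Delta) (Z i),
      measurable A, P (~` A) = 0%E &
      forall omega, A omega -> [/\ forall u, - H <= u -> u <= 0 -> `|x u omega| <= delta,
        forall t, 0 <= t ->
          mu.-integrable `[0, t] (fun u => (g u (segment n hd tau (x ^~ omega) u))%:E) &
        forall i, x (i%:R * Delta) omega
          + \int[mu]_(u in `[0, i%:R * Delta]) drift n hd tau a' b' g (x ^~ omega) u
          + Z i omega = phi 0 omega]].
Proof.
move=> D0; have [_ _ _ gi sol] := x_sol.
have tt0 (i : nat) : 0 <= i%:R * Delta by rewrite mulr_ge0// ltW.
have [Z HZ] := choice (fun i => sol _ (tt0 i)).
pose Q (i : nat) omega : Prop := match i with
  | 0%N => is_true (sup_norm `[(- H)%R, 0%R] (phi ^~ omega) < delta%:E)%E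
  | 1%N => forall t, 0 <= t ->
      mu.-integrable `[0, t] (fun u => (g u (segment n hd tau (x ^~ omega) u))%:E)
  | i.+2 => x (i%:R * Delta) omega
      + \int[mu]_(u in `[0, i%:R * Delta]) drift n hd tau a' b' g (x ^~ omega) u
      + Z i omega = phi 0 omega
  end.
have [|A [mA A0 AQ]] := @ae_full_set _ _ _ P Q.
  by case=> [|[|i]]; [exact: phi_small|exact: gi|have [] := HZ i].
exists Z, A; split => // [i|omega Ao]; first by have [] := HZ i.
split; [move=> u Hu u0|exact: (AQ omega Ao 1%N)|by move=> i; exact: (AQ omega Ao i.+2)].
rewrite x_phi// -lee_fin; apply: le_trans (ltW (AQ omega Ao 0%N)).
by apply: ereal_sup_ubound; exists u => //; rewrite /= in_itv/= Hu.
Qed.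

Lemma drift_rate : exists2 cf, 0 <= cf & forall omega s t, 0 <= s -> s <= t ->
  `|itg (linear_drift (solution_path omega)) s t|
  + kappa * itg (lag_mean nu (solution_path omega)) s t <= cf * (t - s).
Proof.
have [cL cL0 HL] := path_bounded_linear_drift.
exists (cL * B + kappa * (G0 * B)).
  by rewrite addr_ge0// !mulr_ge0// powR_ge0.
move=> omega s t s0 st; have by_ := bm_solution_path omega.
have yB v : `|solution_path omega v| <= B := clipped_solution_le (v, omega).
rewrite mulrDl lerD//.
  by apply: itg_norm_le => // [|u _ _]; [exact: bm_linear_drift|exact: HL].
rewrite -mulrA ler_wpM2l ?powR_ge0//; apply: itg_le_cst => //; first exact: bm_lag_mean.
by move=> u _ _; exact: lag_mean_le.
Qed.

Let H_le0 : - H <= 0. Proof. by rewrite oppr_le0. Qed.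

Let grid_choice (eta p D1 : R) : 0 < eta -> 0 < p -> 0 < D1 ->
  exists (Delta : R) (N N0 : nat), [/\ 0 < Delta, Delta <= D1, Delta <= N0.+1%:R^-1,
    N%:R * Delta = T%:R & (P (~` slow x eta T%:R N0) <= p%:E)%E].
Proof.
move=> eta0 p0 D10.
have H1 := slow_probability P F_filtration x_adapted x_continuous T%:R eta0 p0.
have H2 := near_infty_natSinv_lt (PosNum D10).
have [N0 [h1 h2]] := filter_ex (filterI H1 H2).
exists N0.+1%:R^-1, (T * N0.+1)%N, N0; split => //; first exact: ltW.
by rewrite natrM mulfK.
Qed.

(** Compare the expectations of the upper and the lower bound of the discretized energy.
    The parameters are chosen in an order in which each error can be made small given the
    earlier choices: the modulus [eta] of the path, the weight [k] of Young's inequality,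
    the mesh [Delta], the accuracy [eta1] of the stochastic integrals at the grid points,
    the accuracy [gamma] of the integrand, and last the simple process [J l]. *)
Lemma exit_energy e : 0 < e ->
  ((1 - r) * K / 2) ^+ 2 * fine (P (~` stays x K T%:R)) <= (C1 + 4) * delta ^+ 2 + e.
Proof.
move=> e0.
have [cs cs0 scs] := bm_bound bsigma.
have [cf cf0 rate] := drift_rate.
pose c := cs * B; have c_ge0 : 0 <= c by exact: mulr_ge0.
have T0 : 0 < T%:R :> R by rewrite ltr0n.
have T0' := ltW T0.
set ks := (1 - r) * K / 2.
have ks0 : 0 < ks by rewrite divr_gt0// mulr_gt0// subr_gt0.
pose q := e / 9; have q0 : 0 < q by rewrite divr_gt0.
have ET0 : 0 <= E * B * T%:R by rewrite !mulr_ge0.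
have [etaa ea0 eaq] := small_multiple ET0 q0.
have [eta [eta0 eta_le_a eta_le_K eta_r]] : exists eta,
    [/\ 0 < eta, eta <= etaa, eta <= K & 4 * eta <= (1 - r) * K].
  exists (Num.min etaa (Num.min K (ks / 2))); split.
  - by rewrite !lt_min ea0 K_gt0 divr_gt0.
  - by rewrite ge_min lexx.
  - by rewrite !ge_min lexx orbT.
  - have : Num.min etaa (Num.min K (ks / 2)) <= ks / 2 by rewrite !ge_min lexx !orbT.
    by rewrite /ks; lra.
have cT0 : 0 <= c ^+ 2 * T%:R by rewrite mulr_ge0 ?sqr_ge0.
have [k k0 kq] := small_multiple cT0 q0.
(* A bound of the upper sum that holds whatever the path does. *)
pose MT := T%:R * (4 * B * cf + c ^+ 2).
have MT0 : 0 <= MT by rewrite mulr_ge0// addr_ge0 ?sqr_ge0// !mulr_ge0.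
have M10 : 0 <= ks ^+ 2 + MT by rewrite addr_ge0 ?sqr_ge0.
have [p1 p10 p1q] := small_multiple M10 q0.
have k1_0 : 0 <= 1 + k^-1 by rewrite addr_ge0// invr_ge0 ltW.
have M20 : 0 <= E * B * B * T%:R + (1 + k^-1) * cf ^+ 2 * T%:R.
  by rewrite addr_ge0 ?mulr_ge0 ?sqr_ge0.
have [D1 D10 D1q] := small_multiple M20 q0.
have [Delta [N [N0 [Delta0 DeltaD1 DeltaN0 NDelta slowN0]]]] := grid_choice eta0 p10 D10.
have {D1q} Dq : (E * B * B * T%:R + (1 + k^-1) * cf ^+ 2 * T%:R) * Delta <= q.
  by apply: le_trans D1q; rewrite ler_wpM2l.
have [Z [A [itoZ mA A0 AP]]] := solution_on_grid Delta0.
have NB0 : 0 <= N%:R * (8 * B) by rewrite !mulr_ge0.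
have [eta1 eta10 eta1q] := small_multiple NB0 q0.
(* What the lower bound can lose when a stochastic integral is not well approximated. *)
pose c2 := N%:R * (2 * B) ^+ 2 + ks ^+ 2.
have c20 : 0 <= c2 by rewrite addr_ge0 ?sqr_ge0// mulr_ge0 ?sqr_ge0.
have c2N0 : 0 <= c2 * N%:R by rewrite mulr_ge0.
have [p2 p20 p2q] := small_multiple c2N0 q0.
have [k2 k20 k2q] := small_multiple T0' q0.
have ck20 : 0 <= c ^+ 2 / k2 by rewrite mulr_ge0 ?sqr_ge0// invr_ge0 ltW.
have [gamma gamma0 gammaq] := small_multiple ck20 q0.
have [p3 p30 p3q] := small_multiple MT0 q0.
have tN0 : 0 < N%:R * Delta by rewrite NDelta.
have [J [Jc Jclose Jito]] := ito_localize F_filtration w_wiener tN0 c_ge0 (itoZ N).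
pose bad l i := (A `&` stays x B (i.+1%:R * Delta)) `&`
  [set omega | eta1 <= `|sp_integral w (J l) (i.+1%:R * Delta) omega - Z i.+1 omega|].
have tt0 i : 0 <= i%:R * Delta by rewrite mulr_ge0// ltW.
have ttS0 i : 0 < i.+1%:R * Delta by rewrite mulr_gt0.
have tS i : i%:R * Delta < i.+1%:R * Delta by rewrite ltr_pM2r// ltr_nat.
have ttN i : (i <= N)%N -> i%:R * Delta <= N%:R * Delta.
  by move=> iN; apply: ler_wpM2r; [exact: ltW|rewrite ler_nat].
have mstays C t : 0 <= t -> measurable (stays x C t).
  by move=> t0; apply: (Fm t0); exact: (stays_adapted F_filtration x_adapted).
have mAS i : measurable (A `&` stays x B (i.+1%:R * Delta)).
  by apply: measurableI => //; exact: mstays.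
pose far l := [set omega | gamma <= itg (fun v => (sp_value (J l) v omega -
  clip_process (fun s omega => sigma' s * x (s - tau) omega) (N%:R * Delta) c (v, omega)) ^+ 2)
  0 (N%:R * Delta)].
have [l [farl badl]] : exists l, (P (far l) <= p3%:E)%E /\
    forall i, (i < N)%N -> (P (bad l i) <= p2%:E)%E.
  have H1 := Jclose gamma gamma0 p3 p30.
  have H2 : \forall l \near \oo, forall i, (i < N)%N -> (P (bad l i) <= p2%:E)%E.
    apply: near_all_lt => i iN.
    apply: (Jito _ _ (ttS0 i) (ttN _ iN) (itoZ i.+1) _ (mAS i) _ _ eta10 _ p20).
    move=> omega v [Ao /(staysP x_continuous) So] v0 vi; have [ini _ _] := AP omega Ao.
    rewrite normrM ler_pM//; first by rewrite sigma'E ?scs// ltW.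
    have [vt|vt] := leP 0 (v - tau).
      by apply: So => //; rewrite (le_trans _ vi)// gerBl.
    apply: (@le_trans _ _ delta); last by rewrite (le_trans delta_le)// BK ler_peMl ?ler1n// ltW.
    apply: ini; last exact: ltW.
    by rewrite (@le_trans _ _ (- tau)) ?lerN2// lerDr ltW.
  by have [l [h1 h2]] := filter_ex (filterI H1 H2); exists l.
pose Y := J l.
pose z i omega := neutral (solution_path omega) (i%:R * Delta).
pose h i omega := step_drift Delta cf Z i omega.
have cfD0 : 0 <= cf * Delta by rewrite mulr_ge0// ltW.
have bz i : bm (z i) by exact: bm_neutral_solution.
have bh i : bm (h i).
  apply: bm_clip => //; have mZ j : measurable_fun setT (Z j) by have [] := itoZ j.
  apply: measurable_realfun.measurable_funB; last exact: measurable_realfun.measurable_funB.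
  by apply: measurableT_comp => //; apply: measurable_realfun.measurable_funB; [exact: (bz i.+1).1|exact: (bz i).1].
have hc i omega : `|h i omega| <= cf * Delta by exact: clip_le.
have FA i : (i < N)%N -> F (i%:R * Delta) (stays x K (i%:R * Delta)).
  by move=> _; exact: (stays_adapted F_filtration x_adapted).
have mart i : (i < N)%N -> \int[P]_omega (\1_(stays x K (i%:R * Delta)) omega * z i omega *
     (sp_integral w Y (i.+1%:R * Delta) omega - sp_integral w Y (i%:R * Delta) omega)) = 0.
  by move=> iN; apply: neutral_martingale => //; exact: FA.
have [] := grid_energy F_filtration w_wiener (Jc l) Delta0 k0 FA bz bh hc mart.
set Psi := (fun omega => _); set Theta := (fun omega => _) => iPsi bTheta EE.
have DN : N%:R * Delta * Delta = T%:R * Delta by rewrite NDelta.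
pose S := slow x eta T%:R N0 `&` ~` stays x K T%:R.
have mslow : measurable (slow x eta T%:R N0).
  exact: (measurable_slow F_filtration x_adapted).
have mS : measurable S by apply: measurableI => //; apply: measurableC; exact: mstays.
pose Bad := \big[setU/set0]_(i < N) bad l i.
have mbad i : measurable (bad l i).
  apply: measurableI => //; apply: measurable_leset; first exact: measurable_cst.
  apply: measurableT_comp => //; apply: measurable_realfun.measurable_funB.
    exact: (measurable_sp_integral F_filtration w_wiener).
  by have [] := itoZ i.+1.
have mBad : measurable Bad by apply: bigsetU_measurable => i _.
have mY : jointly_measurable `[0, N%:R * Delta] (fun s omega => sigma' s * x (s - tau) omega).
  by have [] := itoZ N.
have mfar : measurable (far l).
  apply: measurable_leset; first exact: measurable_cst.
  have bq : bm (fun p : R * Omega => (sp_value (J l) p.1 p.2 - clip_process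
      (fun s omega => sigma' s * x (s - tau) omega) (N%:R * Delta) c p) ^+ 2).
    by apply: bmX2; apply: bmB; [exact: (bm_sp_value_joint F_filtration)|exact: bm_clip_process].
  exact: (bm_itg_path 0 (N%:R * Delta) bq).1.
pose low := 4 * delta ^+ 2 + N%:R * (8 * B * eta1).
have low0 : 0 <= low by rewrite addr_ge0 ?mulr_ge0 ?sqr_ge0// ltW.
pose LB omega := ks ^+ 2 * \1_S omega - low - c2 * \1_Bad omega.
pose up := C1 * delta ^+ 2 + E * B * (eta + B * Delta) * T%:R + (k2 * T%:R + c ^+ 2 / k2 * gamma).
have up0 : 0 <= up.
  have e1 := ltW eta0; have D0 := ltW Delta0; have k2' := ltW k20; have g0 := ltW gamma0.
  rewrite /up addr_ge0//; last by rewrite addr_ge0// mulr_ge0.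
  rewrite addr_ge0//; first by rewrite mulr_ge0// sqr_ge0.
  by rewrite !mulr_ge0// addr_ge0// mulr_ge0.
pose UB omega := up + MT * \1_(~` slow x eta T%:R N0) omega + MT * \1_(far l) omega.
have lower omega : A omega -> LB omega <= Psi omega.
  move=> Ao; have [ini gi eqs] := AP omega Ao.
  have S1 : ks ^+ 2 * \1_S omega <= ks ^+ 2.
    by rewrite ler_piMr ?sqr_ge0// indicE; case: (_ \in _).
  have [Bo|nB] := pselect (Bad omega).
    have -> : LB omega = ks ^+ 2 * \1_S omega - low - c2 by rewrite /LB [\1_Bad omega]indicE mem_set// mulr1.
    apply: (@le_trans _ _ (- (N%:R * (2 * B) ^+ 2))).
      exact: drop_budget.
    have -> : - (N%:R * (2 * B) ^+ 2) = \sum_(i < N) - (2 * B) ^+ 2.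
      by rewrite sumr_const card_ord -mulrN [LHS]mulr_natl.
    apply: ler_sum => i _; have zB := neutral_bound omega rho_mass_le r_lt1 (tt0 i).
    have zB2 : z i omega ^+ 2 <= (2 * B) ^+ 2.
      rewrite -(real_normK (num_real (z i omega))) lerXn2r ?nnegrE//.
      exact: mulr_ge0.
    rewrite indicE; case: (_ \in _); rewrite ?mul1r ?mul0r.
      exact: square_budget.
    by rewrite oppr_le0 sqr_ge0.
  have close i : (i <= N)%N -> stays x B (i%:R * Delta) omega ->
      `|sp_integral w Y (i%:R * Delta) omega - Z i omega| <= eta1.
    case: i => [_ _|i iN sB].
      have Z0 : Z 0%N omega = 0.
        have := eqs 0%N; rewrite !mul0r set_itv1 Rintegral_set1 addr0 x_phi//.
        by move=> h0; apply: (addrI (phi 0 omega)); rewrite h0 addr0.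
      by rewrite mul0r sp_integral0 Z0 subrr normr0 ltW.
    rewrite leNgt; apply/negP => big; apply: nB; rewrite /Bad -bigcup_mkord.
    by exists i => //; split; [split|exact: ltW].
  have SE : \1_S omega = `[< slow x eta T%:R N0 omega /\ ~ stays x K T%:R omega >]%:R :> R.
    by rewrite indicE; congr (nat_of_bool _)%:R; apply/idP/asboolP => [/set_mem//|So]; apply/mem_set.
  have -> : LB omega = ks ^+ 2 * `[< slow x eta T%:R N0 omega /\ ~ stays x K T%:R omega >]%:R
      - 4 * delta ^+ 2 - N%:R * (8 * B * eta1).
    by rewrite /LB SE [\1_Bad omega]indicE memNset// mulr0 subr0 /low opprD addrA.
  by apply: (energy_lower K_gt0 BK delta_ge0 delta_le (ltW eta0) eta_le_K Delta0 DeltaN0 NDelta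
    rho_mass_le r_lt1 (rate omega) ini gi eqs (D := fun i => - (h i omega
    + (sp_integral w Y (i.+1%:R * Delta) omega - sp_integral w Y (i%:R * Delta) omega)))
    (ltW eta10) eta_r close).
have upper omega : A omega -> Theta omega <= UB omega.
  move=> Ao; have [ini gi eqs] := AP omega Ao.
  have i0 D : 0 <= MT * \1_D omega by rewrite mulr_ge0// indicE.
  have [[sl nf]|out] := pselect (slow x eta T%:R N0 omega /\ ~ far l omega).
    apply: (@le_trans _ _ up); last by rewrite /UB -addrA lerDl addr_ge0.
    apply: (energy_upper K_gt0 BK delta_le (ltW eta0) eta_le_K Delta0 DeltaN0 NDelta
      (rate omega) ini gi eqs scs sl k20 E_ge0 energy_estimate kappa_le (fun v => Jc l v omega)).
    by rewrite -NDelta; apply/ltW; rewrite ltNge; apply/negP.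
  apply: (@le_trans _ _ MT); last first.
    rewrite /UB; have [sl|nsl] := pselect (slow x eta T%:R N0 omega).
      have fo : far l omega by apply: contrapT => nf; apply: out.
      have -> : \1_(far l) omega = 1 :> R by rewrite indicE mem_set.
      by rewrite mulr1 lerDr addr_ge0.
    have -> : \1_(~` slow x eta T%:R N0) omega = 1 :> R by rewrite indicE mem_set.
    by rewrite mulr1 addrAC lerDr addr_ge0.
  have -> : MT = \sum_(i < N) ((4 * B * cf + c ^+ 2) * Delta).
    by rewrite sumr_const card_ord -mulr_natl /MT -NDelta; ring.
  apply: ler_sum => i _; have zB := neutral_bound omega rho_mass_le r_lt1 (tt0 i).
  have q1 : - 2 * z i omega * h i omega <= 4 * B * cf * Delta.
    rewrite (_ : - 2 * z i omega * h i omega = 2 * (- z i omega * h i omega)); last by ring.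
    rewrite (_ : 4 * B * cf * Delta = 2 * (2 * B * (cf * Delta))); last by ring.
    by rewrite ler_pM2l// (le_trans (ler_norm _))// normrM normrN ler_pM.
  have q2 : itg (fun v => sp_value Y v omega ^+ 2) (i%:R * Delta) (i.+1%:R * Delta) <= c ^+ 2 * Delta.
    rewrite [leRHS](_ : _ = c ^+ 2 * (i.+1%:R * Delta - i%:R * Delta)); last by rewrite -natr1; ring.
    apply: itg_le_cst; [by apply: bmX2; exact: bm_sp_path|exact: ltW|move=> v _ _].
    rewrite -(real_normK (num_real (sp_value Y v omega))) lerXn2r ?nnegrE//.
    exact: Jc.
  have q3 : 0 <= (4 * B * cf + c ^+ 2) * Delta.
    by rewrite mulr_ge0 ?(ltW Delta0)// addr_ge0 ?sqr_ge0// !mulr_ge0.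
  rewrite indicE; case: (_ \in _); rewrite ?mul1r ?mul0r//.
  by rewrite [leRHS]mulrDl; exact: lerD.
have b1 D : measurable D -> bm (fun omega : Omega => \1_D omega : R) by move=> mD; exact: bm_indic.
have bLB : bm LB.
  by apply: bmB; [apply: bmB; [apply: bmM; [exact: bm_cst|exact: b1]|exact: bm_cst]|
    apply: bmM; [exact: bm_cst|exact: b1]].
have bUB : bm UB.
  apply: bmD; [apply: bmD; [exact: bm_cst|]|]; (apply: bmM; [exact: bm_cst|apply: b1 => //]).
  exact: measurableC.
have iL := le_Rintegral_full mA A0 (bm_integrableP P bLB) iPsi lower.
have iU := le_Rintegral_full mA A0 (bm_integrableP P bTheta) (bm_integrableP P bUB) upper.
have ELB : \int[P]_omega LB omega = ks ^+ 2 * fine (P S) - low - c2 * fine (P Bad).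
  rewrite (_ : _ - low - _ = - low + ks ^+ 2 * fine (P S) + - c2 * fine (P Bad)); last by ring.
  rewrite -(Rintegral_affine_indic P (- low) (ks ^+ 2) (- c2) mS mBad).
  by apply: eq_Rintegral => omega _; rewrite /LB; ring.
have EUB : \int[P]_omega UB omega = up + MT * fine (P (~` slow x eta T%:R N0)) + MT * fine (P (far l)).
  exact: (Rintegral_affine_indic P up MT MT (measurableC mslow) mfar).
have PBad : fine (P Bad) <= N%:R * p2 by exact: probability_bigU.
have fp (D : set Omega) (a0 : R) : measurable D -> (P D <= a0%:E)%E -> fine (P D) <= a0.
  by move=> mD; rewrite -lee_fin fineK// fin_num_measure.
have Pslow := fp _ _ (measurableC mslow) slowN0.
have Pfar := fp _ _ mfar farl.
have PE : fine (P (~` stays x K T%:R)) <= fine (P S) + fine (P (~` slow x eta T%:R N0)).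
  have mU : measurable (S `|` ~` slow x eta T%:R N0) by apply: measurableU => //; exact: measurableC.
  rewrite -fineD ?fin_num_measure//; last exact: measurableC.
  apply: fine_le; rewrite ?fin_num_measure//; [exact/measurableC/mstays| |].
    by rewrite fin_numD !fin_num_measure//; exact: measurableC.
  apply: (@le_trans _ _ (P (S `|` ~` slow x eta T%:R N0))).
    apply: le_measure; rewrite ?inE//; first exact/measurableC/mstays.
    by move=> omega nK; have [sl|nsl] := pselect (slow x eta T%:R N0 omega); [left|right].
  by apply: measureU2 => //; exact: measurableC.
have sq0 : 0 <= ks ^+ 2 by exact: sqr_ge0.
have h1 := ler_wpM2l sq0 PE.
have h2 := ler_wpM2l sq0 Pslow.
have h3 := ler_wpM2l c20 PBad.
have h4 := ler_wpM2l MT0 Pslow.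
have h5 := ler_wpM2l MT0 Pfar.
have h6 := ler_wpM2l ET0 eta_le_a.
have step : N%:R * ((1 + k^-1) * (cf * Delta) ^+ 2 + k * (c ^+ 2 * Delta)) =
    (1 + k^-1) * cf ^+ 2 * T%:R * Delta + c ^+ 2 * T%:R * k.
  transitivity ((1 + k^-1) * cf ^+ 2 * (N%:R * Delta * Delta) + c ^+ 2 * (N%:R * Delta) * k).
    by ring.
  by rewrite NDelta; ring.
rewrite step in EE; rewrite ELB in iL; rewrite EUB in iU.
have qe : 9 * q = e by rewrite /q mulrC divfK.
have lowE : low <= 4 * delta ^+ 2 + q by rewrite /low lerD2l !mulrA in eta1q *.
have upE : up <= C1 * delta ^+ 2 + E * B * B * T%:R * Delta + 3 * q.
  by apply: upper_budget => //; exact: le_trans h6 eaq.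
rewrite -qe mulrDl.
apply: (exit_budget h1 h2 h3 h4 h5 iL iU EE kq p1q Dq p2q p3q lowE upE).
Qed.

End ExitEnergy.

End OneSolution.

(** Chebyshev's inequality for the neutral variable at the exit.  The bound [K0] keeps
    [(2 K)^(alpha - 1)], the factor of the nonlinearity before the exit, below
    [kappa0]. *)
Lemma exit_probability (r : R) : (forall u, 0 <= u -> rho_mass u <= r) -> r < 1 ->
  exists K0 C, [/\ 0 < K0, 0 <= C & forall phi x K delta,
    in_H2 P F n hd tau phi -> is_solution P F w n hd tau a' b' sigma' g phi x ->
    0 < K -> K <= K0 -> 0 <= delta -> delta <= K ->
    {ae P, forall omega, (sup_norm `[(- H)%R, 0%R] (phi ^~ omega) < delta%:E)%E} ->
    forall T : nat, fine (P (~` stays x K T%:R)) <= C * (delta / K) ^+ 2].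
Proof.
move=> rle r1; have [kappa0 [C1 [E [k0 C10 E0 est]]]] := grid_energy_bound nu_fin nu_G0.
have a1 : 0 < alpha - 1 by rewrite subr_gt0.
(* [K0] solves [(2 K0)^(alpha - 1) = kappa0]. *)
exists (kappa0 `^ (alpha - 1)^-1 / 2), ((C1 + 4) * (4 / (1 - r) ^+ 2)); split.
- by rewrite divr_gt0// powR_gt0.
- by rewrite mulr_ge0 ?addr_ge0// divr_ge0// sqr_ge0.
move=> phi x K delta pH2 sol K0 KK0 d0 dK small T.
have B0 : 0 <= 2 * K by rewrite mulr_ge0// ltW.
have kap : (2 * K) `^ (alpha - 1) <= kappa0.
  rewrite -[leRHS]powRr1 ?(ltW k0)// -[X in kappa0 `^ X](@mulVf _ (alpha - 1)) ?gt_eqF//.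
  rewrite powRrM ge0_ler_powR ?nnegrE ?powR_ge0// ?(ltW a1)//.
  by move: KK0; rewrite ler_pdivlMr// mulrC.
have [_ [x_ad x_co] _ _ _] := sol.
have Fm t : 0 <= t -> F t `<=` measurable by case: F_filtration => _ + _; exact.
have ms i : measurable (~` stays x K i%:R).
  apply: measurableC; apply: (Fm i%:R) => //; exact: (stays_adapted F_filtration x_ad).
apply: (@le_trans _ _ (fine (P (~` stays x K T.+1%:R)))).
  apply: fine_le; rewrite ?fin_num_measure//; apply: le_measure; rewrite ?inE// => omega.
  apply: contra_not => /(staysP x_co) st; apply/(staysP x_co) => u u0 uT.
  by apply: st => //; rewrite (le_trans uT)// ler_nat.
have en := exit_energy pH2 sol B0 K0 erefl d0 dK (ltn0Sn T) rle r1 C10 E0 est kap small.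
have {}en : ((1 - r) * K / 2) ^+ 2 * fine (P (~` stays x K T.+1%:R)) <= (C1 + 4) * delta ^+ 2.
  by apply/ler_addgt0Pr => e e0; exact: en.
have r0 : 1 - r != 0 by rewrite subr_eq0 gt_eqF.
have ks : 0 < ((1 - r) * K / 2) ^+ 2 by rewrite exprn_gt0// divr_gt0// mulr_gt0// subr_gt0.
rewrite -(ler_pM2l ks) (le_trans en)// le_eqVlt; apply/predU1P; left.
by field; rewrite r0 gt_eqF.
Qed.

End Solution.
End Lyapunov.
End NeutralForm.

(** * Extension of the coefficients *)

Lemma bm_of_bounded {R : realType} (D : set R) (f : R -> R) : measurable D ->
  measurable_fun D f -> [bounded f t | t in D] -> bm (f \_ D).
Proof.
move=> mD mf [M [_ fM]]; apply: (bm_patch (M := M + 1)) => // t Dt.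
by apply: (fM (M + 1)); rewrite ?ltrDl.
Qed.

Section GlobalCoefficients.
Context {R : realType}.
Local Notation mu := (@lebesgue_measure R).
Variables (n n1 n2 : nat) (hd : nat -> R) (tau : R) (a b : nat -> R -> R).
Hypothesis hd0 : hd 0%N = 0.
Hypothesis hd_gt0 : forall k, (1 <= k <= n)%N -> 0 < hd k.
Hypothesis tau_ge0 : 0 <= tau.
Hypothesis n1_le : (n1 <= n)%N.
Hypothesis n2_le : (n2 <= n)%N.
Local Notation H := (max_delay n hd tau).

Lemma tau_le_max_delay : tau <= H.
Proof. exact: bigmax_ge_id. Qed.

Lemma hd_le_max_delay k : (1 <= k <= n)%N -> hd k <= H.
Proof. by move=> kn; apply: le_bigmax_seq => //; rewrite mem_index_iota. Qed.

(** The coefficients are continued by [0] to the whole line, where bounded measurable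
    functions are available; the equation and the criterion only use them where they
    agree. *)
Definition extended_a k : R -> R := if (k <= n)%N then (a k) \_ `[0, +oo[ else fun=> 0.

Definition extended_b k : R -> R :=
  if (1 <= k <= n)%N then (b k) \_ `[- H, +oo[ else fun=> 0.

Lemma extended_aE k t : (k <= n)%N -> 0 <= t -> a k t = extended_a k t.
Proof. by move=> kn t0; rewrite /extended_a kn patchE ifT// inE/= in_itv/= t0. Qed.

Lemma extended_bE k t : (1 <= k <= n)%N -> - H <= t -> b k t = extended_b k t.
Proof. by move=> kn tH; rewrite /extended_b kn patchE ifT// inE/= in_itv/= tH. Qed.

Hypothesis a_meas : forall k, (k <= n)%N -> measurable_fun (`[0, +oo[ : set R) (a k).
Hypothesis a_bnd : forall k, (k <= n)%N -> [bounded a k t | t in `[0, +oo[].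
Hypothesis b_meas : forall k, (1 <= k <= n)%N ->
  measurable_fun (`[- max_delay n hd tau, +oo[ : set R) (b k).
Hypothesis b_bnd : forall k, (1 <= k <= n)%N ->
  [bounded b k t | t in `[- max_delay n hd tau, +oo[].

Lemma bm_extended_a k : bm (extended_a k).
Proof.
rewrite /extended_a; case: ifPn => kn; last exact: bm_cst.
by apply: bm_of_bounded; [exact: measurable_itv|exact: a_meas|exact: a_bnd].
Qed.

Lemma bm_extended_b k : bm (extended_b k).
Proof.
rewrite /extended_b; case: ifPn => kn; last exact: bm_cst.
by apply: bm_of_bounded; [exact: measurable_itv|exact: b_meas|exact: b_bnd].
Qed.

Local Notation ea := extended_a.
Local Notation eb := extended_b.

Let H_ge0 : 0 <= H. Proof. exact: le_trans tau_le_max_delay. Qed.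

Let hd_ge0 k : (k <= n)%N -> 0 <= hd k.
Proof. by case: k => [_|k kn]; [rewrite hd0|rewrite ltW// hd_gt0]. Qed.

Let window k t s : (1 <= k <= n)%N -> 0 <= t -> t - hd k <= s -> - H <= s.
Proof.
move=> kn t0; apply: le_trans; rewrite (@le_trans _ _ (0 - hd k)) ?lerD2r//.
by rewrite sub0r lerN2 hd_le_max_delay.
Qed.

Lemma extended_Ssum t : 0 <= t -> Ssum n1 n2 hd ea eb t = Ssum n1 n2 hd a b t.
Proof.
move=> t0; rewrite /Ssum; congr (_ + _).
  rewrite big_nat_cond [RHS]big_nat_cond; apply: eq_bigr => k; rewrite andbT ltnS => kn1.
  have kn := leq_trans kn1 n1_le; rewrite -extended_aE// addr_ge0// hd_ge0//.
rewrite big_nat_cond [RHS]big_nat_cond; apply: eq_bigr => k; rewrite andbT ltnS => /andP[k1 kn2].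
by rewrite -extended_bE ?k1 ?(leq_trans kn2)// (le_trans _ t0)// oppr_le0.
Qed.

Lemma extended_rho k t s : (1 <= k <= n)%N -> 0 <= t -> t - hd k <= s -> s <= t ->
  rho n1 n2 hd ea eb k t s = Rker n1 n2 hd a b k t s * Iind k 1 (maxn n1 n2).
Proof.
move=> kn t0 ts st; have /andP[k1 kn'] := kn.
have hk := hd_ge0 kn'.
rewrite /rho -extended_aE//; last by rewrite (le_trans t0)// -lerBlDr.
rewrite -extended_bE//; last exact: window ts.
rewrite clamp0_id; last by apply/andP; split; lra.
rewrite /Iind k1/= leq_max /Rker leq_min.
have [kn1|kn1] := leqP k n1; have [kn2|kn2] := leqP k n2; rewrite /= ?mulr1 ?mulr0 ?mul1r ?mul0r ?addr0 ?add0r//.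
- by rewrite (leq_trans kn2 kn1).
- by rewrite ltnNge (leq_trans (ltnW kn1) kn2).
Qed.

Let bra : forall k, bm (ea k) := bm_extended_a.
Let brb : forall k, bm (eb k) := bm_extended_b.

Lemma extended_rho_mass t : 0 <= t -> rho_mass n n1 n2 hd ea eb t = Rsum n1 n2 hd a b t.
Proof.
move=> t0; rewrite /Rsum (@sum_nat_le _ _ n); last by rewrite geq_max n1_le.
rewrite /rho_mass big_nat_cond [RHS]big_nat_cond; apply: eq_bigr => k; rewrite andbT => kn.
have br := bm_norm (bm_rho_sec n1 n2 hd bra brb k t).
rewrite -(itg_cc _ _ br); case: ifPn => km; last first.
  rewrite (_ : \int[mu]_(s in _) _ = \int[mu]_(s in `[t - hd k, t]) 0).
    by rewrite Rintegral_cst ?mul0r.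
  apply: eq_Rintegral => s; rewrite inE/= in_itv/= => /andP[ts st].
  by rewrite extended_rho// /Iind (negbTE km) andbF mulr0 normr0.
apply: eq_Rintegral => s; rewrite inE/= in_itv/= => /andP[ts st].
by rewrite extended_rho// /Iind km andbT; case/andP: kn => -> _; rewrite mulr1.
Qed.

Lemma extended_rho0 k t s : (1 <= k <= n)%N -> 0 <= t -> t - hd k <= s -> s <= t ->
  rho0 n1 n2 hd ea eb k t s = Rker0 n n1 n2 hd a b k t s.
Proof.
move=> kn t0 ts st; rewrite /rho0 /Rker0 extended_Ssum// extended_rho// -extended_bE//.
  by rewrite mulrA /Iind; case/andP: kn => _ ->; rewrite andbT [_%:R * _]mulrC.
exact: window ts.
Qed.

Lemma extended_P0 t : 0 <= t -> P0 n n1 n2 hd ea eb t = Psum0 n n1 n2 hd a b t.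
Proof.
move=> t0; rewrite /P0 /Psum0; congr (_ + _).
  rewrite big_nat_cond [RHS]big_nat_cond; apply: eq_bigr => k; rewrite andbT ltnS => /andP[_ kn].
  by rewrite -extended_aE.
rewrite big_nat_cond [RHS]big_nat_cond; apply: eq_bigr => k; rewrite andbT ltnS => /andP[k2 kn].
have kn1 : (1 <= k <= n)%N by rewrite kn andbT (leq_trans _ k2).
rewrite -(itg_cc _ _ (bm_norm (brb k))); apply: eq_Rintegral => s.
rewrite inE/= in_itv/= => /andP[ts st].
by rewrite -extended_bE//; exact: window ts.
Qed.

Lemma extended_Q0 k u t : (1 <= k <= n)%N -> 0 <= t -> t <= u -> u <= t + hd k ->
  Q0 n n1 n2 hd ea eb k u t = Qker0 n n1 n2 hd a b k u t.
Proof.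
move=> kn t0 tu ut; have u0 := le_trans t0 tu; have ut' : u - hd k <= t by rewrite lerBlDr.
rewrite /Q0 /Qker0 extended_rho0// extended_P0// extended_rho// extended_rho_mass// -extended_bE//.
  rewrite normrM [`|Iind _ _ _|]ger0_norm ?ler0n// mulrA.
  congr (_ + _); have -> : Iind k n2.+1 n = (n2 < k)%N%:R :> R.
    by rewrite /Iind; case/andP: kn => _ ->; rewrite andbT.
  by rewrite -[RHS]mulrA [_%:R * _]mulrC.
exact: window ut'.
Qed.

(** Every value that occurs has its arguments in the domain of the original coefficients,
    because the windows of times [t >= 0] reach back at most to the largest delay. *)
Lemma extended_criterion (sigma : R -> R) (c0 t : R) : 0 <= t ->
  \sum_(1 <= k < n.+1)
      (\int[mu]_(s in `[t - hd k, t]) `|Rker0 n n1 n2 hd a b k t s|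
       + \int[mu]_(u in `[t, t + hd k]) Qker0 n n1 n2 hd a b k u t)
   + \sum_(n1.+1 <= k < n.+1)
      (`|a k t| + (1 + Rsum n1 n2 hd a b (t + hd k)) * `|a k (t + hd k)|)
   + sigma (t + tau) ^+ 2 <= 2 * Ssum n1 n2 hd a b t - c0 ->
  \sum_(1 <= k < n.+1) (itg (fun s => `|rho0 n1 n2 hd ea eb k t s|) (t - hd k) t
     + itg (fun u => Q0 n n1 n2 hd ea eb k u t) t (t + hd k))
  + \sum_(n1.+1 <= k < n.+1)
      (`|ea k t| + (1 + rho_mass n n1 n2 hd ea eb (t + hd k)) * `|ea k (t + hd k)|)
  + (sigma \_ `[0, +oo[) (t + tau) ^+ 2 <= 2 * Ssum n1 n2 hd ea eb t - c0.
Proof.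
move=> t0; rewrite extended_Ssum//; apply: le_trans; rewrite le_eqVlt; apply/predU1P; left.
congr (_ + _ + _); last first.
- by rewrite patchE ifT// inE/= in_itv/= addr_ge0.
- rewrite big_nat_cond [RHS]big_nat_cond; apply: eq_bigr => k; rewrite andbT ltnS => /andP[_ kn].
  have tk : 0 <= t + hd k by rewrite addr_ge0// hd_ge0.
  by rewrite -!extended_aE// extended_rho_mass.
rewrite big_nat_cond [RHS]big_nat_cond; apply: eq_bigr => k; rewrite andbT => kn.
have br0 := bm_norm (bm_sec1 t (bm_rho0 n1 n2 hd bra brb k)).
have bQ := bm_sec2 t (bm_Q0 n n1 n2 hd bra brb k).
rewrite -(itg_cc _ _ br0) -(itg_cc _ _ bQ); congr (_ + _).
  apply: eq_Rintegral => s; rewrite inE/= in_itv/= => /andP[ts st].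
  by rewrite extended_rho0.
apply: eq_Rintegral => u; rewrite inE/= in_itv/= => /andP[tu ut].
by rewrite extended_Q0.
Qed.

End GlobalCoefficients.

(** * Stability in probability *)

Lemma ereal_pos_lb {R : realType} (e : \bar R) : (0 < e)%E -> exists2 r : R, 0 < r & (r%:E <= e)%E.
Proof.
case: e => [r| |//]; rewrite ?lte_fin => e0; first by exists r.
by exists 1 => //; rewrite leey.
Qed.

Lemma ereal_lt_ub {R : realType} (e : \bar R) (q : R) : (e < q%:E)%E ->
  exists2 r : R, r < q & (e <= r%:E)%E.
Proof.
case: e => [r| |] eq; [by exists r; rewrite -?lte_fin|by []|].
by exists (q - 1); [rewrite ltrBlDr ltrDl|rewrite leNye].
Qed.

Section ExitEvent.
Context {R : realType} {d : measure_display} {Omega : measurableType d}.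
Variables (P : probability Omega R) (F : R -> set_system Omega).
Hypothesis F_filtration : is_filtration F.
Variable x : R -> Omega -> R.
Hypothesis x_adapted : forall t, 0 <= t -> sub_measurable (F t) (x t).
Hypothesis x_continuous : forall omega, {within `[0, +oo[, continuous (x ^~ omega)}.

(** The exits before time [T] increase, as [T] grows, to the event that the supremum is
    exceeded. *)
Lemma sup_norm_probability (e1 K q : R) : K <= e1 ->
  (forall T : nat, fine (P (~` stays x K T%:R)) <= q) ->
  (P [set omega | (e1%:E < sup_norm `[0%R, +oo[ (x ^~ omega))%E] <= q%:E)%E.
Proof.
move=> Ke Pq.
have Fm t : 0 <= t -> F t `<=` measurable by case: F_filtration => _ + _; exact.
have ms C (T : nat) : measurable (~` stays x C T%:R).
  by apply: measurableC; apply: (Fm T%:R) => //; exact: (stays_adapted F_filtration x_adapted).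
have -> : [set omega | (e1%:E < sup_norm `[0%R, +oo[ (x ^~ omega))%E] =
    \bigcup_T ~` stays x e1 T%:R.
  apply/seteqP; split => omega /=.
    move=> /ereal_sup_gt[_ [u + <-]]; rewrite /= in_itv/= andbT lte_fin => u0 xu.
    exists (Num.truncn u).+1 => // /(staysP x_continuous) /(_ u u0).
    by rewrite ltW ?truncnS_gt// leNgt xu => /(_ isT).
  move=> [T _ nT]; rewrite ltNge; apply/negP => sup_le; apply: nT.
  apply/(staysP x_continuous) => u u0 uT; rewrite -lee_fin; apply: le_trans sup_le.
  by apply: ereal_sup_ubound; exists u => //; rewrite /= in_itv/= u0.
have mono : nondecreasing_seq (fun T : nat => ~` stays x e1 T%:R).
  move=> S T ST; apply/subsetPset => omega; apply: contra_not.
  move=> /(staysP x_continuous) H; apply/(staysP x_continuous) => u u0 uS.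
  by apply: H => //; rewrite (le_trans uS)// ler_nat.
have mU : measurable (\bigcup_T ~` stays x e1 T%:R) by apply: bigcupT_measurable => T; exact: ms.
have c := nondecreasing_cvg_mu (mu := P) (fun T => ms e1 T) mU mono.
apply: (cvge_to_le c); apply: nearW => T /=.
apply: (@le_trans _ _ (P (~` stays x K T%:R))).
  apply: le_measure; rewrite ?inE// => omega; apply: contra_not.
  move=> /(staysP x_continuous) H; apply/(staysP x_continuous) => u u0 uT.
  by apply: le_trans Ke; exact: H.
by rewrite -[leLHS]fineK ?fin_num_measure// lee_fin.
Qed.

End ExitEvent.

Theorem corollary3p1 (R : realType)
  (d : measure_display) (Omega : measurableType d) (P : probability Omega R)
  (F : R -> set_system Omega) (F_filtration : is_filtration F)
  (w : R -> Omega -> R) (w_wiener : is_wiener P F w)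
  (n : nat) (hd : nat -> R) (tau : R)
  (hd0 : hd 0%N = 0) (hd_gt0 : forall k, (1 <= k <= n)%N -> 0 < hd k)
  (tau_ge0 : 0 <= tau)
  (a b : nat -> R -> R) (sigma : R -> R)
  (a_meas : forall k, (k <= n)%N -> measurable_fun (`[0, +oo[ : set R) (a k))
  (a_bnd : forall k, (k <= n)%N -> [bounded a k t | t in `[0, +oo[])
  (b_meas : forall k, (1 <= k <= n)%N ->
     measurable_fun (`[- max_delay n hd tau, +oo[ : set R) (b k))
  (b_bnd : forall k, (1 <= k <= n)%N ->
     [bounded b k t | t in `[- max_delay n hd tau, +oo[])
  (sigma_meas : measurable_fun (`[0, +oo[ : set R) sigma)
  (sigma_bnd : [bounded sigma t | t in `[0, +oo[])
  (G : R -> R)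
  (G_nd : {in `[- max_delay n hd tau, 0] &, {homo G : s t / s <= t}})
  (G_bv : bounded_variation (- max_delay n hd tau) 0 G)
  (G_fin : (\int[stieltjes_measure G_nd]_(s in `[(- max_delay n hd tau)%R, 0%R]) 1
              < +oo)%E)
  (alpha : R) (alpha_gt1 : 1 < alpha)
  (g : R -> (R -> R) -> R)
  (g_growth : forall t (f : R -> R), 0 <= t ->
     measurable_fun (`[- max_delay n hd tau, 0] : set R) f ->
     (`|g t (f \_ `[(- max_delay n hd tau)%R, 0%R])|%:E <=
       \int[stieltjes_measure G_nd]_(s in `[(- max_delay n hd tau)%R, 0%R])
         (`|f s| `^ alpha)%:E)%E)
  (n1 n2 : nat) (n1_le : (n1 <= n)%N) (n2_le : (n2 <= n)%N) :
  let mu := @lebesgue_measure R in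
  let S := Ssum n1 n2 hd a b in
  let Rt := Rsum n1 n2 hd a b in
  let R0 := Rker0 n n1 n2 hd a b in
  let Q0 := Qker0 n n1 n2 hd a b in
  (0 < ereal_inf [set (S t)%:E | t in `[0%R, +oo[])%E ->
  (ereal_sup [set (S t)%:E | t in `[0%R, +oo[] < +oo)%E ->
  (ereal_sup [set (Rt t)%:E | t in `[0%R, +oo[] < 1)%E ->
  (ereal_sup
     [set ((S t)^-1 *
        (\sum_(1 <= k < n.+1)
            (\int[mu]_(s in `[t - hd k, t]) `|R0 k t s|
             + \int[mu]_(u in `[t, t + hd k]) Q0 k u t)
         + \sum_(n1.+1 <= k < n.+1)
            (`|a k t| + (1 + Rt (t + hd k)) * `|a k (t + hd k)|)
         + sigma (t + tau) ^+ 2))%:E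
     | t in `[0%R, +oo[] < 2%:E)%E ->
  stable_in_probability P F w n hd tau a b sigma g.
Proof.
move=> mu S Rt R0 Q0 infS _ supR supC.
have [s0 s0_gt0 s0_le] := ereal_pos_lb infS.
have half t : 0 <= t -> (`[0, +oo[%classic : set R) t by move=> t0; rewrite /= in_itv/= t0.
have S_ge t : 0 <= t -> s0 <= S t.
  move=> t0; rewrite -lee_fin; apply: (le_trans s0_le).
  by apply: ereal_inf_lbound; exists t => //; exact: half.
have [r r_lt1 r_ge] := ereal_lt_ub supR.
have Rt_le t : 0 <= t -> Rt t <= r.
  move=> t0; rewrite -lee_fin; apply: le_trans r_ge.
  by apply: ereal_sup_ubound; exists t => //; exact: half.
have [q q_lt2 q_ge] := ereal_lt_ub supC.
have c0_gt0 : 0 < (2 - q) * s0 by rewrite mulr_gt0// subr_gt0.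
pose H := max_delay n hd tau.
pose ea := extended_a n a; pose eb := extended_b n hd tau b.
have bea k : bm (ea k) by exact: bm_extended_a.
have beb k : bm (eb k) by exact: bm_extended_b.
have bes : bm (sigma \_ `[0, +oo[) by apply: bm_of_bounded => //; exact: measurable_itv.
have hd_ge0 k : (1 <= k <= n)%N -> 0 <= hd k by move=> kn; rewrite ltW ?hd_gt0.
pose nu : {sigma_finite_measure set (measurableTypeR R) -> \bar R} :=
  lebesgue_stieltjes_measure (stieltjes_distribution G_nd).
pose I := (`[(- H)%R, 0%R]%classic : set (measurableTypeR R)).
have nu_fin : (nu I < +oo)%E.
  by move: G_fin; rewrite integral_cst ?mul1e//; exact: measurable_itv.
have G0_ge0 : 0 <= fine (nu I) by rewrite fine_ge0.
have crit t : 0 <= t ->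
  \sum_(1 <= k < n.+1)
      (\int[mu]_(s in `[t - hd k, t]) `|R0 k t s| + \int[mu]_(u in `[t, t + hd k]) Q0 k u t)
   + \sum_(n1.+1 <= k < n.+1) (`|a k t| + (1 + Rt (t + hd k)) * `|a k (t + hd k)|)
   + sigma (t + tau) ^+ 2 <= 2 * S t - (2 - q) * s0.
  move=> t0; set lhs := (X in X <= _).
  have S0 : 0 < S t by exact: lt_le_trans (S_ge t t0).
  have : (S t)^-1 * lhs <= q.
    rewrite -lee_fin; apply: le_trans q_ge.
    by apply: ereal_sup_ubound; exists t => //; exact: half.
  rewrite mulrC ler_pdivrMr// => lq; apply: (le_trans lq).
  have : (2 - q) * s0 <= (2 - q) * S t by rewrite ler_pM2l ?subr_gt0// S_ge.
  by lra.
have ecrit t (t0 : 0 <= t) := extended_criterion hd0 hd_gt0 tau_ge0 n1_le n2_le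
  a_meas a_bnd b_meas b_bnd t0 (crit t t0).
have rle u : 0 <= u -> rho_mass n n1 n2 hd ea eb u <= r.
  move=> u0; rewrite (extended_rho_mass hd0 hd_gt0 n1_le n2_le a_meas a_bnd b_meas b_bnd)//.
  exact: Rt_le.
have sE t : 0 <= t -> sigma t = (sigma \_ `[0, +oo[) t.
  by move=> t0; rewrite patchE ifT// inE/= in_itv/= t0.
have [K0 [C [K0_gt0 C_ge0 exitP]]] := exit_probability n1_le n2_le hd0 hd_ge0 bea beb bes
  tau_ge0 (tau_le_max_delay n hd tau) (@hd_le_max_delay _ n hd tau) c0_gt0 G0_ge0 ecrit
  F_filtration w_wiener nu_fin erefl (fun k t => @extended_aE _ n a k t)
  (fun k t => @extended_bE _ n hd tau b k t) sE erefl alpha_gt1 g_growth rle r_lt1.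
move=> e1 e2 e1_gt0 e2_gt0.
pose K : R := Num.min K0 e1; have K_gt0 : 0 < K by rewrite lt_min K0_gt0.
have Kn : K != 0 by rewrite gt_eqF.
(* [m <= 1] gives [C m ^ 2 <= C m], which is below [e2 / 2]. *)
pose m := Num.min 1 (e2 / (2 * (C + 1))).
have C1 : 0 < 2 * (C + 1) by rewrite mulr_gt0// ltr_wpDl.
have m_gt0 : 0 < m by rewrite lt_min ltr01 divr_gt0.
have m_le1 : m <= 1 by rewrite ge_min lexx.
have Cm : C * m ^+ 2 <= e2 / 2.
  apply: (@le_trans _ _ (C * m)).
    by rewrite ler_wpM2l// expr2 ger_pMr.
  apply: (@le_trans _ _ ((C + 1) * (e2 / (2 * (C + 1))))).
    by rewrite ler_pM ?lerDl ?(ltW m_gt0)// ge_min lexx orbT.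
  rewrite le_eqVlt; apply/predU1P; left; field.
  by rewrite gt_eqF// ltr_wpDl.
exists (K * m); first exact: mulr_gt0.
move=> phi x phiH xs small.
have [_ [x_ad x_co] _ _ _] := xs.
apply: (@le_lt_trans _ _ (e2 / 2)%:E); last by rewrite lte_fin ltr_pdivrMr// ltr_pMr// ltr1n.
have K_le : K <= e1 by rewrite ge_min lexx orbT.
apply: (@sup_norm_probability _ _ _ P F F_filtration x x_ad x_co e1 K (e2 / 2) K_le).
move=> T; apply: le_trans Cm.
have Km : K * m / K = m by rewrite mulrAC divff// mul1r.
rewrite -[X in C * X ^+ 2]Km; apply: (exitP phi x K (K * m)) => //.
- by rewrite ge_min lexx.
- by rewrite mulr_ge0// ltW.
- by rewrite ger_pMr.
Qed.
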